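(* Let $\mathcal{N}$ be an open subset of a Fréchet space $E$, let $(G,\Gamma)$ be a weak pseudo-Riemannian structure with Levi-Civita connection on $\mathcal{N}$, let $V\in C^\infty(\mathcal{N})$ admit a $G$-gradient $\operatorname{grad}V$, and let $L(g,k)=\tfrac12G_g(k,k)-V(g)$ be the associated mechanical Lagrangian on $\mathcal{N}\times E$. Let $I\subset\mathbb{R}$ be an open interval and $c\in C^\infty(I,\mathcal{N})$. Then for every variation with compact support $c_\bullet$ of $c$, with generator $A$ and associated compact set $K\subset I$, and every relatively compact open $J\subset I$ containing $K$, $$\frac{d}{ds}\Big|_{s=0}\int_J L(c_s(t),c'_s(t))\,dt=-\int_J G_{c(t)}\Bigl(\nabla_{\partial_t}c'(t)+\operatorname{grad}V(c(t)),\,A(t)\Bigr)dt,$$ and $c$ is critical for $L$ if and only if $$\nabla_{\partial_t}c'=-\operatorname{grad}V(c),\qquad\text{that is,}\qquad c''=\Gamma_c(c',c')-\operatorname{grad}V(c).$$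
   Context: Smoothness is in the convenient sense: a map between open subsets of Fréchet spaces is smooth if it sends smooth curves to smooth curves. $L^2_{\mathrm{sym}}(E;F)$ is the space of continuous symmetric bilinear maps $E\times E\to F$; a map from $\mathcal{N}$ into it is smooth when the joint evaluation $\mathcal{N}\times E\times E\to F$ is smooth. A weak pseudo-Riemannian structure with Levi-Civita connection on $\mathcal{N}$ is a pair $(G,\Gamma)$ where $G\colon\mathcal{N}\to L^2_{\mathrm{sym}}(E;\mathbb{R})$ is smooth with each $G_g$ weakly non degenerate ($G_g(h,k)=0$ for all $k\in E$ implies $h=0$), and $\Gamma\colon\mathcal{N}\to L^2_{\mathrm{sym}}(E;E)$ is smooth and satisfies, for all $g\in\mathcal{N}$ and $l,h,k\in E$, $$DG(g)(l)(h,k)+G_g(\Gamma_g(l,h),k)+G_g(h,\Gamma_g(l,k))=0.$$ The covariant derivative of a vector field $h(t)$ along a curve $c(t)$ is $\nabla_{\partial_t}h=h'-\Gamma_{c(t)}(c'(t),h(t))$. A function $V\in C^\infty(\mathcal{N})$ admits a $G$-gradient if there is a smooth $\operatorname{grad}V\colon\mathcal{N}\to E$ with $dV(g)(h)=G_g(\operatorname{grad}V(g),h)$ for all $g\in\mathcal N$, $h\in E$. A variation with compact support of $c$ is a smooth map $c_\bullet\colon\mathbb{R}\times I\to\mathcal{N}$, $(s,t)\mapsto c_s(t)$, with $c_0=c$ and such that there is a compact $K\subset I$ with $c_s(t)=c(t)$ for all $s$ and all $t\notin K$; its generator is $A=\partial_s|_{s=0}c_s\in C^\infty(I,E)$. The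 curve $c$ is critical for $L$ if for every variation with compact support $c_\bullet$ of $c$, and some (equivalently, any) relatively compact open $J\subset I$ containing $K$, $\frac{d}{ds}\big|_{s=0}\int_J L(c_s,c_s')\,dt=0$, where $c_s'=\partial_tc_s$. *)

(* Defs.v *)
From HB Require Import structures.
From mathcomp Require Import all_boot all_order all_algebra.
From mathcomp Require Import all_classical all_reals all_analysis.
Set Implicit Arguments.
Unset Strict Implicit.
Unset Printing Implicit Defensive.
Import Order.TTheory GRing.Theory Num.Theory.
Import numFieldNormedType.Exports.

Local Open Scope classical_set_scope.
Local Open Scope ring_scope.

(* A Frechet space is a Hausdorff, first countable (hence metrizable), complete
   locally convex space.  Completeness refers to the translation-invariant
   uniformity, expressed on differences: [tvsType] does not require its
   [entourage] to be invariant, so the library's [cauchy] cannot be used. *)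
HB.mixin Record Tvs_isFrechet (R : numDomainType) E & Tvs R E := {
  frechet_hausdorff : hausdorff_space E ;
  frechet_countable : exists B : nat -> set E,
    (forall n, nbhs (0 : E) (B n)) /\
    (forall U, nbhs (0 : E) U -> exists n, B n `<=` U) ;
  frechet_complete : forall u : nat -> E,
    (u mn.1 - u mn.2) @[mn --> (\oo, \oo)] --> (0 : E) ->
    exists l : E, u n @[n --> \oo] --> l
}.

#[short(type="frechetType")]
HB.structure Definition Frechet (R : numDomainType) :=
  {E of Tvs_isFrechet R E & Tvs R E}.

Section Smooth.
Context {R : realType}.

(* The library's [derivable] and [derive] (and [lim], which wants a pointed
   type) are restricted to normed modules; these are the same notions for
   topological vector spaces. *)
Definition tvs_derivable {E F : tvsType R} (f : E -> F) (x v : E) : Prop :=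
  exists l : F, h^-1 *: (f (h *: v + x) - f x) @[h --> (0 : R)^'] --> l.

Definition tvs_derive {E F : tvsType R} (f : E -> F) (x v : E) : F :=
  xget 0 [set l : F | h^-1 *: (f (h *: v + x) - f x) @[h --> (0 : R)^'] --> l].

Definition curve_derive {F : tvsType R} (c : R -> F) : R -> F :=
  fun t => tvs_derive (E := R) c t 1.

Definition smooth_curve {F : tvsType R} (c : R -> F) : Prop :=
  forall (n : nat) (t : R), tvs_derivable (E := R) (iter n curve_derive c) t 1.

(* Smoothness of [f : U -> F], [U] open: only the values of [f] on [U] matter. *)
Definition conv_smooth {E F : tvsType R} (U : set E) (f : E -> F) : Prop :=
  forall gamma : R -> E, smooth_curve gamma -> (forall t, U (gamma t)) ->
    smooth_curve (f \o gamma).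

Definition in_L2sym {E F : tvsType R} (b : E -> E -> F) : Prop :=
  [/\ forall h k, b h k = b k h,
      forall h, linear (b h) &
      continuous (fun p : E * E => b p.1 p.2)].

Definition smooth_L2sym {E F : tvsType R} (N : set E) (B : E -> E -> E -> F) :=
  (forall g, N g -> in_L2sym (B g)) /\
  conv_smooth (E := (E * E * E)%type) (N `*` setT `*` setT)
    (fun p : E * E * E => B p.1.1 p.1.2 p.2).

End Smooth.

Section Mechanics.
Context {R : realType} {E : frechetType R}.

Record weak_pseudo_riemannian_LC (N : set E) (G : E -> E -> E -> R)
    (Gamma : E -> E -> E -> E) : Prop := {
  metric_smooth : smooth_L2sym N G ;
  metric_nondegenerate : forall g, N g ->
    forall h, (forall k, G g h k = 0) -> h = 0 ;
  christoffel_smooth : smooth_L2sym N Gamma ;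
  levi_civita : forall g, N g -> forall l h k,
    tvs_derive (fun g' => G g' h k) g l
      + G g (Gamma g l h) k + G g h (Gamma g l k) = 0
}.

Definition covariant_derive (Gamma : E -> E -> E -> E) (c h : R -> E) (t : R) : E :=
  curve_derive h t - Gamma (c t) (curve_derive c t) (h t).

Definition is_G_gradient (N : set E) (G : E -> E -> E -> R) (V : E -> R)
    (gradV : E -> E) : Prop :=
  conv_smooth N gradV /\
  forall g, N g -> forall h, tvs_derive V g h = G g (gradV g) h.

Definition mechanical_lagrangian (G : E -> E -> E -> R) (V : E -> R) (g k : E) : R :=
  2^-1 * G g k k - V g.

(* A variation [(s, t) |-> c_s t] on [R x I] is encoded as [cs s t], with [cs]
   total and unconstrained for [t] outside [I]. *)
Definition compact_variation (N : set E) (I : set R) (c : R -> E)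
    (cs : R -> R -> E) (K : set R) : Prop :=
  [/\ conv_smooth (E := (R * R)%type) (setT `*` I) (fun p : R * R => cs p.1 p.2),
      forall s t, I t -> N (cs s t),
      forall t, I t -> cs 0 t = c t,
      compact K /\ K `<=` I &
      forall s t, I t -> ~ K t -> cs s t = c t].

Definition generator (cs : R -> R -> E) (t : R) : E :=
  curve_derive (fun s => cs s t) 0.

(* [J] is open and relatively compact as a subset of [I]: its closure is
   compact and does not reach the endpoints of [I]. *)
Definition relatively_compact_open (I J : set R) : Prop :=
  [/\ open J, precompact J & closure J `<=` I].

Definition action (L : E -> E -> R) (J : set R) (c : R -> E) : R :=
  \int[lebesgue_measure]_(t in J) L (c t) (curve_derive c t).

Definition critical (L : E -> E -> R) (N : set E) (I : set R) (c : R -> E) : Prop :=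
  forall cs K, compact_variation N I c cs K ->
  exists J, [/\ relatively_compact_open I J, K `<=` J &
    is_derive (0 : R) (1 : R) (fun s => action L J (cs s)) 0].

End Mechanics.

(* Main.v *)
(* The integrand is differentiated through one-variable calculus. Locally, the
   derivatives of a convenient smooth map of the plane along a fixed direction
   are bounded: otherwise the special curve lemma yields a smooth curve along
   which they blow up. Comparing Taylor expansions in the directions [(i, 1)]
   with expansions along the first axis, the first-axis derivatives are locally
   Lipschitz in the second variable. As E is complete, a limit of curves with
   locally bounded derivatives is smooth, so the difference quotients in the
   second variable converge to a smooth partial derivative, and the partial
   derivatives commute; Hadamard's lemma then gives the chain rule. The first
   variation is now the classical computation: symmetry of second derivatives,
   the Levi-Civita identity twice, and the vanishing of the boundary term
   [G (c', A)]. If the Euler-Lagrange defect [D] is nonzero at [t0], choose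
   [k] with [G (D, k) > 0] at [t0] and vary [c] by a bump times [k]. *)

(* Convenient smoothness provides no derivative of [G] or [V] beforehand; it only says that
   composites with smooth curves are smooth. Every differential is therefore recovered from maps of
   two real variables, where the only tool is the choice of a test curve. Such a curve sees
   derivatives along one fixed direction at a time, so the dependence on v of the derivatives in u
   has to be read off from several directions at once; the weights of the n-th finite difference
   isolate it. The resulting estimate excludes the step 0, so a Lipschitz bound comes from two
   values of v, both reached from a common third point. All estimates are made for one continuous
   seminorm at a time, and the mean value inequality is proved for seminorms directly, without
   linear functionals. Cutoffs recur because test curves and variations have to be defined for all
   real parameters, while the data live on open subsets. *)
Require Import Defs.
From HB Require Import structures.
From mathcomp Require Import all_boot all_order all_algebra.
From mathcomp Require Import all_classical all_reals all_analysis.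
From mathcomp Require Import ring lra.
Set Implicit Arguments.
Unset Strict Implicit.
Unset Printing Implicit Defensive.
Import Order.TTheory GRing.Theory Num.Theory.
Import numFieldNormedType.Exports.

Local Open Scope classical_set_scope.
Local Open Scope ring_scope.

(** * Linear identities in modules *)

(* [lmod_eq] proves an equality of linear combinations in a module by comparing
   the coefficients of each atom with [field]. *)
Inductive lmod_expr (R : Type) :=
  | LVar of nat | LZero | LAdd of lmod_expr R & lmod_expr R | LOpp of lmod_expr R
  | LScale of R & lmod_expr R.
Arguments LVar {R}.
Arguments LZero {R}.

Section LmodExpr.
Context {R : comNzRingType} {E : lmodType R}.

Fixpoint lmod_eval (env : seq E) (e : lmod_expr R) : E :=
  match e with
  | LVar i => nth 0 env i
  | LZero => 0
  | LAdd e1 e2 => lmod_eval env e1 + lmod_eval env e2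
  | LOpp e1 => - lmod_eval env e1
  | LScale a e1 => a *: lmod_eval env e1
  end.

(** [Nat.eqb] lets [cbv] with a short list of constants compute every coefficient without unfolding
    the scalars, which are left to [field]. *)
Fixpoint lmod_coef (i : nat) (e : lmod_expr R) : R :=
  match e with
  | LVar j => if Nat.eqb i j then 1 else 0
  | LZero => 0
  | LAdd e1 e2 => lmod_coef i e1 + lmod_coef i e2
  | LOpp e1 => - lmod_coef i e1
  | LScale a e1 => a * lmod_coef i e1
  end.

Fixpoint lmod_coef_eq (n : nat) (e1 e2 : lmod_expr R) : Prop :=
  match n with
  | 0 => True
  | S m => lmod_coef m e1 = lmod_coef m e2 /\ lmod_coef_eq m e1 e2
  end.

Lemma lmod_evalE env e :
  lmod_eval env e = \sum_(i < size env) lmod_coef i e *: nth 0 env i.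
Proof.
elim: e => [j||e1 + e2 +|e1 +|a e1 +] /=; do ?[move=> ->].
- have [jn|nj] := ltnP j (size env).
    rewrite (bigD1 (Ordinal jn))//= big1 ?addr0 => [|i ij].
      by rewrite PeanoNat.Nat.eqb_refl scale1r.
    case: PeanoNat.Nat.eqb_spec => [ji|_]; last by rewrite scale0r.
    by case/eqP: ij; apply: val_inj.
  rewrite nth_default// big1// => i _.
  case: PeanoNat.Nat.eqb_spec => [ij|_]; last by rewrite scale0r.
  by have := ltn_ord i; rewrite ij ltnNge nj.
- by rewrite big1// => i _; rewrite scale0r.
- by rewrite -big_split; apply: eq_bigr => i _; rewrite scalerDl.
- by rewrite -sumrN; apply: eq_bigr => i _; rewrite scaleNr.
- by rewrite scaler_sumr; apply: eq_bigr => i _; rewrite scalerA.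
Qed.

Lemma lmod_eval_eq env e1 e2 :
  lmod_coef_eq (size env) e1 e2 -> lmod_eval env e1 = lmod_eval env e2.
Proof.
move=> h; rewrite !lmod_evalE; apply: eq_bigr => i _; congr (_ *: _).
elim: (size env) h (nat_of_ord i) (ltn_ord i) => // n IH /= [h1 h2] j.
by rewrite ltnS leq_eqVlt => /predU1P[->//|]; exact: IH.
Qed.

End LmodExpr.

Ltac lmod_index x env :=
  lazymatch env with
  | nil => fail
  | cons ?y ?s => match goal with
      | _ => let _ := match goal with _ => constr_eq x y end in constr:(0%N)
      | _ => let i := lmod_index x s in constr:(S i)
      end
  end.
Ltac lmod_atoms t env :=
  lazymatch t with
  | @Algebra.zero _ => env
  | @Algebra.add _ ?a ?b => let env' := lmod_atoms a env in lmod_atoms b env'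
  | @Algebra.opp _ ?a => lmod_atoms a env
  | @GRing.scale _ _ _ ?a => lmod_atoms a env
  | _ => match goal with
      | _ => let _ := lmod_index t env in env
      | _ => constr:(cons t env)
      end
  end.
Ltac lmod_reify R t env :=
  lazymatch t with
  | @Algebra.zero _ => constr:(@LZero R)
  | @Algebra.add _ ?a ?b =>
      let a' := lmod_reify R a env in let b' := lmod_reify R b env in
      constr:(@LAdd R a' b')
  | @Algebra.opp _ ?a => let a' := lmod_reify R a env in constr:(@LOpp R a')
  | @GRing.scale _ _ ?k ?a =>
      let a' := lmod_reify R a env in constr:(@LScale R k a')
  | _ => let i := lmod_index t env in constr:(@LVar R i)
  end.
Ltac lmod_eq R :=
  match goal with
  | |- @eq ?E ?x ?y =>
    let env0 := lmod_atoms x (@nil E) in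
    let env := lmod_atoms y env0 in
    let x' := lmod_reify (R : Type) x env in
    let y' := lmod_reify (R : Type) y env in
    refine (@lmod_eval_eq R _ env x' y' _);
    cbv [lmod_coef lmod_coef_eq Nat.eqb size]; repeat split; try field
  end.

(** * Continuous seminorms *)

Record seminorm {R : realType} {E : tvsType R} (p : E -> R) : Prop := {
  seminormD : forall x y, p (x + y) <= p x + p y ;
  seminormZ : forall a x, p (a *: x) = `|a| * p x ;
  seminorm_nbhs : forall e, 0 < e -> nbhs (0 : E) [set x | p x < e]
}.

Section Seminorms.
Context {R : realType} {E : tvsType R}.
Implicit Types p : E -> R.

Lemma seminorm0 p : seminorm p -> p 0 = 0.
Proof. by move=> sp; rewrite -(scale0r (0 : E)) (seminormZ sp) normr0 mul0r. Qed.

Lemma seminormN p x : seminorm p -> p (- x) = p x.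
Proof. by move=> sp; rewrite -scaleN1r (seminormZ sp) normrN normr1 mul1r. Qed.

Lemma seminorm_ge0 p x : seminorm p -> 0 <= p x.
Proof.
move=> sp; have := seminormD sp x (- x).
by rewrite subrr (seminorm0 sp) (seminormN x sp) -mulr2n pmulrn_lge0.
Qed.

Lemma seminormB p x y : seminorm p -> p (x - y) <= p x + p y.
Proof. by move=> sp; rewrite -[p y](seminormN _ sp) seminormD. Qed.

Lemma seminorm_distC p x y : seminorm p -> p (x - y) = p (y - x).
Proof. by move=> sp; rewrite -(seminormN _ sp) opprB. Qed.

Lemma seminorm_dist p x y z : seminorm p -> p (x - z) <= p (x - y) + p (y - z).
Proof. by move=> sp; rewrite -[x - z](subrKA y) seminormD. Qed.

Lemma seminorm_sum p (I : Type) (r : seq I) (P : pred I) (f : I -> E) :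
  seminorm p -> p (\sum_(i <- r | P i) f i) <= \sum_(i <- r | P i) p (f i).
Proof.
move=> sp; elim/big_rec2: _ => [|i y x _ h]; first by rewrite (seminorm0 sp).
exact: le_trans (seminormD sp _ _) (lerD (lexx _) h).
Qed.

Lemma absorbing (U : set E) x : nbhs (0 : E) U ->
  exists2 r : R, 0 < r & U (r^-1 *: x).
Proof.
move=> U0; have /= := @scale_continuous R E (0, x) U.
rewrite scale0r => /(_ U0)[[A B]/= [A0 Bx] AB].
move: A0 => /nbhs_ballP[e /= e0 eA].
exists (2 / e); first by rewrite divr_gt0.
rewrite invf_div; apply: (AB (e / 2, x)); split; last exact: nbhs_singleton.
apply: eA; rewrite /ball/= sub0r normrN gtr0_norm ?divr_gt0//.
by rewrite ltr_pdivrMr// ltr_pMr// ltr1n.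
Qed.

(** Intersecting a convex neighbourhood with its opposite makes it symmetric; without this the gauge
    would only be positively homogeneous. *)
Lemma convex_nbhs (U : set E) : nbhs (0 : E) U -> exists b : set E,
  [/\ nbhs (0 : E) b, b `<=` U, forall x, b x -> b (- x) &
   forall x y t, b x -> b y -> 0 <= t <= 1 -> b (t *: x + (1 - t) *: y)].
Proof.
move=> U0; have [B Bc [Bo /(_ 0 U U0)[b /= [Bb b0] bU]]] := @locally_convex R E.
exists (b `&` (-%R @` b)); split.
- apply: filterI; first by apply: open_nbhs_nbhs; split => //; exact: Bo.
  by apply/nbhs0N/open_nbhs_nbhs; split => //; exact: Bo.
- by move=> x [+ _] => /bU.
- move=> x [bx [y bY yx]]; rewrite -yx opprK; split => //.
  by exists x => //; rewrite -yx opprK.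
have cb x y t : b x -> b y -> 0 <= t <= 1 -> b (t *: x + (1 - t) *: y).
  move=> bx bY t01.
  case/andP: t01 => t0 t1.
  have := Bc b (mem_set Bb) x y (Itv01 t0 t1) (mem_set bx) (mem_set bY).
  by move/set_mem.
move=> x y t [bx [x' bx' ex]] [bY [y' bY' ey]] t01; split; first exact: cb.
exists (t *: x' + (1 - t) *: y'); first exact: cb.
by rewrite -ex -ey opprD !scalerN.
Qed.

(* The Minkowski gauge of a symmetric convex neighbourhood. *)
Lemma seminorm_below (U : set E) : nbhs (0 : E) U ->
  exists2 p, seminorm p & forall x, p x < 1 -> U x.
Proof.
move=> /convex_nbhs[b [b0 bU bN bc]].
pose S x := [set r : R | 0 < r /\ b (r^-1 *: x)].
pose p x := inf (S x).
have S0 x : S x !=set0.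
  by have [r r0 br] := absorbing x b0; exists r.
have Slb x : has_lbound (S x) by exists 0 => r [/ltW].
have pA x r : 0 < r -> b (r^-1 *: x) -> p x <= r.
  by move=> r0 br; apply: ge_inf => //; split.
have pB x r : p x < r -> b (r^-1 *: x).
  move=> pr; have [s [s0 bs] sr] := inf_lt (S0 x) pr.
  have r0 : 0 < r by exact: lt_trans sr.
  (* [b] is convex and contains 0, so it is stable under the contraction by [s / r]. *)
  have -> : r^-1 *: x = (s / r) *: (s^-1 *: x) + (1 - s / r) *: 0.
    by rewrite scaler0 addr0 scalerA mulrAC divff ?gt_eqF// mul1r.
  apply: bc => //; first exact: nbhs_singleton.
  by rewrite divr_ge0 ?(ltW s0) ?(ltW r0)//= ler_pdivrMr// mul1r (ltW sr).
have p0 x : 0 <= p x by apply: lb_le_inf => // r [/ltW].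
have pZ a x : p (a *: x) <= `|a| * p x.
  apply/ler_addgt0Pr => e e0.
  have [->|a0] := eqVneq a 0.
    rewrite scale0r normr0 mul0r add0r; apply: pA => //.
    by rewrite scaler0; exact: nbhs_singleton.
  have na : 0 < `|a| by rewrite normr_gt0.
  have := pB x (p x + e / `|a|); rewrite ltrDl divr_gt0// => /(_ isT) bx.
  have -> : `|a| * p x + e = `|a| * (p x + e / `|a|).
    by rewrite mulrDr mulrCA divff ?mulr1 // gt_eqF.
  apply: pA; first by rewrite mulr_gt0// ltr_wpDl// divr_gt0.
  rewrite invfM scalerA mulrAC.
  move: bx; set d := (p x + _)^-1 => bx.
  have [->|->] : `|a| = a \/ `|a| = - a.
    by have [ap|an] := lerP 0 a; [left; rewrite ger0_norm|right; rewrite ltr0_norm].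
    by rewrite mulVf// mul1r.
  rewrite invrN mulNr mulVf// mulN1r scaleNr; exact: bN.
exists p; last by move=> x /pB; rewrite invr1 scale1r => /bU.
split => [x y|a x|e e0].
- apply/ler_addgt0Pr => e e0.
  have e2 : 0 < e / 2 by rewrite divr_gt0.
  have s0 : 0 < p x + e / 2 by rewrite ltr_wpDl.
  have t0 : 0 < p y + e / 2 by rewrite ltr_wpDl.
  have bx : b ((p x + e / 2)^-1 *: x) by apply: pB; rewrite ltrDl.
  have bY : b ((p y + e / 2)^-1 *: y) by apply: pB; rewrite ltrDl.
  set s := p x + e / 2 in s0 bx; set t := p y + e / 2 in t0 bY.
  have -> : p x + p y + e = s + t by rewrite /s /t; field.
  have st : 0 < s + t by rewrite addr_gt0.
  apply: pA => //.
  have -> : (s + t)^-1 *: (x + y) =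
      (s / (s + t)) *: (s^-1 *: x) + (1 - s / (s + t)) *: (t^-1 *: y).
    rewrite !scalerA scalerDr; congr (_ *: _ + _ *: _); field.
      by rewrite !gt_eqF.
    by rewrite !gt_eqF.
  apply: bc => //.
  by rewrite divr_ge0 ?(ltW s0) ?(ltW st)//= ler_pdivrMr// mul1r lerDl ltW.
- apply/eqP; rewrite eq_le pZ /=.
  have [->|a0] := eqVneq a 0; first by rewrite normr0 mul0r.
  have := pZ a^-1 (a *: x).
  by rewrite scalerA mulVf// scale1r normfV mulrC ler_pdivlMr ?normr_gt0// mulrC.
- have e2 : e / 2 != 0 by rewrite gt_eqF// divr_gt0.
  apply: filterS (nbhs0Z e2 b0) => _ [x bx <-] /=.
  have e20 : 0 < e / 2 by rewrite divr_gt0.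
  apply: (@le_lt_trans _ _ (e / 2)); last by rewrite ltr_pdivrMr// ltr_pMr// ltr1n.
  by apply: pA => //; rewrite scalerA mulVf// scale1r.
Qed.

(** This is where local convexity enters: limits become estimates by continuous seminorms, handled
    as in a normed space. *)
Lemma cvg_seminorm {T : Type} (F : set_system T) {FF : Filter F} (f : T -> E) l :
  f @ F --> l <->
  forall p, seminorm p -> forall e, 0 < e -> \forall x \near F, p (f x - l) < e.
Proof.
have shift (U : set E) : nbhs l U <-> nbhs (0 : E) [set x | U (x + l)].
  split=> [/(@nbhsB _ _ U l (- l))|/(@nbhsT _ _ _ l)].
    rewrite addNr; apply: filterS => _ [x Ux <-] /=.
    by rewrite addrC addrA subrr add0r.
  by apply: filterS => _ [x /= + <-]; rewrite addrC.
split=> [fl p sp e e0|h U /shift /seminorm_below[p sp pU]].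
  apply: (fl [set x | p (x - l) < e]); apply/shift.
  apply: filterS (seminorm_nbhs sp e0) => x /=.
  by rewrite addrK.
rewrite nbhs_simpl /=; apply: filterS (h p sp 1 ltr01) => x /pU.
by rewrite /= subrK.
Qed.

Lemma hausdorff_seminorm (x : E) : hausdorff_space E ->
  (forall p, seminorm p -> p x = 0) -> x = 0.
Proof.
move=> hE hx; apply: (@cvg_unique _ hE ((fun=> x) @ (nbhs (0 : E)))).
  exact: cvg_cst.
apply/cvg_seminorm => p sp e e0; near=> y; by rewrite subr0 hx.
Unshelve. all: by end_near. Qed.

End Seminorms.

(** * Derivatives of curves *)

(** The error is compared with [e * |h|] for each seminorm, so estimates add up without division by
    [h], and [h = 0] needs no exception. [has_cdP] relates this to the difference quotient. *)
Definition has_cd {R : realType} {E : tvsType R} (c : R -> E) (t : R) (l : E) :=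
  forall p, seminorm p -> forall e : R, 0 < e ->
    \forall h \near (0 : R), p (c (t + h) - c t - h *: l) <= e * `|h|.

Section CurveDerivative.
Context {R : realType} {E : tvsType R}.
Implicit Types (c : R -> E) (t : R) (l : E).

Lemma has_cdP c t l : has_cd c t l <->
  h^-1 *: (c (h *: (1 : R) + t) - c t) @[h --> (0 : R)^'] --> l.
Proof.
have key h : h != 0 -> h^-1 *: (c (h *: (1 : R) + t) - c t) - l =
    h^-1 *: (c (t + h) - c t - h *: l).
  move=> h0; rewrite [RHS]scalerBr scalerA mulVf// scale1r.
  by rewrite [h *: (1 : R)]mulr1 [t + h]addrC.
split=> [cl|/cvg_seminorm cl p sp e e0].
  apply/cvg_seminorm => p sp e e0.
  have e2 : 0 < e / 2 by rewrite divr_gt0.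
  have /nbhs_ballP[d /= d0 hd] := cl p sp _ e2.
  near=> h.
  have h0 : h != 0 by near: h; exact: nbhs_dnbhs_neq.
  rewrite key// (seminormZ sp) normfV.
  have nh : 0 < `|h| by rewrite normr_gt0.
  rewrite mulrC ltr_pdivrMr//; apply: le_lt_trans (hd h _) _.
    by rewrite /ball/= sub0r normrN; near: h; exact: (@dnbhs0_lt _ R).
  by rewrite ltr_pM2r// ltr_pdivrMr// ltr_pMr// ltr1n.
have := cl p sp e e0.
rewrite near_withinE; apply: filterS => h hh.
have [->|h0] := eqVneq h 0.
  by rewrite addr0 subrr scale0r subr0 (seminorm0 sp) normr0 mulr0.
have := hh h0; rewrite key// (seminormZ sp) normfV mulrC.
by rewrite ltr_pdivrMr ?normr_gt0// => /ltW.
Unshelve. all: by end_near. Qed.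

Lemma tvs_derivableP c t : tvs_derivable (E := R) c t 1 <-> exists l, has_cd c t l.
Proof. by split=> -[l] /has_cdP cl; exists l. Qed.

Lemma has_cd_cst (x : E) t : has_cd (fun=> x) t 0.
Proof.
move=> p sp e e0; near=> h.
by rewrite subrr scaler0 subr0 (seminorm0 sp) mulr_ge0// ltW.
Unshelve. all: by end_near. Qed.

Lemma has_cdD c c' t l l' : has_cd c t l -> has_cd c' t l' ->
  has_cd (fun u => c u + c' u) t (l + l').
Proof.
move=> cl cl' p sp e e0; have e2 : 0 < e / 2 by rewrite divr_gt0.
near=> h.
have -> : c (t + h) + c' (t + h) - (c t + c' t) - h *: (l + l') =
    (c (t + h) - c t - h *: l) + (c' (t + h) - c' t - h *: l').
  by lmod_eq R.
apply: le_trans (seminormD sp _ _) _.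
rewrite [e]splitr mulrDl lerD//; near: h; [exact: cl|exact: cl'].
Unshelve. all: by end_near. Qed.

Lemma has_cdZ (a : R) c t l : has_cd c t l -> has_cd (fun u => a *: c u) t (a *: l).
Proof.
move=> cl p sp e e0.
have a1 : 0 < `|a| + 1 by rewrite ltr_wpDl.
have ea : 0 < e / (`|a| + 1) by rewrite divr_gt0.
apply: filterS (cl p sp _ ea) => h hh.
rewrite -scalerBr scalerA mulrC -scalerA -scalerBr (seminormZ sp).
apply: le_trans (ler_wpM2l (normr_ge0 a) hh) _.
rewrite mulrA ler_wpM2r// mulrCA ler_piMr ?(ltW e0)//.
by rewrite ler_pdivrMr// mul1r lerDl.
Qed.

Lemma has_cdN c t l : has_cd c t l -> has_cd (fun u => - c u) t (- l).
Proof.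
move=> /(has_cdZ (-1)); rewrite scaleN1r.
by rewrite (_ : (fun u => _) = fun u => - c u)//; apply/funext => u; rewrite scaleN1r.
Qed.

Lemma has_cdB c c' t l l' : has_cd c t l -> has_cd c' t l' ->
  has_cd (fun u => c u - c' u) t (l - l').
Proof. by move=> cl /has_cdN; exact: has_cdD. Qed.

Lemma has_cd_near c c' t l : (\forall h \near t, c h = c' h) ->
  has_cd c t l -> has_cd c' t l.
Proof.
move=> cc' cl p sp e e0.
have ct : c t = c' t by exact: nbhs_singleton cc'.
have cc : \forall h \near (0 : R), c (t + h) = c' (t + h).
  have := cc'; rewrite -{1}[t]addr0 => /(@cvgD _ _ _ _ _ _ _ _ _ (cvg_cst t) cvg_id).
  exact.
by apply: filterS2 (cl p sp _ e0) cc => h; rewrite ct => + hh; rewrite hh.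
Qed.

Lemma has_cd_lip c t l p : has_cd c t l -> seminorm p ->
  \forall h \near (0 : R), p (c (t + h) - c t) <= (1 + p l) * `|h|.
Proof.
move=> cl sp; apply: filterS (cl p sp 1 ltr01) => h hh.
rewrite -[c (t + h) - c t](subrK (h *: l)).
apply: le_trans (seminormD sp _ _) _.
by rewrite (seminormZ sp) mulrDl [`|h| * _]mulrC lerD2r.
Qed.

Lemma has_cd_continuous c t l p e : has_cd c t l -> seminorm p -> 0 < e ->
  \forall h \near (0 : R), p (c (t + h) - c t) < e.
Proof.
move=> cl sp e0.
have k0 : 0 < 1 + p l by rewrite ltr_wpDr// (seminorm_ge0 _ sp).
near=> h.
apply: (@le_lt_trans _ _ ((1 + p l) * `|h|)); first by near: h; exact: (has_cd_lip cl sp).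
rewrite mulrC -ltr_pdivlMr//.
by near: h; apply: (@nbhs0_lt _ R); rewrite divr_gt0.
Unshelve. all: by end_near. Qed.

Lemma has_cd_cvg c t l : has_cd c t l -> c u @[u --> t] --> c t.
Proof.
move=> cl; apply/cvg_seminorm => p sp e e0.
have := has_cd_continuous cl sp e0.
rewrite !near_nbhs_norm => -[d /= d0 hd]; exists d => //= u ud.
have := hd (u - t); rewrite /= sub0r normrN addrCA subrr addr0; apply.
by rewrite distrC.
Qed.

Hypothesis hE : hausdorff_space E.

Lemma has_cd_unique c t l l' : has_cd c t l -> has_cd c t l' -> l = l'.
Proof. by move=> /has_cdP cl /has_cdP cl'; exact: cvg_unique cl cl'. Qed.

Lemma curve_deriveE c t l : has_cd c t l -> curve_derive c t = l.
Proof.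
move=> cl; rewrite /curve_derive /tvs_derive; case: xgetP => [y _|/(_ l)].
  by move=> /has_cdP cy; exact: has_cd_unique cy cl.
by move/has_cdP : cl.
Qed.

Lemma curve_deriveP c t : tvs_derivable (E := R) c t 1 -> has_cd c t (curve_derive c t).
Proof. by move/tvs_derivableP => [l cl]; rewrite (curve_deriveE cl). Qed.

End CurveDerivative.

Section CurveDerivativeComp.
Context {R : realType} {E : tvsType R}.

Lemma seminorm_real (p : R -> R) : seminorm p -> forall x, p x = `|x| * p 1.
Proof. by move=> sp x; rewrite -(seminormZ sp) [_ *: _]mulr1. Qed.

Lemma seminorm_norm : seminorm (fun x : R => `|x|).
Proof.
split; [exact: ler_normD|exact: normrM|] => e e0.
exact: (@nbhs0_lt _ R).
Qed.

Lemma hausdorff_real : hausdorff_space R.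
Proof. exact: norm_hausdorff. Qed.

Lemma has_cd_derive (f : R -> R) t l : has_cd f t l <-> is_derive t (1 : R) f l.
Proof.
split=> [/has_cdP fl|[/cvg_ex[l' /= fl'] <-]].
  apply: DeriveDef; first by apply/cvg_ex; exists l.
  exact/cvg_lim.
by apply/has_cdP; rewrite /derive (cvg_lim _ fl').
Qed.

Lemma has_cd_comp (phi : R -> R) (c : R -> E) t a l :
  has_cd phi t a -> has_cd c (phi t) l -> has_cd (fun u => c (phi u)) t (a *: l).
Proof.
move=> pa cl p sp e e0.
(* [k] is a Lipschitz constant of [phi] near [t], and [m] exceeds [p l]; each half of [e] is divided
   by one of them. *)
pose k := 1 + `|a|; have k0 : 0 < k by rewrite ltr_wpDr.
pose m := 1 + p l; have m0 : 0 < m by rewrite ltr_wpDr// (seminorm_ge0 _ sp).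
have ek : 0 < e / 2 / k by rewrite !divr_gt0.
have em : 0 < e / 2 / m by rewrite !divr_gt0.
have /nbhs_ballP[d /= d0 hd] := cl p sp _ ek.
near=> h.
have h'k : `|phi (t + h) - phi t| <= k * `|h|.
  by near: h; exact: (has_cd_lip pa seminorm_norm).
have h'2 : `|phi (t + h) - phi t - h * a| <= e / 2 / m * `|h|.
  by near: h; exact: (pa _ seminorm_norm _ em).
have h'd : `|phi (t + h) - phi t| < d.
  by near: h; exact: (has_cd_continuous pa seminorm_norm d0).
set h' := phi (t + h) - phi t in h'k h'2 h'd.
have -> : phi (t + h) = phi t + h' by rewrite /h' subrKC.
have -> : c (phi t + h') - c (phi t) - h *: (a *: l) =
    (c (phi t + h') - c (phi t) - h' *: l) + (h' - h * a) *: l by lmod_eq R.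
apply: le_trans (seminormD sp _ _) _; rewrite [e]splitr mulrDl lerD//.
  apply: (@le_trans _ _ (e / 2 / k * `|h'|)).
    by apply: hd; rewrite /ball/= sub0r normrN.
  apply: le_trans (ler_wpM2l (ltW ek) h'k) _.
  by rewrite mulrA mulfVK// gt_eqF.
rewrite (seminormZ sp).
apply: le_trans (ler_wpM2r (seminorm_ge0 l sp) h'2) _.
have -> : e / 2 / m * `|h| * p l = e / 2 * `|h| * (p l / m) by ring.
rewrite ler_piMr ?mulr_ge0 ?(ltW e0)//.
by rewrite ler_pdivrMr// mul1r lerDr.
Unshelve. all: by end_near. Qed.

Lemma has_cd_scale (phi : R -> R) (c : R -> E) t a l :
  has_cd phi t a -> has_cd c t l ->
  has_cd (fun u => phi u *: c u) t (a *: c t + phi t *: l).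
Proof.
move=> pa cl p sp e e0.
have pct := seminorm_ge0 (c t) sp.
(* [k] is the sum of the weights of the three errors below, so that after division by it they add up
   to exactly [e]. *)
pose k := 1 + `|a| + p (c t) + `|phi t|.
have k0 : 0 < k by rewrite !ltr_wpDr.
have ek : 0 < e / k by rewrite !divr_gt0.
near=> h.
rewrite (_ : _ - h *: _ = (phi (t + h) - phi t) *: (c (t + h) - c t) +
  ((phi (t + h) - phi t - h * a) *: c t + phi t *: (c (t + h) - c t - h *: l)));
  last by lmod_eq R.
have -> : e * `|h| = (1 + `|a|) * `|h| * (e / k) +
    (e / k * `|h| * p (c t) + `|phi t| * (e / k * `|h|)).
  by rewrite /k; field; rewrite gt_eqF.
apply: le_trans (seminormD sp _ _) _; rewrite lerD//.
  rewrite (seminormZ sp) ler_pM ?(seminorm_ge0 _ sp)//.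
    by near: h; exact: (has_cd_lip pa seminorm_norm).
  by apply: ltW; near: h; exact: (has_cd_continuous cl sp ek).
apply: le_trans (seminormD sp _ _) _; rewrite !(seminormZ sp) lerD//.
  by rewrite ler_wpM2r//; near: h; exact: (pa _ seminorm_norm _ ek).
by rewrite ler_wpM2l//; near: h; exact: (cl _ sp _ ek).
Unshelve. all: by end_near. Qed.

End CurveDerivativeComp.

(** * Iterated derivatives and smoothness on subsets of the line *)

Notation dn n c := (iter n curve_derive c).

Definition smooth_on {R : realType} {E : tvsType R} (D : set R) (c : R -> E) :=
  forall n t, D t -> tvs_derivable (E := R) (dn n c) t 1.

Section IteratedDerivatives.
Context {R : realType} {E : tvsType R}.
Implicit Types (D : set R) (c : R -> E) (t : R).

Lemma curve_derive_xget c t : curve_derive c t = xget 0 [set l | has_cd c t l].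
Proof.
rewrite /curve_derive /tvs_derive; congr (xget _ _).
by apply/seteqP; split => l /has_cdP.
Qed.

Lemma curve_derive_near c c' (t : R) :
  (\forall h \near t, c h = c' h) -> curve_derive c t = curve_derive c' t.
Proof.
move=> cc'; rewrite !curve_derive_xget; congr (xget _ _).
apply/seteqP; split => l; apply: has_cd_near => //.
by apply: filterS cc' => h ->.
Qed.

Lemma dn_near n c c' (t : R) :
  (\forall h \near t, c h = c' h) -> \forall h \near t, dn n c h = dn n c' h.
Proof.
move=> cc'; elim: n => //= n /near_join.
by apply: filterS => h; exact: curve_derive_near.
Qed.

Lemma dn_eq_on n D c c' t : open D -> (forall u, D u -> c u = c' u) -> D t ->
  dn n c t = dn n c' t.
Proof.
move=> oD cc' Dt; have /(dn_near n) : \forall h \near t, c h = c' h; last exact: nbhs_singleton.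
by apply: filterS (open_nbhs_nbhs (conj oD Dt)).
Qed.

Lemma dn_shift n c a : dn n (fun t => c (t + a)) = (fun t => dn n c (t + a)).
Proof.
elim: n => //= n ->; apply/funext => t; rewrite !curve_derive_xget; congr (xget _ _).
apply/seteqP; split => l /= cl p sp e e0; apply: filterS (cl p sp e e0) => h;
  by rewrite ?(addrAC t h) // (addrAC t a).
Qed.

Lemma dn_shift0 n c t : dn n c t = dn n (fun u => c (u + t)) 0.
Proof. by rewrite dn_shift add0r. Qed.

Lemma curve_derive_shift0 c t : curve_derive c t = curve_derive (fun u => c (u + t)) 0.
Proof. exact: (dn_shift0 1). Qed.

Lemma smooth_on_sub D D' c : D' `<=` D -> smooth_on D c -> smooth_on D' c.
Proof. by move=> DD' sc n t /DD'; exact: sc. Qed.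

Lemma smooth_on_dn D c n : smooth_on D c -> smooth_on D (dn n c).
Proof. by move=> sc m t Dt; rewrite -iterD; exact: sc. Qed.

Lemma smooth_on_derive D c : smooth_on D c -> smooth_on D (curve_derive c).
Proof. by move/(smooth_on_dn 1). Qed.

Lemma smooth_on_near D c t n : smooth_on D c -> D t -> exists l, has_cd (dn n c) t l.
Proof. by move=> sc Dt; apply/tvs_derivableP; exact: sc. Qed.

Lemma smooth_on_cvg D c t : smooth_on D c -> D t -> c u @[u --> t] --> c t.
Proof. by move=> sc /(smooth_on_near 0 sc)[l]; exact: has_cd_cvg. Qed.

Lemma smooth_on_local D c : (forall t, D t ->
  exists2 D', smooth_on D' c & D' t) -> smooth_on D c.
Proof. by move=> h n t /h[D' sc D't]; exact: sc. Qed.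

Lemma smooth_on_ext D c c' : open D -> (forall t, D t -> c t = c' t) ->
  smooth_on D c -> smooth_on D c'.
Proof.
move=> oD cc' sc n t Dt; have [l cl] := smooth_on_near n sc Dt.
apply/tvs_derivableP; exists l; apply: has_cd_near cl; apply: dn_near.
by apply: filterS (open_nbhs_nbhs (conj oD Dt)).
Qed.

Lemma smooth_curveP c : smooth_curve c <-> smooth_on setT c.
Proof. by split=> [sc n t _|sc n t]; exact: sc. Qed.

(** A finite-order form of [smooth_on] that peels off the first derivative instead of the last, so
    that closure under products and composition goes by induction. [Ck 0] already asks for one
    derivative. *)
Fixpoint Ck n D c : Prop := (forall t, D t -> exists l, has_cd c t l) /\
  if n is m.+1 then Ck m D (curve_derive c) else True.

Lemma smooth_onP D c : smooth_on D c <-> forall n, Ck n D c.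
Proof.
split=> [sc n|].
  elim: n c sc => [|n IH] c sc; split => //.
  - by move=> t; exact: (smooth_on_near 0 sc).
  - by move=> t; exact: (smooth_on_near 0 sc).
  - by apply: IH; exact: smooth_on_derive.
move=> h n; elim: n c h => [|n IH] c h t Dt.
  by apply/tvs_derivableP; have [/(_ t Dt)] := h 0%N.
by rewrite iterSr; apply: IH => // m; have [] := h m.+1.
Qed.

Lemma Ck_lt n D c : Ck n.+1 D c -> Ck n D c.
Proof. by elim: n c => [|n IH] c [h1 h2]; split => //; exact: IH. Qed.

Lemma Ck_ext n D c c' : open D -> (forall t, D t -> c t = c' t) ->
  Ck n D c -> Ck n D c'.
Proof.
move=> oD; elim: n c c' => [|n IH] c c' cc'.
  move=> -[h _]; split => // t Dt; have [l cl] := h t Dt; exists l.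
  by apply: has_cd_near cl; apply: filterS (open_nbhs_nbhs (conj oD Dt)).
move=> -[h1 h2]; split.
  move=> t Dt; have [l cl] := h1 t Dt; exists l.
  by apply: has_cd_near cl; apply: filterS (open_nbhs_nbhs (conj oD Dt)).
apply: IH h2 => t Dt; apply: curve_derive_near.
by apply: filterS (open_nbhs_nbhs (conj oD Dt)).
Qed.

Hypothesis hE : hausdorff_space E.

Lemma has_cd_dn D c t n : smooth_on D c -> D t -> has_cd (dn n c) t (dn n.+1 c t).
Proof. by move=> sc Dt; apply: curve_deriveP => //; exact: sc. Qed.

Lemma Ck_intro n D c c1 : open D -> (forall t, D t -> has_cd c t (c1 t)) ->
  Ck n D c1 -> Ck n.+1 D c.
Proof.
move=> oD h h1; split; first by move=> t Dt; exists (c1 t); exact: h.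
by apply: Ck_ext h1 => // t Dt; apply/esym/curve_deriveE => //; exact: h.
Qed.

Lemma Ck0_intro D c c1 : (forall t, D t -> has_cd c t (c1 t)) -> Ck 0 D c.
Proof. by move=> h; split => // t Dt; exists (c1 t); exact: h. Qed.

Lemma Ck_has_cd n D c t : Ck n D c -> D t -> has_cd c t (curve_derive c t).
Proof.
by case: n => [|n] [h _] Dt; have [l cl] := h t Dt; rewrite (curve_deriveE hE cl).
Qed.

Lemma Ck_cst n D (x : E) : open D -> Ck n D (fun=> x).
Proof.
move=> oD; elim: n x => [|n IH] x.
  by apply: (@Ck0_intro _ _ (fun=> 0)) => t _; exact: has_cd_cst.
by apply: (@Ck_intro _ _ _ (fun=> 0)) => // t _; exact: has_cd_cst.
Qed.

Lemma CkD n D c c' : open D -> Ck n D c -> Ck n D c' -> Ck n D (fun t => c t + c' t).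
Proof.
move=> oD; elim: n c c' => [|n IH] c c' h h'.
  apply: Ck0_intro => t Dt; by apply: has_cdD; apply: Ck_has_cd Dt; eassumption.
apply: Ck_intro => // [t Dt|].
  apply: has_cdD; [exact: Ck_has_cd h Dt|exact: Ck_has_cd h' Dt].
by apply: IH; [case: h|case: h'].
Qed.

End IteratedDerivatives.

Section SmoothAlgebra.
Context {R : realType} {E : tvsType R} (hE : hausdorff_space E).
Implicit Types (D : set R) (c : R -> E) (phi : R -> R) (t : R).

Lemma Ck_scale n D phi c : open D -> Ck n D phi -> Ck n D c ->
  Ck n D (fun t => phi t *: c t).
Proof.
move=> oD; elim: n phi c => [|n IH] phi c h h'.
  apply: Ck0_intro => t Dt; apply: has_cd_scale.
    exact: (Ck_has_cd hausdorff_real h).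
  exact: (Ck_has_cd hE h').
apply: Ck_intro => // [t Dt|].
  apply: has_cd_scale.
    exact: (Ck_has_cd hausdorff_real h).
  exact: (Ck_has_cd hE h').
by apply: CkD => //; apply: IH => //; [case: h|exact: Ck_lt|exact: Ck_lt|case: h'].
Qed.

Lemma Ck_comp n D D' phi c : open D -> (forall t, D t -> D' (phi t)) ->
  Ck n D phi -> Ck n D' c -> Ck n D (fun t => c (phi t)).
Proof.
move=> oD DD'; elim: n c => [|n IH] c h h'.
  apply: Ck0_intro => t Dt; apply: has_cd_comp.
    exact: (Ck_has_cd hausdorff_real h).
  by apply: (Ck_has_cd hE h'); exact: DD'.
apply: Ck_intro => // [t Dt|].
  apply: has_cd_comp.
    exact: (Ck_has_cd hausdorff_real h).
  by apply: (Ck_has_cd hE h'); exact: DD'.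
apply: Ck_scale => //; first by case: h.
by apply: IH; [exact: Ck_lt|case: h'].
Qed.

Lemma has_cd_id (t : R) : has_cd (fun u => u) t (1 : R).
Proof.
move=> p sp e e0; near=> h.
by rewrite [h *: _]mulr1 [t + h]addrC addrK subrr (seminorm0 sp) mulr_ge0// ltW.
Unshelve. all: by end_near. Qed.

Lemma smooth_on_cst D (x : E) : open D -> smooth_on D (fun=> x).
Proof. by move=> oD; apply/smooth_onP => n; exact: Ck_cst. Qed.

Lemma smooth_on_id D : open D -> smooth_on D (fun t : R => t).
Proof.
move=> oD; apply/smooth_onP => -[|n].
  by apply: Ck0_intro => t _; exact: has_cd_id.
apply: (Ck_intro hausdorff_real oD) => [t _|]; first exact: has_cd_id.
exact: (Ck_cst hausdorff_real).
Qed.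

Lemma smooth_onD D c c' : open D -> smooth_on D c -> smooth_on D c' ->
  smooth_on D (fun t => c t + c' t).
Proof.
move=> oD /smooth_onP h /smooth_onP h'; apply/smooth_onP => n; exact: CkD.
Qed.

Lemma smooth_on_scale D phi c : open D -> smooth_on D phi -> smooth_on D c ->
  smooth_on D (fun t => phi t *: c t).
Proof.
move=> oD /smooth_onP h /smooth_onP h'; apply/smooth_onP => n; exact: Ck_scale.
Qed.

Lemma smooth_onZ D (a : R) c : open D -> smooth_on D c ->
  smooth_on D (fun t => a *: c t).
Proof.
move=> oD sc; apply: smooth_on_scale => //.
by apply/smooth_onP => n; exact: (Ck_cst hausdorff_real).
Qed.

Lemma smooth_onN D c : open D -> smooth_on D c -> smooth_on D (fun t => - c t).
Proof.
move=> oD /(smooth_onZ (-1) oD); apply: smooth_on_ext => // t _.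
by rewrite scaleN1r.
Qed.

Lemma smooth_onB D c c' : open D -> smooth_on D c -> smooth_on D c' ->
  smooth_on D (fun t => c t - c' t).
Proof. by move=> oD sc /(smooth_onN oD); exact: smooth_onD. Qed.

Lemma smooth_on_comp D D' phi c : open D -> (forall t, D t -> D' (phi t)) ->
  smooth_on D phi -> smooth_on D' c -> smooth_on D (fun t => c (phi t)).
Proof.
move=> oD DD' /smooth_onP h /smooth_onP h'; apply/smooth_onP => n.
exact: (Ck_comp oD DD').
Qed.

Lemma dnD n D c c' t : open D -> smooth_on D c -> smooth_on D c' -> D t ->
  dn n (fun u => c u + c' u) t = dn n c t + dn n c' t.
Proof.
move=> oD sc sc'; elim: n t => //= n IH t Dt.
rewrite (curve_derive_near (c' := fun u => dn n c u + dn n c' u)).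
  by apply: curve_deriveE => //; apply: has_cdD; exact: (has_cd_dn hE) Dt.
by apply: filterS (open_nbhs_nbhs (conj oD Dt)).
Qed.

Lemma dnZ n D (a : R) c t : open D -> smooth_on D c -> D t ->
  dn n (fun u => a *: c u) t = a *: dn n c t.
Proof.
move=> oD sc; elim: n t => //= n IH t Dt.
rewrite (curve_derive_near (c' := fun u => a *: dn n c u)).
  by apply: curve_deriveE => //; apply: has_cdZ; exact: (has_cd_dn hE) Dt.
by apply: filterS (open_nbhs_nbhs (conj oD Dt)).
Qed.

Lemma dnB n D c c' t : open D -> smooth_on D c -> smooth_on D c' -> D t ->
  dn n (fun u => c u - c' u) t = dn n c t - dn n c' t.
Proof.
move=> oD sc sc' Dt; rewrite -[in RHS]scaleN1r -(dnZ _ _ oD sc' Dt).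
rewrite -(dnD _ oD) //; last exact: smooth_onZ.
by congr (dn n _ _); apply/funext => u; rewrite scaleN1r.
Qed.

Lemma dn_affine n D (a b : R) c t : open D -> smooth_on D c -> D (a * t + b) ->
  dn n (fun u => c (a * u + b)) t = a ^+ n *: dn n c (a * t + b).
Proof.
move=> oD sc Dt.
have ha (u : R) : has_cd (fun u => a * u + b) u a.
  rewrite -[X in has_cd _ _ X]addr0; apply: has_cdD; last exact: has_cd_cst.
  by rewrite -[X in has_cd _ _ X]mulr1; apply: has_cdZ; exact: has_cd_id.
have ca : (fun u => a * u + b) @ t --> a * t + b by exact: has_cd_cvg (ha t).
elim: n t Dt ca => [|n IH] t Dt ca /=; first by rewrite scale1r.
rewrite (curve_derive_near (c' := fun u => a ^+ n *: dn n c (a * u + b))).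
  apply: curve_deriveE => //.
  rewrite exprSr -scalerA; apply: has_cdZ; apply: has_cd_comp => //.
  exact: (has_cd_dn hE) Dt.
have := ca _ (open_nbhs_nbhs (conj oD Dt)); rewrite nbhs_simpl /=.
apply: filterS => u Du; apply: IH => //; exact: has_cd_cvg (ha u).
Qed.

End SmoothAlgebra.

(** * Curves in product spaces *)

Section SmoothPair.
Context {R : realType} {E F : tvsType R}.
Hypotheses (hE : hausdorff_space E) (hF : hausdorff_space F).

Lemma hausdorff_pair : hausdorff_space (E * F)%type.
Proof.
move=> [x1 x2] [y1 y2] xy; congr pair; [apply: hE|apply: hF] => A B nA nB.
  have [||[z1 z2] [/= Az Bz]] := xy (fst @^-1` A) (fst @^-1` B).
  - by exists (A, setT); [split => //; exact: filterT|case=> ? ? []].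
  - by exists (B, setT); [split => //; exact: filterT|case=> ? ? []].
  by exists z1.
have [||[z1 z2] [/= Az Bz]] := xy (snd @^-1` A) (snd @^-1` B).
- by exists (setT, A); [split => //; exact: filterT|case=> ? ? []].
- by exists (setT, B); [split => //; exact: filterT|case=> ? ? []].
by exists z2.
Qed.

Lemma has_cd_pair (a : R -> E) (b : R -> F) t l m :
  has_cd a t l -> has_cd b t m -> has_cd (fun u => (a u, b u)) t (l, m).
Proof. by move=> /has_cdP al /has_cdP bm; apply/has_cdP; exact: cvg_pair. Qed.

Lemma smooth_on_pair D (a : R -> E) (b : R -> F) : open D ->
  smooth_on D a -> smooth_on D b -> smooth_on D (fun u => (a u, b u)).
Proof.
move=> oD /smooth_onP sa /smooth_onP sb; apply/smooth_onP => n.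
have {sa sb} := (sa n, sb n); elim: n a b => [|n IH] a b [sa sb].
  apply: Ck0_intro => t Dt; apply: has_cd_pair.
    exact: (Ck_has_cd hE sa Dt).
  exact: (Ck_has_cd hF sb Dt).
apply: (Ck_intro hausdorff_pair oD) => [t Dt|].
  apply: has_cd_pair; [exact: (Ck_has_cd hE sa Dt)|exact: (Ck_has_cd hF sb Dt)].
by apply: IH; split; [case: sa|case: sb].
Qed.

Lemma smooth_on_fst D (c : R -> E * F) : open D -> smooth_on D c ->
  smooth_on D (fun u => (c u).1).
Proof.
move=> oD /smooth_onP h; apply/smooth_onP => n; have {h} := h n.
have cd (c' : R -> E * F) t l : has_cd c' t l -> has_cd (fun u => (c' u).1) t l.1.
  move=> /has_cdP cl; apply/has_cdP.
  have f : x.1 @[x --> l] --> l.1 by case: l {cl} => l1 l2; exact: cvg_fst.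
  exact: cvg_comp cl f.
elim: n c => [|n IH] c h.
  apply: Ck0_intro => t Dt; exact: cd (Ck_has_cd hausdorff_pair h Dt).
apply: (Ck_intro hE oD) => [t Dt|]; first exact: cd (Ck_has_cd hausdorff_pair h Dt).
by apply: IH; case: h.
Qed.

Lemma smooth_on_snd D (c : R -> E * F) : open D -> smooth_on D c ->
  smooth_on D (fun u => (c u).2).
Proof.
move=> oD /smooth_onP h; apply/smooth_onP => n; have {h} := h n.
have cd (c' : R -> E * F) t l : has_cd c' t l -> has_cd (fun u => (c' u).2) t l.2.
  move=> /has_cdP cl; apply/has_cdP.
  have f : x.2 @[x --> l] --> l.2 by case: l {cl} => l1 l2; exact: cvg_snd.
  exact: cvg_comp cl f.
elim: n c => [|n IH] c h.
  apply: Ck0_intro => t Dt; exact: cd (Ck_has_cd hausdorff_pair h Dt).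
apply: (Ck_intro hF oD) => [t Dt|]; first exact: cd (Ck_has_cd hausdorff_pair h Dt).
by apply: IH; case: h.
Qed.

End SmoothPair.

(** * Mean value theorem and Taylor's formula *)

Section MeanValue.
Context {R : realType} {E : tvsType R}.
Implicit Types (c : R -> E) (p : E -> R).

Lemma seminorm_continuous p (x : E) : seminorm p -> p y @[y --> x] --> p x.
Proof.
move=> sp; apply/cvgrPdist_lt => e e0.
have /cvg_seminorm/(_ p sp e e0) : id y @[y --> x] --> x by exact: cvg_id.
apply: filterS => y; apply: le_lt_trans; rewrite ler_norml; apply/andP; split.
  have := seminormD sp (y - x) x; rewrite subrK; lra.
have := seminormD sp (x - y) y; rewrite subrK (seminorm_distC y x sp); lra.
Qed.

(* The minimum over [a, b] of [p (c t - c a) - C' (t - a)], [C' > C], can only be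
   reached at [b]. *)
Lemma mvt_seminorm p c (a b C : R) : seminorm p -> a <= b ->
  (forall t, a <= t <= b -> exists2 l, has_cd c t l & p l <= C) ->
  p (c b - c a) <= C * (b - a).
Proof.
move=> sp ab hc; apply/ler_addgt0Pr => e0 e0_gt0.
(* The added 1 keeps the divisor positive when [a = b]. *)
pose e := e0 / (b - a + 1).
have ba0 : 0 < b - a + 1 by rewrite ltr_wpDl// subr_ge0.
have e_gt0 : 0 < e by rewrite divr_gt0.
pose m t := p (c t - c a) - (C + e) * (t - a).
have mc : {within `[a, b], continuous m}.
  apply: continuous_in_subspaceT => t; rewrite inE/= in_itv/= => /hc[l cl _].
  apply: cvgB.
    apply: (@continuous_comp _ _ _ (fun t => c t - c a) p).
      apply: (@has_cd_cvg _ _ _ _ (l - 0)).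
      by apply: has_cdB => //; exact: has_cd_cst.
    exact: seminorm_continuous.
  by apply: cvgMr; apply: cvgB; [exact: cvg_id|exact: cvg_cst].
have [t0 + min0] := EVT_min ab mc; rewrite in_itv/= => /andP[at0 t0b].
have [t0_ltb|] := ltP t0 b; last first.
  move=> bt0; have t0E : t0 = b by apply/eqP; rewrite eq_le t0b.
  have := min0 a; rewrite in_itv/= lexx ab => /(_ isT).
  rewrite /m t0E subrr (seminorm0 sp) subrr mulr0 subr0 subr_le0 mulrDl.
  move/le_trans; apply; rewrite lerD2l.
  rewrite /e mulrAC ler_pdivrMr// ler_pM2l//; lra.
exfalso.
have [l cl lC] := hc t0 (introT andP (conj at0 t0b)).
have e2 : 0 < e / 2 by rewrite divr_gt0.
have /nbhs_ballP[d /= d0 hd] := cl p sp _ e2.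
pose h := Num.min (d / 2) (b - t0).
have h0 : 0 < h by rewrite lt_min divr_gt0// subr_gt0.
have hd' : `|h| < d.
  rewrite gtr0_norm// /h; apply: (@le_lt_trans _ _ (d / 2)); [by rewrite ge_min lexx|lra].
have htb : t0 + h <= b.
  by rewrite -lerBrDl /h ge_min lexx orbT.
have ath : a <= t0 + h by lra.
have := min0 (t0 + h); rewrite in_itv/= htb ath => /(_ isT).
rewrite leNgt => /negP; apply; rewrite /m.
have := hd h; rewrite /ball/= sub0r normrN => /(_ hd'); rewrite gtr0_norm// => hh.
have := seminorm_dist (c (t0 + h)) (c t0) (c a) sp.
have := seminormD sp (c (t0 + h) - c t0 - h *: l) (h *: l).
rewrite subrK (seminormZ sp) gtr0_norm// => h1 h2.
have h3 : h * p l <= h * C by rewrite ler_wpM2l// ltW.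
have h4 : 0 < e * h by rewrite mulr_gt0.
have h5 : e / 2 * h = e * h / 2 by ring.
have -> : (C + e) * (t0 + h - a) = (C + e) * (t0 - a) + C * h + e * h by ring.
rewrite mulrC in h3; rewrite [h * C]mulrC in h3.
rewrite [h * p l]mulrC in h1.
lra.
Qed.

Lemma mvt_segment p c (a h C : R) : seminorm p ->
  (forall t : R, `|t| <= `|h| -> exists2 l, has_cd c (a + t) l & p l <= C) ->
  p (c (a + h) - c a) <= C * `|h|.
Proof.
move=> sp hc; have [h0|h0] := leP 0 h.
  have := @mvt_seminorm p c a (a + h) C sp; rewrite lerDl h0 ger0_norm//.
  have -> : a + h - a = h by ring.
  apply=> // t /andP[t1 t2]; have := hc (t - a); rewrite subrKC; apply.
  rewrite !ger0_norm//; lra.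
have := @mvt_seminorm p c (a + h) a C sp; rewrite (seminorm_distC _ _ sp) ltr0_norm//.
have -> : a - (a + h) = - h by ring.
apply=> [|t /andP[t1 t2]]; first lra.
have := hc (t - a); rewrite subrKC; apply.
rewrite (ltr0_norm h0) ler0_norm; lra.
Qed.

Lemma has_cd_exp n (t : R) :
  has_cd (fun u : R => u ^+ n.+1 / (n.+1)`!%:R) t (t ^+ n / n`!%:R).
Proof.
have -> : t ^+ n / n`!%:R = (n.+1)`!%:R^-1 *: (n.+1%:R * t ^+ n).
  change (t ^+ n / n`!%:R = (n.+1)`!%:R^-1 * (n.+1%:R * t ^+ n)).
  by rewrite factS natrM invfM mulrACA mulVf ?pnatr_eq0// mul1r mulrC.
rewrite (_ : (fun u => _) = fun u : R => (n.+1)`!%:R^-1 *: (u ^+ n.+1)).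
  apply: has_cdZ; apply/has_cd_derive; apply: DeriveDef.
    exact: exprn_derivable.
  by rewrite exp_derive [LHS]mulr1.
by apply/funext => u; rewrite mulrC.
Qed.

Lemma has_cd_taylor_poly n (x : nat -> E) (t : R) :
  has_cd (fun u : R => \sum_(k < n.+1) (u ^+ k / k`!%:R) *: x k) t
    (\sum_(k < n) (t ^+ k / k`!%:R) *: x k.+1).
Proof.
elim: n => [|n IH].
  rewrite big_ord0 (_ : (fun u => _) = fun=> x 0%N); first exact: has_cd_cst.
  by apply/funext => u; rewrite big_ord1 expr0 divr1 scale1r.
rewrite big_ord_recr /= (_ : (fun u => _) = fun u =>
   \sum_(k < n.+1) (u ^+ k / k`!%:R) *: x k + (u ^+ n.+1 / n.+1`!%:R) *: x n.+1).
  apply: has_cdD => //; rewrite -[X in has_cd _ _ X]addr0.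
  rewrite -[X in _ + X](scaler0 _ (t ^+ n.+1 / n.+1`!%:R)).
  apply: has_cd_scale; [exact: has_cd_exp|exact: has_cd_cst].
by apply/funext => u; rewrite big_ord_recr.
Qed.

End MeanValue.

Section Taylor.
Context {R : realType} {E : tvsType R} (hE : hausdorff_space E).

(** The remainder, as a function of [h], has for derivative the remainder of one order less for the
    derivative of [c]; induction and the mean value inequality conclude. The bound has no factorial
    because each step bounds this derivative by its largest value on the segment instead of
    integrating it. *)
Lemma taylor (p : E -> R) n D (c : R -> E) (a h C : R) : seminorm p -> smooth_on D c ->
  (forall t : R, `|t| <= `|h| -> D (a + t) /\ p (dn n.+1 c (a + t)) <= C) ->
  p (c (a + h) - \sum_(k < n.+1) (h ^+ k / k`!%:R) *: dn k c a) <= C * `|h| ^+ n.+1.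
Proof.
move=> sp; elim: n c h => [|n IH] c h sc hC.
  rewrite big_ord1 expr0 divr1 scale1r expr1; apply: mvt_segment => // t /hC[Dt pC].
  by exists (curve_derive c (a + t)) => //; exact: (has_cd_dn hE 0 sc Dt).
have C0 : 0 <= C by have [|_] := hC 0; rewrite ?normr0//; apply: le_trans; exact: seminorm_ge0.
pose r u := c (a + u) - \sum_(k < n.+2) (u ^+ k / k`!%:R) *: dn k c a.
have r0 : r 0 = 0.
  rewrite /r big_ord_recl/= expr0 divr1 scale1r addr0 big1 ?addr0 ?subrr// => i _.
  by rewrite expr0n/= mul0r scale0r.
rewrite -/(r h) -[r h]subr0 -r0 -[h in r h]add0r exprSr mulrA.
apply: mvt_segment => // t th; rewrite add0r.
have [Dt _] := hC t th.
exists (curve_derive c (a + t) - \sum_(k < n.+1) (t ^+ k / k`!%:R) *: dn k.+1 c a).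
  apply: has_cdB; last exact: (has_cd_taylor_poly n.+1 (fun k => dn k c a)).
  rewrite -[X in has_cd _ _ X]scale1r; apply: has_cd_comp.
    rewrite -[X in has_cd _ _ X]add0r; apply: has_cdD; [exact: has_cd_cst|exact: has_cd_id].
  exact: (has_cd_dn hE 0 sc Dt).
apply: (@le_trans _ _ (C * `|t| ^+ n.+1)); last first.
  by rewrite ler_wpM2l// lerXn2r// nnegrE.
under eq_bigr do rewrite iterSr.
apply: IH; first exact: smooth_on_derive.
by move=> u ut; rewrite -iterSr; apply: hC; exact: le_trans th.
Qed.

End Taylor.

(** Shared by Fréchet spaces and the real line, the two kinds of target of the calculus below. *)
Definition complete_tvs {R : realType} (E : tvsType R) : Prop :=
  hausdorff_space E /\ forall u : nat -> E,
    (u mn.1 - u mn.2) @[mn --> (\oo, \oo)] --> (0 : E) ->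
    exists l : E, u n @[n --> \oo] --> l.

Lemma complete_frechet {R : realType} (E : frechetType R) : complete_tvs E.
Proof. by split; [exact: frechet_hausdorff|exact: frechet_complete]. Qed.

Lemma cauchy_seminorm {R : realType} (E : tvsType R) (u : nat -> E) :
  (forall p, seminorm p -> forall e : R, 0 < e ->
    exists N, forall i j, (N <= i)%N -> (N <= j)%N -> p (u i - u j) < e) ->
  (u mn.1 - u mn.2) @[mn --> (\oo, \oo)] --> (0 : E).
Proof.
move=> h; apply/cvg_seminorm => p sp e e0; have [N hN] := h p sp e e0.
exists ([set n | (N <= n)%N], [set n | (N <= n)%N]); first by split; exists N.
by move=> [i j] [/= Ni Nj]; rewrite subr0; exact: hN.
Qed.

Lemma complete_real {R : realType} : complete_tvs R.
Proof.
split; first exact: hausdorff_real.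
move=> u /cvg_seminorm/(_ _ seminorm_norm) hu.
suff /cvg_ex[l ul] : cvg (u @ \oo) by exists l.
apply/cauchy_cvgP/cauchyP => e e0.
have [[A B] /= [[M _ AM] [N _ BN]] AB] := hu e e0.
exists (u (maxn M N)); exists N => // n /= Nn.
rewrite /ball/=.
have := AB (maxn M N, n); rewrite /= subr0; apply; split => /=.
  by apply: AM; rewrite /= leq_maxl.
exact: BN.
Qed.

(** * Limits of smooth curves in complete spaces *)

Section LimitOfCurves.
Context {R : realType} {E : tvsType R} (cE : complete_tvs E).
Implicit Types (q : nat -> R -> E) (g : R -> E) (D : set R).

Let hE := cE.1.

(** Smoothness is asked only locally and from some index on: difference quotients of a map on an
    open set make sense near a point only for small steps. *)
Definition evt_smooth D q := forall t0, D t0 -> exists2 d : R, 0 < d &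
  exists N, forall j, (N <= j)%N -> smooth_on [set t | `|t - t0| < d] (q j).

Definition evt_bounded D q := forall t0, D t0 -> forall p, seminorm p -> forall n,
  exists2 d : R, 0 < d & exists N C, forall j (t : R), (N <= j)%N -> `|t - t0| < d ->
    p (dn n (q j) t) <= C.

(** Bounds on second derivatives make the first order expansions of the [q j] uniform in [j].
    Convergence of the values at [t0] and at one nearby point then makes the derivatives Cauchy, and
    the expansion passes to the limit. *)
Lemma limit_has_cd D q g t0 : open D -> evt_smooth D q -> evt_bounded D q ->
  (forall t, D t -> q j t @[j --> \oo] --> g t) -> D t0 ->
  exists2 l, curve_derive (q j) t0 @[j --> \oo] --> l & has_cd g t0 l.
Proof.
move=> oD sq bq qg Dt0.
have [d1 d1_gt0 [N1 h1]] := sq t0 Dt0.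
have /nbhs_ballP[d2 /= d2_gt0 h2] := open_nbhs_nbhs (conj oD Dt0).
have qgp p (sp : seminorm p) t e : D t -> 0 < e -> exists N, forall j, (N <= j)%N ->
    p (q j t - g t) < e.
  move=> Dt e0; have /cvg_seminorm/(_ p sp e e0)[N _ hN] := qg t Dt.
  by exists N => j; exact: hN.
have key p : seminorm p -> exists2 d : R, 0 < d & exists2 C : R, 0 <= C & exists N,
    forall (h : R), `|h| < d -> D (t0 + h) /\ forall j, (N <= j)%N ->
      p (q j (t0 + h) - q j t0 - h *: curve_derive (q j) t0) <= C * `|h| ^+ 2.
  move=> sp; have [d3 d3_gt0 [N2 [C hC]]] := bq t0 Dt0 p sp 2%N.
  exists (Num.min d1 (Num.min d2 d3)); first by rewrite !lt_min d1_gt0 d2_gt0.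
  exists (Num.max 0 C); first by rewrite le_max lexx.
  exists (maxn N1 N2) => h; rewrite !lt_min => /and3P[hd1 hd2 hd3]; split.
    by apply: h2; rewrite /ball/= opprD addrA subrr sub0r normrN.
  move=> j; rewrite geq_max => /andP[j1 j2].
  have := @taylor _ _ hE p 1 _ (q j) t0 h (Num.max 0 C) sp (h1 j j1).
  rewrite big_ord_recr big_ord1 /= expr0 expr1 !divr1 scale1r opprD addrA; apply.
  move=> t th; rewrite /= addrAC subrr add0r; split; first exact: le_lt_trans hd1.
  rewrite le_max orbC; apply/orP; left; apply: hC => //.
  by rewrite addrAC subrr add0r; exact: le_lt_trans hd3.
have [l hl] : exists l : E, curve_derive (q j) t0 @[j --> \oo] --> l.
  pose u j := curve_derive (q j) t0.
  apply: (cE.2 u); apply: (cauchy_seminorm (u := u)) => p sp e e0; rewrite {}/u.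
  have [d d0 [C C0 [N hN]]] := key p sp.
  (* This makes each of the two quadratic remainders at most [h * e / 4]; with four values known up
     to [e * h / 16], the total stays below [h * e]. *)
  pose h := Num.min (d / 2) (e / (4 * (C + 1))).
  have C1 : 0 < C + 1 by rewrite ltr_wpDl.
  have h0 : 0 < h by rewrite lt_min !divr_gt0// mulr_gt0.
  have hd : `|h| < d.
    by rewrite gtr0_norm// /h gt_min; apply/orP; left; lra.
  have [Dh hj] := hN h hd.
  have eh : 0 < e * h / 16 by rewrite divr_gt0// mulr_gt0.
  have [M1 hM1] := qgp p sp t0 _ Dt0 eh.
  have [M2 hM2] := qgp p sp (t0 + h) _ Dh eh.
  exists (maxn N (maxn M1 M2)) => i j.
  rewrite !geq_max => /and3P[Ni M1i M2i] /and3P[Nj M1j M2j].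
  rewrite -(ltr_pM2l h0) -{1}(gtr0_norm h0) -(seminormZ sp).
  have -> : h *: (curve_derive (q i) t0 - curve_derive (q j) t0) =
     (q j (t0 + h) - q j t0 - h *: curve_derive (q j) t0)
     - (q i (t0 + h) - q i t0 - h *: curve_derive (q i) t0)
     + ((q i (t0 + h) - g (t0 + h)) - (q j (t0 + h) - g (t0 + h)))
     - ((q i t0 - g t0) - (q j t0 - g t0)) by lmod_eq R.
  have hC : C * `|h| ^+ 2 <= h * e / 4.
    rewrite gtr0_norm// expr2 mulrA.
    have : h <= e / (4 * (C + 1)) by rewrite /h ge_min lexx orbT.
    rewrite ler_pdivlMr ?mulr_gt0// => hh.
    have : C * h * h <= (C + 1) * h * h by rewrite !ler_wpM2r ?(ltW h0)//; lra.
    have : h * (h * (4 * (C + 1))) <= h * e by rewrite ler_wpM2l// ltW.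
    have -> : h * (h * (4 * (C + 1))) = 4 * ((C + 1) * h * h) by ring.
    lra.
  have := hj i Ni; have := hj j Nj.
  have := hM1 i M1i; have := hM1 j M1j; have := hM2 i M2i; have := hM2 j M2j.
  set Xj := _ - h *: curve_derive (q j) t0; set Xi := _ - h *: curve_derive (q i) t0.
  set Yj := _ - g (t0 + h); set Yi := _ - g (t0 + h).
  set Zj := _ - g t0; set Zi := _ - g t0.
  have := seminormB (Xj - Xi + (Yi - Yj)) (Zi - Zj) sp.
  have := seminormD sp (Xj - Xi) (Yi - Yj).
  have := seminormB Xj Xi sp; have := seminormB Yi Yj sp.
  have := seminormB Zi Zj sp.
  have : 0 < h * e by rewrite mulr_gt0.
  have : e * h = h * e by rewrite mulrC.
  lra.
exists l => // p sp e e0.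
have [d d0 [C C0 [N hN]]] := key p sp.
have C1 : 0 < C + 1 by rewrite ltr_wpDl.
have dC : 0 < Num.min d (e / (C + 1)) by rewrite lt_min d0 divr_gt0.
apply/nbhs_ballP; exists (Num.min d (e / (C + 1))) => //= h.
rewrite /ball/= sub0r normrN lt_min => /andP[hd he].
have [Dh hj] := hN h hd.
apply: (@le_trans _ _ (C * `|h| ^+ 2)); last first.
  rewrite expr2 mulrA ler_wpM2r//.
  move: he; rewrite ltr_pdivlMr// => he.
  have : `|h| * C <= `|h| * (C + 1) by rewrite ler_wpM2l//; lra.
  rewrite [C * _]mulrC; lra.
(* Now [h] is fixed and the index may depend on it: the slack [e1] pays for replacing [g] and [l] by
   [q j] and its derivative. *)
apply/ler_addgt0Pr => e1 e1_gt0.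
have e4 : 0 < e1 / 4 by rewrite divr_gt0.
have h1_gt0 : 0 < `|h| + 1 by rewrite ltr_wpDl.
have [M1 hM1] := qgp p sp t0 _ Dt0 e4.
have [M2 hM2] := qgp p sp (t0 + h) _ Dh e4.
have e4h : 0 < e1 / 4 / (`|h| + 1) by rewrite divr_gt0.
have /cvg_seminorm/(_ p sp _ e4h)[M3 _ hM3] := hl.
pose j := maxn N (maxn M1 (maxn M2 M3)).
have [j0 j1 j2 j3] : [/\ (N <= j)%N, (M1 <= j)%N, (M2 <= j)%N & (M3 <= j)%N].
  by rewrite /j; split; rewrite !leq_max leqnn ?orbT.
have := hj j j0; have := hM1 j j1; have := hM2 j j2; have := hM3 j j3.
rewrite ltr_pdivlMr// => H3 H2 H1 H0.
have -> : g (t0 + h) - g t0 - h *: l =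
  (q j (t0 + h) - q j t0 - h *: curve_derive (q j) t0) - (q j (t0 + h) - g (t0 + h))
  + (q j t0 - g t0) + h *: (curve_derive (q j) t0 - l) by lmod_eq R.
have H4 : p (h *: (curve_derive (q j) t0 - l)) < e1 / 4.
  apply: le_lt_trans H3; rewrite (seminormZ sp) mulrC ler_wpM2l//.
    exact: seminorm_ge0.
  by rewrite lerDl.
move: H0 H1 H2 H4.
set X := _ - h *: curve_derive _ _; set Y := _ - g (t0 + h); set Z := _ - g t0.
set W := h *: _ => H0 H1 H2 H4.
have := seminormD sp (X - Y + Z) W; have := seminormD sp (X - Y) Z.
have := seminormB X Y sp; lra.
Qed.

(** The hypotheses pass to the sequence of derivatives, so [limit_has_cd] can be iterated. The
    convergence of the derivatives is what later identifies mixed partial derivatives. *)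
Lemma limit_smooth D q g : open D -> evt_smooth D q -> evt_bounded D q ->
  (forall t, D t -> q j t @[j --> \oo] --> g t) ->
  smooth_on D g /\
  forall n t, D t -> dn n (q j) t @[j --> \oo] --> dn n g t.
Proof.
move=> oD sq bq qg.
suff h n t : D t -> (exists l, has_cd (dn n g) t l) /\
    dn n (q j) t @[j --> \oo] --> dn n g t.
  split=> [n t Dt|n t Dt]; last by have [] := h n t Dt.
  by apply/tvs_derivableP; have [] := h n t Dt.
elim: n q g sq bq qg t => [|n IH] q g sq bq qg t Dt.
  split; last exact: qg.
  by have [l _ gl] := limit_has_cd oD sq bq qg Dt; exists l.
rewrite iterSr (_ : (fun j => _) = fun j => dn n (curve_derive (q j)) t); last first.
  by apply/funext => j; rewrite -iterSr.
apply: (IH (fun j => curve_derive (q j))) => //.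
- move=> t0 /sq[d d0 [N hN]]; exists d => //; exists N => j Nj.
  by apply: smooth_on_derive; exact: hN.
- move=> t0 Dt0 p sp m; have [d d0 [N [C hC]]] := bq t0 Dt0 p sp m.+1.
  by exists d => //; exists N, C => j u Nj ut; rewrite -iterSr; exact: hC.
- move=> u Du; have [l ql gl] := limit_has_cd oD sq bq qg Du.
  by rewrite (curve_deriveE hE gl).
Qed.

End LimitOfCurves.

(** * Bump functions and the special curve lemma *)

Section Bump.
Context {R : realType}.

(** The powers of 1/x are included because the span of this family is stable under differentiation;
    smoothness then follows for all [n] at once. *)
Definition flat_exp (n : nat) (x : R) : R :=
  if 0 < x then x^-1 ^+ n * expR (- x^-1) else 0.

Lemma flat_exp_le0 n x : x <= 0 -> flat_exp n x = 0.
Proof. by rewrite /flat_exp ltNge => ->. Qed.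

Lemma flat_exp_gt0 n x : 0 < x -> 0 < flat_exp n x.
Proof. by move=> x0; rewrite /flat_exp x0 mulr_gt0 ?expR_gt0// exprn_gt0// invr_gt0. Qed.

Lemma flat_exp_ge0 n x : 0 <= flat_exp n x.
Proof.
by have [/flat_exp_le0 ->|/(flat_exp_gt0 n)/ltW] := leP x 0.
Qed.

Lemma exprn_le_expR n (y : R) : 0 <= y -> y ^+ n <= n`!%:R * expR y.
Proof.
case: n => [|n] y0; first by rewrite expr0 mul1r -expR0 ler_expR.
have := expR_ge1Dxn n y0; rewrite -ler_pdivrMl ?ltr0n ?fact_gt0//.
move=> h; rewrite mulrC; by apply: le_trans h; rewrite lerDr.
Qed.

(** A quadratic bound suffices to give derivative 0 at the origin. It comes from y^(n+2) <= (n+2)!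
    exp(y) with y = 1/x. *)
Lemma flat_exp_sqr n (x : R) : flat_exp n x <= (n.+2)`!%:R * x ^+ 2.
Proof.
have [/flat_exp_le0 ->|x0] := leP x 0; first by rewrite mulr_ge0// sqr_ge0.
rewrite /flat_exp x0 expRN ler_pdivrMr ?expR_gt0//.
have := exprn_le_expR n.+2 (y := x^-1); rewrite invr_ge0 ltW// => /(_ isT).
rewrite -addn2 exprD addn2 => h.
have -> : x^-1 ^+ n = x^-1 ^+ n * x^-1 ^+ 2 * x ^+ 2.
  by rewrite -mulrA -exprMn mulVf ?gt_eqF// expr1n mulr1.
by rewrite [leRHS]mulrAC ler_wpM2r ?sqr_ge0.
Qed.

Lemma has_cd_flat_exp n (x : R) :
  has_cd (flat_exp n) x (flat_exp n.+2 x - n%:R *: flat_exp n.+1 x).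
Proof.
have [x0|x0|->] := ltgtP x 0.
- rewrite !flat_exp_le0 ?ltW// scaler0 subr0.
  apply: (@has_cd_near _ _ (fun=> 0)); last exact: has_cd_cst.
  near=> h; rewrite flat_exp_le0// ltW//; near: h; exact: lt_nbhsl.
- apply: (@has_cd_near _ _ (fun u => u^-1 ^+ n * expR (- u^-1))).
    near=> h; rewrite /flat_exp ifT//; near: h; exact: lt_nbhsr.
  pose F (y : R) := y ^+ n *: expR (- y).
  have -> : flat_exp n.+2 x - n%:R *: flat_exp n.+1 x = - x^-1 ^+ 2 *:
     ((n%:R * x^-1 ^+ n.-1) *: expR (- x^-1) + x^-1 ^+ n *: (-1 *: expR (- x^-1))).
    rewrite /flat_exp x0 /GRing.scale /=.
    case: (n) => [|m] /=; first by rewrite !expr0; ring.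
    by rewrite !exprS; ring.
  apply: (@has_cd_comp _ _ (fun u : R => u^-1) F); last first.
    apply: has_cd_scale.
      apply/has_cd_derive; apply: DeriveDef; first exact: exprn_derivable.
      by rewrite exp_derive [LHS]mulr1.
    apply: (@has_cd_comp _ _ (fun u : R => - u) expR).
      by apply: has_cdN; exact: has_cd_id.
    by apply/has_cd_derive; exact: is_derive_expR.
  apply/has_cd_derive; apply: DeriveDef.
    by apply: derivableV; rewrite ?gt_eqF//; exact: derivable_id.
  by rewrite deriveV ?gt_eqF// ?derive_id ?exprVn ?[LHS]mulr1//; exact: derivable_id.
- rewrite !flat_exp_le0// scaler0 subr0 => p sp e e0.
  pose k := (n.+2)`!%:R * p 1 + 1.
  have k0 : 0 < k by rewrite ltr_wpDl// mulr_ge0// (seminorm_ge0 _ sp).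
  near=> h; rewrite add0r (flat_exp_le0 n (lexx 0)) subr0 scaler0 subr0 (seminorm_real sp).
  rewrite ger0_norm ?flat_exp_ge0//.
  apply: le_trans (ler_wpM2r (seminorm_ge0 _ sp) (flat_exp_sqr n h)) _.
  have -> : (n.+2)`!%:R * h ^+ 2 * p 1 = (n.+2)`!%:R * p 1 * `|h| * `|h|.
    have hh : `|h| * `|h| = h ^+ 2 by rewrite -normrM -expr2 ger0_norm ?sqr_ge0.
    by rewrite -[RHS]mulrA hh; ring.
  rewrite ler_wpM2r//; apply: (@le_trans _ _ (k * `|h|)).
    by rewrite ler_wpM2r// /k lerDl.
  rewrite mulrC -ler_pdivlMr//.
  by near: h; apply: (@nbhs0_le _ R); rewrite divr_gt0.
Unshelve. all: by end_near. Qed.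

Lemma smooth_flat_exp : smooth_on setT (flat_exp 0).
Proof.
apply/smooth_onP => m; move: 0%N; elim: m => [|m IH] n.
  by apply: Ck0_intro => t _; exact: has_cd_flat_exp.
apply: (Ck_intro hausdorff_real openT) => [t _|]; first exact: has_cd_flat_exp.
apply: (CkD hausdorff_real openT) => //.
apply: (@Ck_ext _ _ _ _ (fun t => (- n%:R) *: flat_exp n.+1 t)); first exact: openT.
  by move=> t _; rewrite scaleNr.
apply: (Ck_scale hausdorff_real openT) => //.
by apply: (Ck_cst hausdorff_real); exact: openT.
Qed.

Lemma smooth_onM D (f g : R -> R) : open D -> smooth_on D f -> smooth_on D g ->
  smooth_on D (fun t => f t * g t).
Proof. exact: (smooth_on_scale hausdorff_real). Qed.

Lemma smooth_bump : exists b : R -> R, [/\ smooth_on setT b,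
  forall x, `|x| <= 1 -> b x = 1, forall x, 2 <= `|x| -> b x = 0 & forall x, 0 <= b x].
Proof.
have h2 : (0 : R) < 2^-1 by rewrite invr_gt0.
(* For |x| <= 1 the inner term is 0 and [b0] is constant. For |x| >= 2 it is at least exp(-1/3) >=
   2/3 > 1/2, so the outer argument is negative and [b0] vanishes. *)
pose b0 x := flat_exp 0 (2^-1 - flat_exp 0 (x * x - 1)).
have hR := @hausdorff_real R.
have sc (a : R) : smooth_on setT (fun=> a : R).
  by apply: (smooth_on_cst hR); exact: openT.
have sb : smooth_on setT b0.
  apply: (@smooth_on_comp _ _ hR _ setT) => //; first exact: openT; last exact: smooth_flat_exp.
  apply: smooth_onB => //; first exact: openT.
  apply: (@smooth_on_comp _ _ hR _ setT) => //; first exact: openT; last exact: smooth_flat_exp.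
  apply: smooth_onB => //; first exact: openT.
  by apply: smooth_onM; [exact: openT|exact/smooth_on_id/openT|exact/smooth_on_id/openT].
have c0 := flat_exp_gt0 0 h2.
exists (fun x => (flat_exp 0 2^-1)^-1 * b0 x); split.
- by apply: smooth_onM => //; exact: openT.
- move=> x x1; rewrite /b0 (flat_exp_le0 0 (x := x * x - 1)) ?subr0 ?mulVf ?gt_eqF//.
  by rewrite subr_le0 -expr2 -[x ^+ 2]ger0_norm ?sqr_ge0// normrX exprn_ile1.
- move=> x x2; rewrite /b0 (flat_exp_le0 0 (x := _ - _)) ?mulr0// subr_le0.
  have x3 : 3 <= x * x - 1.
    rewrite lerBrDr -expr2 -[x ^+ 2]ger0_norm ?sqr_ge0// normrX.
    have : 2 * 2 <= `|x| * `|x| by rewrite ler_pM.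
    by rewrite expr2; lra.
  have x0 : 0 < x * x - 1 by lra.
  rewrite /flat_exp x0 expr0 mul1r.
  apply: le_trans (expR_ge1Dx _).
  have : (x * x - 1)^-1 <= 3^-1 by rewrite lef_pV2// posrE.
  lra.
- by move=> x; rewrite mulr_ge0// ?flat_exp_ge0// invr_ge0 flat_exp_ge0.
Qed.

Lemma dn_compact_bounded (f : R -> R) n : smooth_on setT f ->
  (forall x, 2 <= `|x| -> f x = 0) -> exists2 M, 0 <= M & forall x, `|dn n f x| <= M.
Proof.
move=> sf f0.
have cont : {within `[-2, 2], continuous (fun x => `|dn n f x|)}.
  apply: continuous_subspaceT => x.
  apply: (@continuous_comp _ _ _ (dn n f) Num.norm); last exact: norm_continuous.
  exact: (smooth_on_cvg (smooth_on_dn n sf)).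
have [x0 _ hx0] := EVT_max (ge0_cp (ler0n R 2)).2 cont.
exists `|dn n f x0| => // x.
have [x2|x2] := leP `|x| 2.
  by apply: hx0; rewrite in_itv/= -ler_norml.
have oD : open [set x : R | 2 < `|x|].
  have -> : [set x : R | 2 < `|x|] = Num.norm @^-1` [set x | 2 < x] by [].
  apply: open_comp; first by move=> y _; exact: norm_continuous.
  exact: open_gt.
rewrite (@dn_eq_on _ _ n _ f (fun=> 0) x oD) => [|u /= /ltW /f0//|//].
suff -> : dn n (fun=> 0 : R) = fun=> 0 by rewrite normr0.
elim: n {cont x0 hx0} => //= n ->; apply/funext => t.
by apply: (curve_deriveE hausdorff_real); exact: has_cd_cst.
Qed.

(** A bounded substitute for the identity: it turns data defined near a point into data defined for
    all real parameters, both for test curves and for variations. *)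
Lemma smooth_cutoff (d : R) : 0 < d -> exists k : R -> R,
  [/\ smooth_on setT k, forall t, `|k t| < d &
   exists2 r : R, 0 < r & forall t, `|t| < r -> k t = t].
Proof.
move=> d0; have [b [sb b1 b0 _]] := smooth_bump.
have [M M0 hM] := @dn_compact_bounded _ 0 sb b0.
(* The bump cuts off at |t| = 2 e, so the product is at most 2 e M, which is less than [d]. *)
pose e := d / (2 * M + 1).
have M1 : 0 < 2 * M + 1 by rewrite ltr_wpDl// mulr_ge0.
have e0 : 0 < e by rewrite divr_gt0.
exists (fun t => t * b (e^-1 * t)); split.
- apply: smooth_onM; [exact: openT|exact/smooth_on_id/openT|].
  apply: (@smooth_on_comp _ _ hausdorff_real _ setT) => //; first exact: openT.
  by apply: (smooth_onZ hausdorff_real); [exact: openT|exact/smooth_on_id/openT].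
- move=> t; have [te|te] := leP (2 * e) `|t|.
    rewrite b0 ?mulr0 ?normr0//.
    by rewrite normrM gtr0_norm ?invr_gt0// mulrC ler_pdivlMr.
  rewrite normrM; apply: (@le_lt_trans _ _ ((2 * e) * M)).
    by rewrite ler_pM// ?(ltW te)//; exact: hM.
  have : e * (2 * M + 1) = d by rewrite /e divfK// gt_eqF.
  have -> : 2 * e * M = e * (2 * M + 1) - e by ring.
  lra.
- exists e => // t te; rewrite b1 ?mulr1//.
  by rewrite normrM gtr0_norm ?invr_gt0// mulrC ler_pdivrMr// mul1r ltW.
Qed.

End Bump.

Section SpecialCurve.
Context {R : realType}.

Lemma dn_sum {E : tvsType R} (hE : hausdorff_space E) n (D : set R)
    (phi : nat -> R -> E) j (t : R) :
  open D -> (forall i, smooth_on D (phi i)) -> D t ->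
  smooth_on D (fun u => \sum_(i < j) phi i u) /\
  dn n (fun u => \sum_(i < j) phi i u) t = \sum_(i < j) dn n (phi i) t.
Proof.
move=> oD sphi Dt; elim: j => [|j [IH1 IH2]].
  have -> : (fun u => \sum_(i < 0) phi i u) = fun=> 0.
    by apply/funext => u; rewrite big_ord0.
  split; first exact: smooth_on_cst.
  rewrite big_ord0; suff -> : dn n (fun=> 0 : E) = fun=> 0 by [].
  elim: n => //= n ->; apply/funext => u.
  by apply: (curve_deriveE hE); exact: has_cd_cst.
have -> : (fun u => \sum_(i < j.+1) phi i u) = fun u => \sum_(i < j) phi i u + phi j u.
  by apply/funext => u; rewrite big_ord_recr.
split; first exact: smooth_onD.
by rewrite (dnD hE n oD) // IH2 big_ord_recr.
Qed.

(** The special curve meets its [k]-th target at time [tick k]. Rescaling a bump to a width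
    comparable with [tick k] costs a factor of order (tick k)^-n in the [n]-th derivative; [fast k]
    decays faster than every power of [tick k] and absorbs it. *)
Definition fast (k : nat) : R := 2^-1 ^+ (k ^ 2).
Definition tick (k : nat) : R := 2^-1 ^+ k.

Lemma tick_gt0 k : 0 < tick k. Proof. by rewrite exprn_gt0// invr_gt0. Qed.
Lemma fast_gt0 k : 0 < fast k. Proof. by rewrite exprn_gt0// invr_gt0. Qed.

Lemma tick_half k i : (k < i)%N -> 2 * tick i <= tick k.
Proof.
move=> ki; rewrite /tick -[i](subnKC ki) exprD exprS !mulrA mulfV// mul1r.
by rewrite ler_piMr ?exprn_ge0// ?exprn_ile1 ?invr_ge0// invf_le1// ler1n.
Qed.

(** On exponents of 2 the claim is k (n+1) <= k^2 + (n+1)^2. *)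
Lemma fast_tick n k : fast k * (tick (k + 3))^-1 ^+ n <=
  2 ^+ (n.+1 ^ 2 + 3 * n) * tick k.
Proof.
rewrite /fast /tick !exprVn invrK -exprM.
rewrite mulrC ler_pdivrMr ?exprn_gt0// mulrAC ler_pdivlMr ?exprn_gt0//.
rewrite -!exprD ler_weXn2l ?ler1n//.
have : (2 * (k * n.+1) <= k ^ 2 + n.+1 ^ 2)%N by exact: nat_Cauchy.
move=> h; rewrite mulnDl addnAC -mulnSr [leqRHS]addnAC leq_add2r.
by rewrite addnC in h; apply: leq_trans h; rewrite leq_pmull.
Qed.

Lemma sum_tick j : \sum_(k < j) tick k <= 2.
Proof.
suff -> : \sum_(k < j) tick k = 2 - 2 * tick j by rewrite lerBlDr lerDl mulr_ge0// ltW// tick_gt0.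
elim: j => [|j IH]; first by rewrite big_ord0 /tick expr0 mulr1 subrr.
by rewrite big_ord_recr /= IH /tick exprS; field.
Qed.

(** The curve is a sum of bumps at the times [tick k], each carrying an affine motion of velocity
    [fast k * w]. Targets and velocities tend to 0 fast enough for smoothness at time 0, where the
    bumps accumulate. *)
Lemma special_curve (y : nat -> R) (w : R) : (forall k, `|y k| <= fast k) ->
  exists a : R -> R, [/\ smooth_on setT a, a 0 = 0 &
    forall k (t : R), `|t - tick k| <= tick (k + 3) -> a t = y k + fast k * (t - tick k) * w].
Proof.
move=> yf; have [b [sb b1 b0 _]] := @smooth_bump R.
have hR := @hausdorff_real R.
pose b' x := x * b x.
have sb' : smooth_on setT b' by apply: smooth_onM => //; [exact: openT|exact/smooth_on_id/openT].
have b'0 (x : R) : 2 <= `|x| -> b' x = 0 by move=> /b0 bx; rewrite /b' bx mulr0.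
pose s k := (tick (k + 3))^-1.
have s0 k : 0 < s k by rewrite invr_gt0 tick_gt0.
pose phi k t := y k *: b (s k * t + - (s k * tick k)) +
   (fast k * tick (k + 3) * w) *: b' (s k * t + - (s k * tick k)).
have saff k : smooth_on setT (fun t : R => s k * t + - (s k * tick k)).
  apply: (smooth_onD hR); [exact: openT| |by apply: (smooth_on_cst hR); exact: openT].
  by apply: (smooth_onZ hR); [exact: openT|exact/smooth_on_id/openT].
have scomp k (f : R -> R) : smooth_on setT f ->
    smooth_on setT (fun t : R => f (s k * t + - (s k * tick k))).
  by move=> sf; apply: (@smooth_on_comp _ _ hR _ setT) => //; exact: openT.
have sphi k : smooth_on setT (phi k).
  apply: (smooth_onD hR); first exact: openT.
    by apply: (smooth_onZ hR); [exact: openT|exact: scomp].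
  by apply: (smooth_onZ hR); [exact: openT|exact: scomp].
have affE k t : s k * t + - (s k * tick k) = s k * (t - tick k) by rewrite mulrBr.
have phi0 k t : 2 * tick (k + 3) <= `|t - tick k| -> phi k t = 0.
  move=> h; have h2 : 2 <= `|s k * t + - (s k * tick k)|.
    by rewrite affE normrM gtr0_norm// /s mulrC ler_pdivlMr ?tick_gt0.
  by rewrite /phi b0// b'0// !scaler0 addr0.
have phi1 k t : `|t - tick k| <= tick (k + 3) -> phi k t = y k + fast k * (t - tick k) * w.
  move=> h; have h1 : `|s k * t + - (s k * tick k)| <= 1.
    by rewrite affE normrM gtr0_norm// /s mulrC ler_pdivrMr ?tick_gt0// mul1r.
  rewrite /phi /b' b1// mulr1 affE [y k *: _]mulr1; congr (_ + _).
  rewrite /s /GRing.scale /=; field.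
  by rewrite gt_eqF// tick_gt0.
(* Bump [k] lives within [2 * tick (k + 3)], a quarter of [tick k], of [tick k]. The shift by 3 thus
   makes the supports disjoint and keeps them in t > 0. *)
have t3 k : tick k = 8 * tick (k + 3) by rewrite /tick exprD; field.
have far i k t : i != k -> `|t - tick k| <= tick (k + 3) -> phi i t = 0.
  move=> ik tk; apply: phi0; move: tk; rewrite ler_norml => /andP[l1 l2].
  have := t3 k; have := t3 i; have := tick_gt0 (k + 3); have := tick_gt0 (i + 3).
  move: ik; rewrite neq_ltn => /orP[/tick_half|/tick_half] h p1 p2 p3 p4.
    rewrite distrC ger0_norm; lra.
  rewrite ger0_norm; lra.
pose q j t := \sum_(i < j) phi i t.
have ev (t : R) : exists N, forall j, (N <= j)%N -> q j t = q N t.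
  suff [N hN] : exists N, forall i, (N <= i)%N -> phi i t = 0.
    exists N => j Nj; rewrite /q -!(big_mkord xpredT (fun i => phi i t)).
    rewrite (@big_cat_nat _ _ _ N)//= [X in _ + X]big_nat_cond [X in _ + X]big1 ?addr0// => i.
    by rewrite andbT => /andP[/hN].
  have [t0|t0] := leP t 0.
    exists 0%N => i _; apply: phi0; rewrite distrC.
    have := t3 i; have := tick_gt0 (i + 3) => p1 p2.
    rewrite ger0_norm; lra.
  have [N hN] : exists N, tick N < t / 2.
    have h : (2^-1 : R) ^+ n @[n --> \oo] --> (0 : R).
      by apply: cvg_expr; rewrite ger0_norm ?invr_ge0// invf_lt1// ltr1n.
    have t2 : 0 < t / 2 by rewrite divr_gt0.
    have := @cvgr0_norm_lt _ _ _ _ _ _ h _ t2 => -[N _ /(_ N (leqnn N))].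
    by rewrite /= -/(tick N) gtr0_norm ?tick_gt0// => ?; exists N.
  exists N => i Ni; apply: phi0.
  have tiN : tick i <= tick N.
    by rewrite /tick ler_wiXn2l// ?invr_ge0// invf_le1// ler1n.
  have := t3 i; have := tick_gt0 (i + 3) => p1 p2.
  rewrite ger0_norm; lra.
have [N hN] := choice ev.
(* The index [N t] need not be bounded near 0; smoothness there rests on derivative bounds uniform
   in the number of terms. *)
pose a t := q (N t) t.
have qa t : setT t -> q j t @[j --> \oo] --> a t.
  move=> _; apply: cvg_near_cst; exists (N t) => // j; exact: hN.
exists a; split.
- apply: (limit_smooth (q := q) complete_real openT _ _ qa).1.
    move=> t0 _; exists 1 => //; exists 0%N => j _.
    apply: (smooth_on_sub (D := setT)) => //.
    by have [] := @dn_sum _ hR 0 setT phi j 0 openT sphi I.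
  move=> t0 _ p sp n; exists 1 => //; exists 0%N.
  have [M0 M00 hM0] := dn_compact_bounded n sb b0.
  have [M1 M10 hM1] := dn_compact_bounded n sb' b'0.
  exists (2 ^+ (n.+1 ^ 2 + 3 * n) * (M0 + `|w| * M1) * 2 * p 1) => j t _ _.
  rewrite (seminorm_real sp) ler_wpM2r ?(seminorm_ge0 _ sp)//.
  have [_ ->] := @dn_sum _ hR n setT phi j t openT sphi I.
  apply: le_trans (ler_norm_sum _ _ _) _.
  apply: (@le_trans _ _ (2 ^+ (n.+1 ^ 2 + 3 * n) * (M0 + `|w| * M1) *
    \sum_(k < j) tick k)); last first.
    by rewrite ler_wpM2l ?sum_tick// mulr_ge0 ?exprn_ge0// addr_ge0// mulr_ge0.
  rewrite mulr_sumr; apply: ler_sum => k _.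
  rewrite mulrAC; apply: (@le_trans _ _ (fast k * s k ^+ n * (M0 + `|w| * M1))); last first.
    by rewrite ler_wpM2r ?fast_tick// addr_ge0// mulr_ge0.
  have -> : dn n (phi k) t = s k ^+ n * (y k * dn n b (s k * t + - (s k * tick k)) +
      (fast k * tick (k + 3) * w) * dn n b' (s k * t + - (s k * tick k))).
    rewrite /phi (dnD hR n openT) //; last 2 first.
    - by apply: (smooth_onZ hR); [exact: openT|exact: scomp].
    - by apply: (smooth_onZ hR); [exact: openT|exact: scomp].
    rewrite (dnZ hR n _ openT) ?(dnZ hR n _ openT)//; [|exact: scomp|exact: scomp].
    rewrite (dn_affine hR n openT sb) // (dn_affine hR n openT sb') //.
    by rewrite /GRing.scale /=; ring.
  rewrite normrM ger0_norm ?exprn_ge0 ?(ltW (s0 k))//.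
  rewrite [leRHS](_ : _ = s k ^+ n * (fast k * (M0 + `|w| * M1))); last by ring.
  apply: ler_wpM2l; first by rewrite exprn_ge0// (ltW (s0 k)).
  apply: le_trans (ler_normD _ _) _; rewrite mulrDr lerD//.
    by rewrite normrM ler_pM.
  rewrite !normrM [X in _ <= X]mulrA ler_pM// ler_pM//.
  rewrite gtr0_norm ?fast_gt0// gtr0_norm ?tick_gt0// ler_piMr ?(ltW (fast_gt0 k))//.
  by rewrite /tick exprn_ile1 ?invr_ge0// invf_le1// ler1n.
- rewrite /a /q big1// => i _; apply: phi0; rewrite sub0r normrN gtr0_norm ?tick_gt0//.
  have := t3 i; have := tick_gt0 (i + 3); lra.
- move=> k t tk; rewrite -(phi1 k t tk) /a.
  have -> : q (N t) t = q (maxn (N t) k.+1) t by rewrite hN// leq_maxl.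
  have kj : (k < maxn (N t) k.+1)%N by rewrite leq_maxr.
  rewrite /q (bigD1 (Ordinal kj))//= big1 ?addr0// => i ik.
  by apply: (far i k) => //; apply: contra ik => /eqP ik; apply/eqP/val_inj.
Qed.

End SpecialCurve.

(** * Convenient smoothness on the plane *)

Section ConvenientSmooth.
Context {R : realType}.

Lemma open_ball_real (t0 d : R) : open [set t | `|t - t0| < d].
Proof.
have -> : [set t | `|t - t0| < d] = ball t0 d.
  by apply/funext => t; rewrite /ball/= distrC.
exact: ball_open.
Qed.

Lemma near_ball_real (t0 d : R) : 0 < d -> \forall t \near t0, `|t - t0| < d.
Proof.
move=> d0; apply/nbhs_ballP; exists d => // t.
by rewrite /ball/= distrC.
Qed.

Lemma ball_real_sub (D : set R) t0 : open D -> D t0 ->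
  exists2 d : R, 0 < d & forall t, `|t - t0| < d -> D t.
Proof.
move=> oD Dt; have /nbhs_ballP[d /= d0 hd] := open_nbhs_nbhs (conj oD Dt).
by exists d => // t td; apply: hd; rewrite /ball/= distrC.
Qed.

Lemma open_ball0_real (d : R) : open [set t : R | `|t| < d].
Proof.
have := @open_ball_real 0 d; congr open; apply/seteqP.
by split => t /=; rewrite subr0.
Qed.

Lemma open_strip (I : set R) : open I -> open ([set: R] `*` I).
Proof.
move=> oI; rewrite openE => -[s t] [/= _ It].
have c2 : x.2 @[x --> (s, t)] --> t by exact: cvg_snd.
have h : nbhs (s, t) [set x : R * R | I x.2].
  exact: (c2 _ (open_nbhs_nbhs (conj oI It))).
by apply: filterS h => -[? ?].
Qed.

(* Only curves defined on the whole line are tested by [conv_smooth]; a curve on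
   an open set is made global near a point by the reparametrization
   [t0 + k (t - t0)], with [k] the identity near 0 and small everywhere. *)
Lemma conv_smooth_comp {E F : tvsType R} (U : set E) (f : E -> F) (D : set R)
    (c : R -> E) : hausdorff_space E -> hausdorff_space F -> open D ->
  conv_smooth U f -> smooth_on D c -> (forall t, D t -> U (c t)) ->
  smooth_on D (fun t => f (c t)).
Proof.
move=> hE hF oD sf sc Dc; apply: smooth_on_local => t0 Dt0.
have [d d0 hd] := ball_real_sub oD Dt0.
have [k [sk kd [r r0 kr]]] := smooth_cutoff d0.
have hR := @hausdorff_real R.
pose phi t := t0 + k (t - t0).
have sphi : smooth_on setT phi.
  apply: (smooth_onD hR); [exact: openT|by apply: (smooth_on_cst hR); exact: openT|].
  apply: (@smooth_on_comp _ _ hR setT setT) => //; first exact: openT.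
  apply: (smooth_onB hR); [exact: openT|exact/smooth_on_id/openT|].
  by apply: (smooth_on_cst hR); exact: openT.
have Dphi t : D (phi t) by apply: hd; rewrite /phi addrAC subrr add0r; exact: kd.
have /(sf _) : smooth_curve (fun t => c (phi t)).
  by apply/smooth_curveP; apply: (@smooth_on_comp _ _ hE setT D) => //; exact: openT.
move=> /(_ (fun t => Dc _ (Dphi t))) /smooth_curveP sfc.
exists [set t | `|t - t0| < r]; last by rewrite /= subrr normr0.
apply: smooth_on_ext (smooth_on_sub (fun _ _ => I) sfc); first exact: open_ball_real.
by move=> t /= tr; rewrite /= /phi kr// subrKC.
Qed.

(** Test curves are given by coordinates on an arbitrary open set rather than on the whole line;
    this local form is easily transported by shears and by the exchange of variables. *)
Definition csmooth2 {E : tvsType R} (U : set (R * R)) (f : R -> R -> E) :=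
  forall (D : set R) (a b : R -> R), open D -> smooth_on D a -> smooth_on D b ->
    (forall t, D t -> U (a t, b t)) -> smooth_on D (fun t => f (a t) (b t)).

Lemma conv_smooth_csmooth2 {E : tvsType R} (U : set (R * R)) (f : R -> R -> E) :
  hausdorff_space E ->
  conv_smooth (E := (R * R)%type) U (fun x : R * R => f x.1 x.2) -> csmooth2 U f.
Proof.
move=> hE sf D a b oD sa sb Dab; have hR := @hausdorff_real R.
apply: (conv_smooth_comp (hausdorff_pair hR hR) hE oD sf (smooth_on_pair hR hR oD sa sb)).
exact: Dab.
Qed.

Lemma open_box (U : set (R * R)) (u v : R) : open U -> U (u, v) ->
  exists2 d : R, 0 < d & forall x y, `|x| < d -> `|y| < d -> U (u + x, v + y).
Proof.
move=> oU Uuv; have [[A B] /= [nA nB] AB] := open_nbhs_nbhs (conj oU Uuv).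
have /nbhs_ballP[d /= d0 hd] := nA; have /nbhs_ballP[e /= e0 he] := nB.
exists (Num.min d e); first by rewrite lt_min d0.
move=> x y; rewrite !lt_min => /andP[xd _] /andP[_ ye]; apply: AB; split => /=.
  by apply: hd; rewrite /ball/= opprD addrA subrr sub0r normrN.
by apply: he; rewrite /ball/= opprD addrA subrr sub0r normrN.
Qed.

Lemma open_curve_preimage (U : set (R * R)) (D : set R) (a b : R -> R) :
  open U -> open D -> smooth_on D a -> smooth_on D b ->
  open [set t | D t /\ U (a t, b t)].
Proof.
move=> oU oD sa sb; rewrite openE => t [/= Dt Ut].
have nU : nbhs (a t, b t) U by exact: open_nbhs_nbhs.
have := cvg_pair (smooth_on_cvg sa Dt) (smooth_on_cvg sb Dt) nU.
move=> h; apply: filterI; last exact: h.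
exact: open_nbhs_nbhs.
Qed.

Lemma smooth_on_affine (D : set R) (x w : R) : open D ->
  smooth_on D (fun t : R => x + t * w).
Proof.
move=> oD; have hR := @hausdorff_real R.
apply: (smooth_onD hR oD); first exact: (smooth_on_cst hR).
apply: smooth_onM => //; first exact: smooth_on_id.
exact: (smooth_on_cst hR).
Qed.

Section Plane.
Context {E : tvsType R} (hE : hausdorff_space E).
Variables (U : set (R * R)) (f : R -> R -> E).
Hypotheses (oU : open U) (sf : csmooth2 U f).

Lemma open_line (x y v w : R) : open [set t : R | U (x + t * v, y + t * w)].
Proof.
have := open_curve_preimage oU openT (smooth_on_affine x v openT)
  (smooth_on_affine y w openT).
by congr open; apply/seteqP; split => t //= [].
Qed.

Lemma smooth_on_line (x y v w : R) :
  smooth_on [set t : R | U (x + t * v, y + t * w)]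
    (fun t => f (x + t * v) (y + t * w)).
Proof.
by apply: sf => //; [exact: open_line|exact/smooth_on_affine/open_line..].
Qed.

Lemma open_slice1 v : open [set u : R | U (u, v)].
Proof.
have := @open_line 0 v 1 0; congr open; apply/seteqP.
by split => u /=; rewrite add0r mulr1 mulr0 addr0.
Qed.

Lemma open_slice2 u : open [set v : R | U (u, v)].
Proof.
have := @open_line u 0 0 1; congr open; apply/seteqP.
by split => v /=; rewrite add0r mulr1 mulr0 addr0.
Qed.

Lemma smooth_slice1 v : smooth_on [set u : R | U (u, v)] (f ^~ v).
Proof.
apply: sf => //; [exact: open_slice1|exact/smooth_on_id/open_slice1|].
by apply: (smooth_on_cst (@hausdorff_real R)); exact: open_slice1.
Qed.

Lemma smooth_slice2 u : smooth_on [set v : R | U (u, v)] (f u).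
Proof.
apply: sf => //; [exact: open_slice2| |exact/smooth_on_id/open_slice2].
by apply: (smooth_on_cst (@hausdorff_real R)); exact: open_slice2.
Qed.

(* Otherwise a smooth curve runs, ever more slowly, through points where the
   derivatives in the direction (v, w) blow up. *)
Lemma bounded_dir (x y v w : R) p n : U (x, y) -> seminorm p ->
  exists2 d : R, 0 < d & exists C, forall a b : R, `|a| < d -> `|b| < d ->
    p (dn n (fun t => f (x + a + t * v) (y + b + t * w)) 0) <= C.
Proof.
move=> Uxy sp; have [d0 d0_gt0 hd0] := open_box oU Uxy.
have hR := @hausdorff_real R.
apply: contrapT => H.
(* The curve moves with parameter speed [fast k] near its [k]-th target, so its [n]-th derivative
   there carries the factor [fast k ^+ n]; the threshold leaves more than [k]. *)
have /choice[z hz] (k : nat) : exists z : R * R,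
    [/\ `|z.1| < Num.min (fast k) d0, `|z.2| < Num.min (fast k) d0 &
      k%:R / fast k ^+ n < p (dn n (fun t => f (x + z.1 + t * v) (y + z.2 + t * w)) 0)].
  apply: contrapT => Hk; apply: H; exists (Num.min (fast k) d0).
    by rewrite lt_min fast_gt0.
  exists (k%:R / fast k ^+ n) => a b ha hb; rewrite leNgt; apply/negP => lt.
  by apply: Hk; exists (a, b).
have [|a [sa a0 ha]] := @special_curve R (fun k => (z k).1) v.
  by move=> k; have [+ _ _] := hz k; rewrite lt_min => /andP[/ltW].
have [|b [sb b0 hb]] := @special_curve R (fun k => (z k).2) w.
  by move=> k; have [_ + _] := hz k; rewrite lt_min => /andP[/ltW].
have scst u : smooth_on setT (fun=> u : R) by apply: (smooth_on_cst hR); exact: openT.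
have sxa : smooth_on setT (fun t => x + a t) by apply: (smooth_onD hR) => //; exact: openT.
have syb : smooth_on setT (fun t => y + b t) by apply: (smooth_onD hR) => //; exact: openT.
pose D := [set t | setT t /\ U (x + a t, y + b t)].
have oD : open D by apply: open_curve_preimage => //; exact: openT.
have D0 : D 0 by split => //; rewrite a0 b0 !addr0.
have sg : smooth_on D (fun t => f (x + a t) (y + b t)).
  apply: sf => //; [exact: (smooth_on_sub (D := setT))|exact: (smooth_on_sub (D := setT))|].
  by move=> t [].
set g := fun t => f (x + a t) (y + b t) in sg.
have gk k : k%:R < p (dn n g (tick k)).
  have [z1 z2 hp] := hz k.
  move: z1 z2; rewrite !lt_min => /andP[_ z1] /andP[_ z2].
  pose F t := f (x + (z k).1 + t * v) (y + (z k).2 + t * w).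
  have gF : \forall t \near tick k, g t = F (fast k * t + - (fast k * tick k)).
    have := near_ball_real (tick k) (tick_gt0 (k + 3)).
    apply: filterS => t /ltW tk.
    by rewrite /g /F (ha k t tk) (hb k t tk) -mulrBr !addrA.
  have -> : dn n g (tick k) = dn n (fun t => F (fast k * t + - (fast k * tick k))) (tick k).
    exact: nbhs_singleton (dn_near n gF).
  have sF := @smooth_on_line (x + (z k).1) (y + (z k).2) v w.
  have oF := @open_line (x + (z k).1) (y + (z k).2) v w.
  rewrite (dn_affine hE n oF sF) /=; last by rewrite subrr !mul0r !addr0; exact: hd0.
  rewrite subrr (seminormZ sp) ger0_norm ?exprn_ge0 ?(ltW (fast_gt0 k))//.
  by rewrite mulrC -ltr_pdivrMr// exprn_gt0// fast_gt0.
(* Continuity of the [n]-th derivative at 0 bounds it at all late times [tick k], against [gk]. *)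
have gc := smooth_on_cvg (smooth_on_dn n sg) D0.
have /cvg_seminorm/(_ p sp 1 ltr01) := gc.
move=> /nbhs_ballP[e /= e0 he].
have h : (2^-1 : R) ^+ k @[k --> \oo] --> (0 : R).
  by apply: cvg_expr; rewrite ger0_norm ?invr_ge0// invf_lt1// ltr1n.
have [N _ hN] := @cvgr0_norm_lt _ _ _ _ _ _ h _ e0.
pose B := p (dn n g 0) + 1.
have [M hM] : exists M : nat, B < M%:R.
  exists (Num.truncn B).+1; apply: truncnS_gt.
pose k := maxn N M.
have := gk k; apply/negP; rewrite -leNgt.
have := he (tick k); rewrite /ball/= sub0r normrN => /(_ (hN _ (leq_maxl _ _))) hk.
apply: (@le_trans _ _ B).
  rewrite -[dn n g (tick k)](subrK (dn n g 0)).
  apply: le_trans (seminormD sp _ _) _; rewrite /B; lra.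
by apply: le_trans (ltW hM) _; rewrite ler_nat leq_maxr.
Qed.

End Plane.

End ConvenientSmooth.

(** * Finite differences and the Lipschitz estimate in the plane *)

Section Weights.
Context {R : realType}.

(** These are the weights (-1)^(n-i) / (i! (n-i)!) of the [n]-th finite difference divided by n!,
    built by differencing once more at each step; 0^0 counts as 1. *)
Lemma diff_weights n : exists w : nat -> R, forall k, (k <= n)%N ->
  \sum_(i < n.+1) w i * i%:R ^+ k = (k == n)%:R.
Proof.
elim: n => [|n [w hw]].
  by exists (fun=> 1) => -[|//] _; rewrite big_ord1 expr0 mulr1.
exists (fun i => ((if i is j.+1 then w j else 0) - (if (i <= n)%N then w i else 0)) / n.+1%:R).
move=> k kn.
under eq_bigr do rewrite mulrAC mulrBl.
rewrite -mulr_suml sumrB big_ord_recl /= mul0r add0r.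
rewrite [X in _ - X]big_ord_recr /= ltnn mul0r addr0 -sumrB.
have -> : \sum_(i < n.+1) (w i * (bump 0 i)%:R ^+ k - (if (i <= n)%N then w i else 0) * i%:R ^+ k) =
   \sum_(i < n.+1) \sum_(j < k) 'C(k, j)%:R * (w i * i%:R ^+ j).
  apply: eq_bigr => i _; rewrite -ltnS ltn_ord -mulrBr.
  have -> : (bump 0 i)%:R = 1 + i%:R :> R by rewrite /bump leq0n natrD.
  rewrite exprDn big_ord_recr /= subnn expr0 mul1r binn mulr1n addrK mulr_sumr.
  by apply: eq_bigr => j _; rewrite expr1n mul1r -mulr_natl mulrCA.
rewrite exchange_big /=.
have -> : \sum_(j < k) \sum_(i < n.+1) 'C(k, j)%:R * (w i * i%:R ^+ j) =
    \sum_(j < k) 'C(k, j)%:R * (j == n :> nat)%:R.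
  apply: eq_bigr => j _; rewrite -mulr_sumr hw// -ltnS.
  exact: leq_trans (ltn_ord j) kn.
(* Only j = n contributes, and it occurs only for k = n + 1, where the binomial coefficient n + 1
   cancels the divisor. *)
move: kn; rewrite leq_eqVlt => /predU1P[->|kn].
  rewrite big_ord_recr /= big1 ?add0r => [|j _]; last by rewrite ltn_eqF ?mulr0.
  by rewrite eqxx mulr1 eqxx binSn divff// pnatr_eq0.
rewrite big1 ?mul0r => [|j _]; first by rewrite ltn_eqF.
by rewrite ltn_eqF ?mulr0// (leq_trans (ltn_ord j)).
Qed.

(** A polynomial of degree less than [n] that is O(h^n) at 0 vanishes, as seen by [p]: small [h]
    forces the constant coefficient to 0, and division by [h] lowers the degree. *)
Lemma poly_small {E : tvsType R} (p : E -> R) (d K : R) n (X : nat -> E) :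
  seminorm p -> 0 < d -> 0 <= K ->
  (forall h, 0 < h < d -> p (\sum_(k < n) h ^+ k *: X k) <= K * h ^+ n) ->
  forall k, (k < n)%N -> p (X k) = 0.
Proof.
move=> sp d0 K0; elim: n X => // n IH X hX.
have sumE h : \sum_(k < n.+1) h ^+ k *: X k =
    X 0%N + h *: \sum_(k < n) h ^+ k *: X k.+1.
  rewrite big_ord_recl expr0 scale1r scaler_sumr; congr (_ + _).
  by apply: eq_bigr => k _; rewrite scalerA -exprS.
have X0 : p (X 0%N) = 0.
  pose M := \sum_(k < n) p (X k.+1).
  have M0 : 0 <= M by apply: sumr_ge0 => k _; exact: seminorm_ge0.
  apply/eqP; rewrite eq_le seminorm_ge0// andbT; apply/ler_addgt0Pr => e e0.
  rewrite add0r; pose h := Num.min (d / 2) (Num.min 1 (e / (K + M + 1))).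
  have KM : 0 < K + M + 1 by rewrite ltr_wpDl// addr_ge0.
  have h0 : 0 < h by rewrite !lt_min !divr_gt0// ltr01.
  have hd : h < d by rewrite gt_min; apply/orP; left; lra.
  have h1 : h <= 1 by rewrite !ge_min lexx orbT.
  have := hX h; rewrite h0 hd sumE => /(_ isT) hh.
  have hS : p (\sum_(k < n) h ^+ k *: X k.+1) <= M.
    apply: le_trans (seminorm_sum _ _ _ sp) _; apply: ler_sum => k _.
    by rewrite (seminormZ sp) normrX gtr0_norm// ler_piMl ?seminorm_ge0// exprn_ile1// ltW.
  have := seminormB (X 0%N + h *: \sum_(k < n) h ^+ k *: X k.+1)
    (h *: \sum_(k < n) h ^+ k *: X k.+1) sp.
  rewrite addrK (seminormZ sp) gtr0_norm// => /le_trans; apply.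
  apply: (@le_trans _ _ (K * h + h * M)).
    apply: lerD; last by rewrite ler_wpM2l// ltW.
    apply: le_trans hh _; rewrite ler_wpM2l// exprS ler_piMr ?(ltW h0)//.
    by rewrite exprn_ile1// ltW.
  have he : h <= e / (K + M + 1) by rewrite !ge_min lexx !orbT.
  apply: (@le_trans _ _ (h * (K + M + 1))); first lra.
  by rewrite -ler_pdivlMr.
move=> [//|k]; rewrite ltnS; apply: (IH (fun k => X k.+1)) => h /andP[h0 hd].
have := hX h; rewrite h0 hd sumE => /(_ isT) hh.
rewrite -(ler_pM2l h0) -{1}(gtr0_norm h0) -(seminormZ sp).
have -> : h *: (\sum_(k < n) h ^+ k *: X k.+1) =
  (X 0%N + h *: \sum_(k < n) h ^+ k *: X k.+1) - X 0%N by rewrite addrAC subrr add0r.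
apply: le_trans (seminormB _ _ sp) _; rewrite X0 addr0.
by rewrite mulrCA -exprS.
Qed.

End Weights.

Section PlaneLipschitz.
Context {R : realType} {E : tvsType R} (hE : hausdorff_space E).
Variables (U : set (R * R)) (f : R -> R -> E).
Hypotheses (oU : open U) (sf : csmooth2 U f).

Lemma bounded_dirs (x y : R) p n m : U (x, y) -> seminorm p ->
  exists2 d : R, 0 < d & exists2 C : R, 0 <= C & forall (i : nat) (a b : R),
    (i <= m)%N -> `|a| < d -> `|b| < d ->
    p (dn n (fun t => f (x + a + t * i%:R) (y + b + t * 1)) 0) <= C.
Proof.
move=> Uxy sp; elim: m => [|m [d d0 [C C0 hC]]].
  have [d d0 [C hC]] := bounded_dir hE oU sf 0%:R 1 n Uxy sp.
  exists d => //; exists (Num.max 0 C); first by rewrite le_max lexx.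
  move=> i a b; rewrite leqn0 => /eqP -> ad bd.
  by rewrite le_max hC ?orbT.
have [d' d'0 [C' hC']] := bounded_dir hE oU sf m.+1%:R 1 n Uxy sp.
exists (Num.min d d'); first by rewrite lt_min d0.
exists (Num.max C C'); first by rewrite le_max C0.
move=> i a b im; rewrite !lt_min => /andP[ad ad'] /andP[bd bd'].
move: im; rewrite leq_eqVlt ltnS => /predU1P[->|im].
  by rewrite le_max hC' ?orbT.
by rewrite le_max hC.
Qed.

(* Expanding [f (u + i h) (v + h)], [i <= n], both along the first axis from
   [(u, v + h)] and along the direction [(i, 1)] from [(u, v)], and taking an
   [n]-th difference in [i], only the [n]-th derivative survives in the first
   expansion. *)
Lemma dn_near_limit (u0 v0 : R) p n : U (u0, v0) -> seminorm p ->
  exists2 d : R, 0 < d & exists2 C : R, 0 <= C & forall u v : R,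
    `|u - u0| < d -> `|v - v0| < d -> exists X : E,
    forall h, h != 0 -> `|h| < d -> p (dn n (f ^~ (v + h)) u - X) <= C * `|h|.
Proof.
move=> Uuv sp.
have [r0 r0_gt0 hr0] := open_box oU Uuv.
have [r1 r1_gt0 [B1 hB1]] := bounded_dir hE oU sf 1 0 n Uuv sp.
have [r2 r2_gt0 [B2 hB2]] := bounded_dir hE oU sf 1 0 n.+1 Uuv sp.
have [r3 r3_gt0 [B3 B30 hB3]] := bounded_dirs n.+1 n Uuv sp.
pose r := Num.min (Num.min r0 r1) (Num.min r2 r3).
have r_gt0 : 0 < r by rewrite !lt_min r0_gt0 r1_gt0 r2_gt0.
pose B := Num.max (Num.max 0 B1) (Num.max B2 B3).
have B0 : 0 <= B by rewrite !le_max lexx.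
have hr x : `|x| < r -> [/\ `|x| < r0, `|x| < r1, `|x| < r2 & `|x| < r3].
  by rewrite !lt_min -andbA => /and4P[].
have shiftE m a b u v : u = u0 + a -> v = v0 + b ->
    dn m (fun t => f (u0 + a + t * 1) (v0 + b + t * 0)) 0 = dn m (f ^~ v) u.
  move=> -> ->; rewrite (dn_shift0 m _ (u0 + a)); congr (dn m _ _).
  by apply/funext => t; rewrite mulr0 addr0 mulr1 addrC.
have bn u v : `|u - u0| < r -> `|v - v0| < r ->
    [/\ U (u, v), p (dn n (f ^~ v) u) <= B & p (dn n.+1 (f ^~ v) u) <= B].
  move=> /hr[x0 x1 x2 _] /hr[y0 y1 y2 _]; split.
  - by have := hr0 _ _ x0 y0; rewrite !subrKC.
  - have := hB1 _ _ x1 y1; rewrite (shiftE n _ _ u v) ?subrKC// => h.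
    by rewrite !le_max h ?orbT.
  - have := hB2 _ _ x2 y2; rewrite (shiftE n.+1 _ _ u v) ?subrKC// => h.
    by rewrite !le_max h ?orbT.
have bd i u v : (i <= n)%N -> `|u - u0| < r -> `|v - v0| < r ->
    p (dn n.+1 (fun t => f (u + t * i%:R) (v + t * 1)) 0) <= B.
  move=> i_n /hr[_ _ _ x3] /hr[_ _ _ y3].
  have := hB3 i _ _ i_n x3 y3; rewrite !subrKC => h.
  by rewrite !le_max h !orbT.
have [w hw] := @diff_weights R n.
(* A point within [d] of the centre, moved by at most n + 1 steps |h| < d, stays within (n + 2) d <=
   r / 2. The minimum with 1 serves h^(n+1) <= h^n. *)
pose d := Num.min 1 (r / (2 * n.+2%:R)).
have n2 : 0 < 2 * n.+2%:R :> R by rewrite mulr_gt0.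
have d_gt0 : 0 < d by rewrite lt_min ltr01 divr_gt0.
have dr i (x t h : R) : (i <= n.+1)%N -> `|x| < d -> `|h| < d -> `|t| <= i%:R * `|h| ->
    `|x + t| < r.
  move=> i_n xd hd ti; apply: le_lt_trans (ler_normD _ _) _.
  have : n.+2%:R * d <= r / 2.
    have : d <= r / (2 * n.+2%:R) by rewrite ge_min lexx orbT.
    rewrite ler_pdivlMr// mulrA => h1; rewrite ler_pdivlMr// mulrC mulrA; lra.
  have : i%:R * `|h| <= n.+1%:R * d by rewrite ler_pM ?ler_nat// ltW.
  rewrite -[n.+2]addn1 natrD mulrDl mul1r; lra.
pose K := (\sum_(i < n.+1) `|w i|) * (B * (n%:R ^+ n.+1 + 1)).
have K0 : 0 <= K.
  by rewrite mulr_ge0 ?sumr_ge0// mulr_ge0// addr_ge0// exprn_ge0.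
exists d => //; exists (n`!%:R * K); first by rewrite mulr_ge0.
move=> u v ud vd.
pose a i k := dn k (fun t => f (u + t * i%:R) (v + t * 1)) 0.
(* The coefficient of h^k in the weighted sum of the expansions along the directions (i, 1); it does
   not depend on [h]. *)
pose X k := \sum_(i < n.+1) (w i / k`!%:R) *: a i k.
have main h : h != 0 -> `|h| < d ->
    p ((h ^+ n / n`!%:R) *: dn n (f ^~ (v + h)) u - \sum_(k < n.+1) h ^+ k *: X k)
    <= K * `|h| ^+ n.+1.
  move=> h0 hd.
  have vhr : `|v + h - v0| < r.
    by rewrite addrAC; apply: (dr 1%N _ _ h) => //; rewrite mul1r.
  pose S1 i := \sum_(k < n.+1) ((i%:R * h) ^+ k / k`!%:R) *: dn k (f ^~ (v + h)) u.
  pose S2 i := \sum_(k < n.+1) (h ^+ k / k`!%:R) *: a i k.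
  have T1 i : (i <= n)%N -> p (f (u + i%:R * h) (v + h) - S1 i) <= B * `|i%:R * h| ^+ n.+1.
    move=> i_n.
    have := @taylor _ _ hE p n _ (f ^~ (v + h)) u (i%:R * h) B sp
      (@smooth_slice1 _ _ _ _ oU sf (v + h)).
    apply => t ti.
    have utr : `|u + t - u0| < r.
      rewrite addrAC; apply: (dr i _ _ h) => //; first exact: leqW.
      by rewrite -[i%:R]ger0_norm// -normrM.
    by have [? _ ?] := bn _ _ utr vhr.
  have T2 i : (i <= n)%N -> p (f (u + i%:R * h) (v + h) - S2 i) <= B * `|h| ^+ n.+1.
    move=> i_n.
    have := @taylor _ _ hE p n _ _ 0 h B sp (@smooth_on_line _ _ _ _ oU sf u v i%:R 1).
    rewrite add0r mulr1 [h * _]mulrC; apply => t th.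
    have ui : `|u + t * i%:R - u0| < r.
      rewrite addrAC; apply: (dr i _ _ h) => //; first exact: leqW.
      by rewrite normrM mulrC ger0_norm// ler_wpM2l.
    have vi : `|v + t * 1 - v0| < r.
      by rewrite mulr1 addrAC; apply: (dr 1%N _ _ h) => //; rewrite mul1r.
    rewrite add0r; split; first by have [] := bn _ _ ui vi.
    have := bd i _ _ i_n ui vi; apply: le_trans; rewrite le_eqVlt; apply/orP; left; apply/eqP.
    rewrite (dn_shift0 n.+1 _ t); congr (p (dn n.+1 _ 0)); apply/funext => z.
    by congr f; rewrite mulrDl addrAC addrA.
  have S12 i : (i <= n)%N -> p (S1 i - S2 i) <= B * (n%:R ^+ n.+1 + 1) * `|h| ^+ n.+1.
    move=> i_n; have := seminorm_dist (S1 i) (f (u + i%:R * h) (v + h)) (S2 i) sp.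
    rewrite (seminorm_distC (S1 i) (f _ _) sp) => /le_trans; apply.
    rewrite mulrDr mulrDl mulr1; apply: lerD; last exact: T2.
    apply: le_trans (T1 i i_n) _.
    rewrite -mulrA ler_wpM2l// normrM exprMn ler_wpM2r ?exprn_ge0//.
    by rewrite ger0_norm// lerXn2r ?nnegrE// ler_nat.
  have -> : (h ^+ n / n`!%:R) *: dn n (f ^~ (v + h)) u - \sum_(k < n.+1) h ^+ k *: X k =
      \sum_(i < n.+1) w i *: (S1 i - S2 i).
    under [RHS]eq_bigr do rewrite scalerBr; rewrite sumrB; congr (_ - _).
      under eq_bigr do rewrite scaler_sumr; rewrite exchange_big/=.
      rewrite [RHS](eq_bigr (fun k : 'I_n.+1 => (h ^+ k / k`!%:R * (k == n :> nat)%:R) *: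
          dn k (f ^~ (v + h)) u)).
        rewrite big_ord_recr /= eqxx mulr1 big1 ?add0r// => k _.
        by rewrite ltn_eqF// mulr0 scale0r.
      move=> k _; rewrite -hw; last by rewrite -ltnS.
      rewrite mulr_sumr scaler_suml; apply: eq_bigr => i _; rewrite scalerA exprMn.
      by congr (_ *: _); ring.
    under [RHS]eq_bigr do rewrite scaler_sumr; rewrite exchange_big/=.
    apply: eq_bigr => k _; rewrite scaler_sumr; apply: eq_bigr => i _.
    by rewrite !scalerA; congr (_ *: _); ring.
  apply: le_trans (seminorm_sum _ _ _ sp) _; rewrite /K -mulrA mulr_suml.
  apply: ler_sum => i _; rewrite (seminormZ sp) ler_wpM2l// S12//.
  by rewrite -ltnS.
(* The derivative term is O(h^n) by the bound [B], hence so is the part of degree less than [n],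
   which [poly_small] then kills. *)
have X0 k : (k < n)%N -> p (X k) = 0.
  have pX0 := seminorm_ge0 (X n) sp.
  apply: (poly_small (d := d) (K := K + B + p (X n)) sp d_gt0); first by rewrite !addr_ge0.
  move=> h /andP[h0 hd]; have nh : `|h| = h by rewrite gtr0_norm.
  have := main h; rewrite gt_eqF// nh => /(_ isT hd); rewrite big_ord_recr /=.
  set S := \sum_(k < n) _; set Y := _ *: dn n _ _ => hm.
  have pY : p Y <= B * h ^+ n.
    have [_ + _] : [/\ U (u, v + h), p (dn n (f ^~ (v + h)) u) <= B &
        p (dn n.+1 (f ^~ (v + h)) u) <= B].
      apply: bn; first by rewrite -[u - u0]addr0; apply: (dr 0%N _ _ h); rewrite ?nh// normr0 mul0r.
      by rewrite addrAC; apply: (dr 1%N _ _ h) => //; rewrite ?nh// mul1r.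
    move=> pB; rewrite /Y (seminormZ sp) mulrC ger0_norm; last first.
      by rewrite divr_ge0// exprn_ge0// ltW.
    have hn0 : 0 <= h ^+ n by rewrite exprn_ge0// ltW.
    apply: ler_pM => //; [exact: seminorm_ge0|by rewrite divr_ge0|].
    by rewrite ler_pdivrMr ?ltr0n ?fact_gt0// ler_peMr// ler1n fact_gt0.
  have hn1 : h ^+ n.+1 <= h ^+ n.
    rewrite exprS ler_piMl ?exprn_ge0 ?(ltW h0)//.
    by apply: le_trans (ltW hd) _; rewrite ge_min lexx.
  have -> : S = Y - (Y - (S + h ^+ n *: X n)) - h ^+ n *: X n by lmod_eq R.
  apply: le_trans (seminormB _ _ sp) _; rewrite (seminormZ sp) ger0_norm ?exprn_ge0 ?(ltW h0)//.
  have := seminormB Y (Y - (S + h ^+ n *: X n)) sp.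
  have := ler_wpM2l K0 hn1; lra.
(* Division of [main] by h^n / n! turns its error K |h|^(n+1) into n! K |h|. *)
exists (n`!%:R *: X n) => h h0 hd.
have hn0 : 0 < `|h| ^+ n by rewrite exprn_gt0// normr_gt0.
have fn0 : n`!%:R != 0 :> R by rewrite pnatr_eq0 -lt0n fact_gt0.
rewrite -(ler_pM2l hn0) -{1}normrX -(seminormZ sp).
have -> : h ^+ n *: (dn n (f ^~ (v + h)) u - n`!%:R *: X n) =
   n`!%:R *: (((h ^+ n / n`!%:R) *: dn n (f ^~ (v + h)) u - \sum_(k < n.+1) h ^+ k *: X k)
     + \sum_(k < n) h ^+ k *: X k).
  rewrite big_ord_recr /=; set S := \sum_(k < n) _.
  by lmod_eq R.
rewrite (seminormZ sp) ger0_norm//.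
have -> : `|h| ^+ n * (n`!%:R * K * `|h|) = n`!%:R * (K * `|h| ^+ n.+1) by rewrite exprS; ring.
rewrite ler_wpM2l//; apply: le_trans (seminormD sp _ _) _.
have -> : p (\sum_(k < n) h ^+ k *: X k) = 0.
  apply/eqP; rewrite eq_le seminorm_ge0// andbT; apply: le_trans (seminorm_sum _ _ _ sp) _.
  by rewrite big1// => k _; rewrite (seminormZ sp) X0 ?mulr0.
by rewrite addr0; exact: main.
Qed.

(** The point [X] of [dn_near_limit] is not known to be the derivative at step 0. With k = v' - v
    and base point v - k, the steps k and 2 k reach v and v', and their errors C |k| and 2 C |k|
    give the factor 3. The radius d / 4 keeps the base point and both steps in range. *)
Lemma lip_dn (u0 v0 : R) p n : U (u0, v0) -> seminorm p ->
  exists2 d : R, 0 < d & exists2 C : R, 0 <= C & forall u v v' : R,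
    `|u - u0| < d -> `|v - v0| < d -> `|v' - v0| < d ->
    p (dn n (f ^~ v) u - dn n (f ^~ v') u) <= C * `|v - v'|.
Proof.
move=> Uuv sp; have [d d0 [C C0 hC]] := dn_near_limit n Uuv sp.
exists (d / 4); first by rewrite divr_gt0.
exists (3 * C); first by rewrite mulr_ge0.
move=> u v v' ud vd v'd.
have [->|vv'] := eqVneq v v'.
  by rewrite !subrr (seminorm0 sp) normr0 mulr0.
pose k := v' - v; have k0 : k != 0 by rewrite subr_eq0 eq_sym.
have kd : `|k| < d / 2.
  have := ler_normB (v' - v0) (v - v0); rewrite opprB addrA subrK -/k; lra.
have kd1 : `|k| < d by lra.
have kd2 : 2 * `|k| < d by lra.
have [||X hX] := hC u (v - k).
- by apply: lt_trans ud _; rewrite ltr_pdivrMr// ltr_pMr// ltr1n.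
- have := ler_normB (v - v0) k; rewrite addrAC; lra.
have h1 := hX k k0; rewrite subrK in h1.
have h2 := hX (2 * k); rewrite mulf_neq0// in h2.
have E2 : v - k + 2 * k = v' by rewrite /k; ring.
rewrite E2 normrM gtr0_norm// in h2.
have {}h1 := h1 kd1; have {}h2 := h2 isT kd2.
have := seminorm_dist (dn n (f ^~ v) u) X (dn n (f ^~ v') u) sp.
rewrite (seminorm_distC X _ sp) [`|v - v'|]distrC -/k; lra.
Qed.

End PlaneLipschitz.

(** * Partial derivatives of maps of the plane *)

Section PartialDerivatives.
Context {R : realType} {E : tvsType R} (cE : complete_tvs E).

Let hE := cE.1.

Definition harm (j : nat) : R := j.+1%:R^-1.

Lemma harm_gt0 j : 0 < harm j. Proof. by rewrite invr_gt0. Qed.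

Lemma harm_lt (e : R) : 0 < e -> exists N, forall j, (N <= j)%N -> harm j < e.
Proof.
move=> e0; exists (Num.truncn e^-1) => j Nj.
rewrite /harm invf_plt ?posrE//.
by apply: lt_le_trans (truncnS_gt e^-1) _; rewrite ler_nat.
Qed.

(** [lip_dn] bounds every derivative of the difference quotients uniformly in the step, as
    [limit_smooth] requires. The axis v = 0 is enough: a shear brings any curve there. *)
Lemma limit_d2 (U : set (R * R)) (f : R -> R -> E) (D : set R) :
  open U -> csmooth2 U f -> open D -> (forall u, D u -> U (u, 0)) ->
  smooth_on D (fun u => curve_derive (f u) 0) /\
  forall n u, D u -> j.+1%:R *: (dn n (f ^~ (harm j)) u - dn n (f ^~ 0) u) @[j --> \oo]
    --> dn n (fun u => curve_derive (f u) 0) u.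
Proof.
move=> oU sf oD DU; pose q j u := j.+1%:R *: (f u (harm j) - f u 0).
have sq0 t0 : D t0 -> exists2 d : R, 0 < d & exists N, forall j (t : R), (N <= j)%N ->
    `|t - t0| < d -> U (t, harm j) /\ U (t, 0).
  move=> /DU /(open_box oU)[d d0 hd]; exists d => //.
  have [N hN] := harm_lt d0; exists N => j t Nj td.
  have := hd (t - t0) (harm j) td; rewrite subrKC add0r gtr0_norm ?harm_gt0//.
  have := hd (t - t0) 0 td; rewrite subrKC addr0 normr0 => /(_ d0) U1 U2; split => //.
  by apply: U2; exact: hN.
have dq n j t d t0 : 0 < d -> `|t - t0| < d ->
    (forall u, `|u - t0| < d -> U (u, harm j) /\ U (u, 0)) ->
    smooth_on [set t | `|t - t0| < d] (q j) /\
    dn n (q j) t = j.+1%:R *: (dn n (f ^~ (harm j)) t - dn n (f ^~ 0) t).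
  move=> d0 td h; have oB := @open_ball_real R t0 d.
  have s1 : smooth_on [set t | `|t - t0| < d] (f ^~ (harm j)).
    by apply: (smooth_on_sub _ (@smooth_slice1 _ _ _ _ oU sf (harm j))) => u /h[].
  have s2 : smooth_on [set t | `|t - t0| < d] (f ^~ 0).
    by apply: (smooth_on_sub _ (@smooth_slice1 _ _ _ _ oU sf 0)) => u /h[].
  split; first by apply: (smooth_onZ hE _ oB); exact: smooth_onB.
  rewrite (dnZ hE n _ oB) //; last exact: smooth_onB.
  by rewrite (dnB hE n oB).
have [sg hg] : smooth_on D (fun u => curve_derive (f u) 0) /\
    forall n t, D t -> dn n (q j) t @[j --> \oo] --> dn n (fun u => curve_derive (f u) 0) t.
  apply: limit_smooth => //.
  - move=> t0 /sq0[d d0 [N hN]]; exists d => //; exists N => j Nj.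
    by have [] := @dq 0%N j t0 d t0 d0; rewrite ?subrr ?normr0// => u; exact: hN.
  - move=> t0 Dt0 p sp n; have [d d0 [N hN]] := sq0 t0 Dt0.
    have [e e0 [C C0 hC]] := lip_dn hE oU sf n (DU _ Dt0) sp.
    have [M hM] := harm_lt e0.
    exists (Num.min d e); first by rewrite lt_min d0.
    exists (maxn N M), C => j t; rewrite geq_max => /andP[Nj Mj].
    rewrite lt_min => /andP[td te].
    have [|_ ->] := @dq n j t d t0 d0 td; first by move=> u; exact: hN.
    rewrite (seminormZ sp) ger0_norm//.
    have := hC t (harm j) 0 te; rewrite !subr0 normr0 gtr0_norm ?harm_gt0//.
    move=> /(_ (hM _ Mj) e0) h.
    apply: le_trans (ler_wpM2l (ler0n R _) h) _.
    by rewrite mulrCA /harm mulfV ?mulr1// pnatr_eq0.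
  - move=> t Dt; apply/cvg_seminorm => p sp e e0.
    have e2 : 0 < e / 2 by rewrite divr_gt0.
    have cd := has_cd_dn hE 0 (@smooth_slice2 _ _ _ _ oU sf t) (DU _ Dt).
    have /nbhs_ballP[d /= d0 hd] := cd p sp _ e2.
    have [N hN] := harm_lt d0; exists N => // j Nj.
    have := hd (harm j); rewrite /ball/= sub0r normrN gtr0_norm ?harm_gt0//.
    move=> /(_ (hN _ Nj)); rewrite add0r => h.
    have -> : q j t - curve_derive (f t) 0 =
        j.+1%:R *: (f t (harm j) - f t 0 - harm j *: curve_derive (f t) 0).
      by rewrite /q [RHS]scalerBr scalerA /harm mulfV ?scale1r// pnatr_eq0.
    rewrite (seminormZ sp) ger0_norm//.
    apply: le_lt_trans (ler_wpM2l (ler0n R _) h) _.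
    rewrite mulrCA /harm mulfV ?mulr1 ?pnatr_eq0//; lra.
split => // n u Du; have [d d0 [N hN]] := sq0 u Du.
apply: cvg_trans (hg n u Du); apply: near_eq_cvg; exists N => // j Nj.
have uu : `|u - u| < d by rewrite subrr normr0.
by have [_ ->] := dq n j u d u d0 uu (fun t => hN j t Nj).
Qed.

Lemma open_shear (U : set (R * R)) (D : set R) (a b : R -> R) :
  open U -> open D -> smooth_on D a -> smooth_on D b ->
  open [set x : R * R | D x.1 /\ U (a x.1, x.2 + b x.1)].
Proof.
move=> oU oD sa sb; rewrite openE => -[r h] [/= Dr Ur].
have nU : nbhs (a r, h + b r) U by exact: open_nbhs_nbhs.
have c1 : x.1 @[x --> (r, h)] --> r by exact: cvg_fst.
have c2 : x.2 @[x --> (r, h)] --> h by exact: cvg_snd.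
have ca : a x.1 @[x --> (r, h)] --> a r by apply: cvg_comp c1 (smooth_on_cvg sa Dr).
have cb : b x.1 @[x --> (r, h)] --> b r by apply: cvg_comp c1 (smooth_on_cvg sb Dr).
have := cvg_pair ca (cvgD c2 cb) nU => hU.
apply: filterI; last exact: hU.
exact: (c1 _ (open_nbhs_nbhs (conj oD Dr))).
Qed.

(** The shear sends the axis h = 0 to the curve (a, b), so [limit_d2] yields the partial derivative
    along any curve. *)
Lemma csmooth2_shear (U : set (R * R)) (f : R -> R -> E) (D : set R) (a b : R -> R) :
  csmooth2 U f -> smooth_on D a -> smooth_on D b ->
  csmooth2 [set x : R * R | D x.1 /\ U (a x.1, x.2 + b x.1)]
    (fun r h => f (a r) (h + b r)).
Proof.
move=> sf sa sb D' al be oD' sal sbe hU; have hR := @hausdorff_real R.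
have aD t : D' t -> D (al t) by move=> /hU[].
apply: (sf _ (fun t => a (al t)) (fun t => be t + b (al t))) => //.
- exact: (smooth_on_comp hR oD' aD).
- by apply: (smooth_onD hR) => //; exact: (smooth_on_comp hR oD' aD).
- by move=> t /hU[].
Qed.

Lemma csmooth2_d2 (U : set (R * R)) (f : R -> R -> E) : open U -> csmooth2 U f ->
  csmooth2 U (fun u v => curve_derive (f u) v).
Proof.
move=> oU sf D a b oD sa sb DU.
have h u : D u -> [set x : R * R | D x.1 /\ U (a x.1, x.2 + b x.1)] (u, 0).
  by move=> Du; split => //=; rewrite add0r; exact: DU.
have [+ _] := limit_d2 (open_shear oU oD sa sb) (csmooth2_shear sf sa sb) oD h.
apply: smooth_on_ext => // r _.
by rewrite -curve_derive_shift0.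
Qed.

Lemma open_swap (U : set (R * R)) : open U -> open [set x : R * R | U (x.2, x.1)].
Proof.
move=> oU; rewrite openE => -[r h] /= Urh.
have c1 : x.1 @[x --> (r, h)] --> r by exact: cvg_fst.
have c2 : x.2 @[x --> (r, h)] --> h by exact: cvg_snd.
exact: (cvg_pair c2 c1 (open_nbhs_nbhs (conj oU Urh))).
Qed.

Lemma csmooth2_d1 (U : set (R * R)) (f : R -> R -> E) : open U -> csmooth2 U f ->
  csmooth2 U (fun u v => curve_derive (f ^~ v) u).
Proof.
move=> oU sf D a b oD sa sb DU.
have sf' : csmooth2 [set x : R * R | U (x.2, x.1)] (fun v u => f u v).
  by move=> D' a' b' oD' sa' sb' DU'; exact: sf.
exact: (csmooth2_d2 (open_swap oU) sf').
Qed.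

(** The difference quotients in v of the first partial derivative, with steps [harm j], tend to the
    left side by [limit_d2] of order 1 and to the right side by definition. *)
Lemma d1_d2 (U : set (R * R)) (f : R -> R -> E) (u v : R) : open U -> csmooth2 U f ->
  U (u, v) ->
  curve_derive (fun u => curve_derive (f u) v) u =
  curve_derive (fun v => curve_derive (f ^~ v) u) v.
Proof.
move=> oU sf Uuv; have hR := @hausdorff_real R.
pose D := [set u | U (u, v)].
have oD : open D by exact: (open_slice1 oU).
have sid : smooth_on D (fun u => u : R) by exact: smooth_on_id.
have scst : smooth_on D (fun=> v) by exact: (smooth_on_cst hR).
have [_ h] := limit_d2 (open_shear oU oD sid scst) (csmooth2_shear sf sid scst) oD
  (fun u Du => conj Du (eq_ind_r (fun w => U (u, w)) Du (add0r v))).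
have gE : (fun u => curve_derive (fun h => f u (h + v)) 0) =
    fun u => curve_derive (f u) v.
  by apply/funext => r; rewrite -curve_derive_shift0.
have {h} := h 1%N u Uuv; rewrite {}gE.
set l := curve_derive (fun u => curve_derive (f u) v) u => hl.
have sd1 := csmooth2_d1 oU sf.
have cd := has_cd_dn hE 0 (@smooth_slice2 _ _ _ _ oU sd1 u) Uuv.
set m := curve_derive _ v; rewrite -/m in cd.
apply/eqP; rewrite -subr_eq0; apply/eqP; apply: hausdorff_seminorm => // p sp.
apply/eqP; rewrite eq_le seminorm_ge0// andbT; apply/ler_addgt0Pr => e e0; rewrite add0r.
have e2 : 0 < e / 2 by rewrite divr_gt0.
have /cvg_seminorm/(_ p sp _ e2)[N _ hN] := hl.
have /nbhs_ballP[d /= d0 hd] := cd p sp _ e2.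
have [M hM] := harm_lt d0.
pose j := maxn N M.
have h1 := hN j (leq_maxl _ _).
have := hd (harm j); rewrite /ball/= sub0r normrN gtr0_norm ?harm_gt0//.
move=> /(_ (hM _ (leq_maxr _ _))) h2.
rewrite /= add0r in h1.
set X := curve_derive (f ^~ (v + harm j)) u in h2; set Y := curve_derive (f ^~ v) u in h1 h2.
have XE : curve_derive (fun x => f x (harm j + v)) u = X by rewrite addrC.
rewrite XE in h1.
have h3 : p (j.+1%:R *: (X - Y - harm j *: m)) <= e / 2.
  rewrite (seminormZ sp) ger0_norm//; apply: le_trans (ler_wpM2l (ler0n R _) h2) _.
  by rewrite mulrCA /harm mulfV ?mulr1 ?pnatr_eq0.
have -> : l - m = j.+1%:R *: (X - Y - harm j *: m) - (j.+1%:R *: (X - Y) - l).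
  rewrite [X in _ = X - _]scalerBr scalerA /harm mulfV ?pnatr_eq0// scale1r.
  by lmod_eq R.
apply: le_trans (seminormB _ _ sp) _; lra.
Qed.

(** The increment is split at (0, h). At height h, Taylor's formula along the first axis costs
    O(h^2); moving its linear term from height h to height 0 costs O(h^2) by [lip_dn]. *)
Lemma has_cd_diag (U : set (R * R)) (f : R -> R -> E) : open U -> csmooth2 U f ->
  U (0, 0) -> has_cd (fun t => f t t) 0 (curve_derive (f ^~ 0) 0 + curve_derive (f 0) 0).
Proof.
move=> oU sf U0 p sp e e0.
have [d1 d1_gt0 hd1] := open_box oU U0.
have [d2 d2_gt0 [C hC]] := bounded_dir hE oU sf 1 0 2 U0 sp.
have [d3 d3_gt0 [C' C'0 hC']] := lip_dn hE oU sf 1 U0 sp.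
have cd := has_cd_dn hE 0 (@smooth_slice2 _ _ _ _ oU sf 0) U0.
have e3 : 0 < e / 3 by rewrite divr_gt0.
pose B := Num.max 0 C.
have B0 : 0 <= B by rewrite le_max lexx.
have B1 : 0 < B + 1 by rewrite ltr_wpDl.
have C1 : 0 < C' + 1 by rewrite ltr_wpDl.
near=> h; rewrite !add0r.
have n1 : `|h| < d1 by near: h; exact: (@nbhs0_lt _ R).
have n2 : `|h| < d2 by near: h; exact: (@nbhs0_lt _ R).
have n3 : `|h| < d3 by near: h; exact: (@nbhs0_lt _ R).
have n4 : `|h| <= e / 3 / (B + 1) by near: h; apply: (@nbhs0_le _ R); rewrite divr_gt0.
have n5 : `|h| <= e / 3 / (C' + 1) by near: h; apply: (@nbhs0_le _ R); rewrite divr_gt0.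
have h3 : p (f 0 h - f 0 0 - h *: curve_derive (f 0) 0) <= e / 3 * `|h|.
  by rewrite -{1}[h]add0r; near: h; exact: cd.
have h1 : p (f h h - f 0 h - h *: curve_derive (f ^~ h) 0) <= B * `|h| ^+ 2.
  have := @taylor _ _ hE p 1 _ (f ^~ h) 0 h B sp (@smooth_slice1 _ _ _ _ oU sf h).
  rewrite big_ord_recr big_ord1 /= expr0 expr1 !divr1 scale1r opprD addrA add0r; apply.
  move=> t th; rewrite !add0r.
  have td1 : `|t| < d1 by exact: le_lt_trans n1.
  have td2 : `|t| < d2 by exact: le_lt_trans n2.
  split; first by have := hd1 t h td1 n1; rewrite !add0r.
  rewrite le_max; apply/orP; right.
  have dE : dn 2 (f ^~ h) t = dn 2 (fun s => f (0 + t + s * 1) (0 + h + s * 0)) 0.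
    rewrite (dn_shift0 2 (f ^~ h) t); congr (dn 2 _ 0).
    by apply/funext => z; rewrite !add0r mulr0 addr0 mulr1 addrC.
  by have := hC t h td2 n2; rewrite -dE.
have h2 : p (curve_derive (f ^~ h) 0 - curve_derive (f ^~ 0) 0) <= C' * `|h|.
  by have := hC' 0 h 0; rewrite !subr0 normr0; apply.
have -> : f h h - f 0 0 - h *: (curve_derive (f ^~ 0) 0 + curve_derive (f 0) 0) =
  (f h h - f 0 h - h *: curve_derive (f ^~ h) 0)
  + h *: (curve_derive (f ^~ h) 0 - curve_derive (f ^~ 0) 0)
  + (f 0 h - f 0 0 - h *: curve_derive (f 0) 0) by lmod_eq R.
have h4 : B * `|h| ^+ 2 <= e / 3 * `|h|.
  rewrite expr2 mulrA ler_wpM2r//.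
  apply: (@le_trans _ _ ((B + 1) * `|h|)); first by rewrite ler_wpM2r// lerDl.
  by rewrite mulrC -ler_pdivlMr.
have h5 : p (h *: (curve_derive (f ^~ h) 0 - curve_derive (f ^~ 0) 0)) <= e / 3 * `|h|.
  rewrite (seminormZ sp) mulrC ler_wpM2r//; apply: le_trans h2 _.
  apply: (@le_trans _ _ ((C' + 1) * `|h|)); first by rewrite ler_wpM2r// lerDl.
  by rewrite mulrC -ler_pdivlMr.
apply: le_trans (seminormD sp _ _) _.
have := seminormD sp (f h h - f 0 h - h *: curve_derive (f ^~ h) 0)
  (h *: (curve_derive (f ^~ h) 0 - curve_derive (f ^~ 0) 0)).
have -> : e * `|h| = e / 3 * `|h| + e / 3 * `|h| + e / 3 * `|h| by field.
move=> h6; apply: lerD => //; apply: le_trans h6 _; apply: lerD => //.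
exact: le_trans h1 h4.
Unshelve. all: by end_near. Qed.

End PartialDerivatives.

(** * Hadamard's lemma and the chain rule *)

Section Hadamard.
Context {R : realType} {E : tvsType R} (cE : complete_tvs E).

Let hE := cE.1.

Lemma smooth_on_segment_bounded D (c : R -> E) (r : R) p n : smooth_on D c ->
  (forall t, `|t| <= r -> D t) -> 0 <= r -> seminorm p ->
  exists2 M, 0 <= M & forall t, `|t| <= r -> p (dn n c t) <= M.
Proof.
move=> sc hD r0 sp.
have cont : {within `[- r, r], continuous (fun x => p (dn n c x))}.
  apply: continuous_in_subspaceT => x; rewrite inE/= in_itv/= -ler_norml => xr.
  apply: (@continuous_comp _ _ _ (dn n c) p); last exact: seminorm_continuous.
  exact: (smooth_on_cvg (smooth_on_dn n sc) (hD _ xr)).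
have [x0 _ hx0] := EVT_max (ge0_cp r0).2 cont.
exists (p (dn n c x0)); first exact: seminorm_ge0.
by move=> t tr; apply: hx0; rewrite in_itv/= -ler_norml.
Qed.

(* The Riemann sums of [s |-> c' (s t)] over [0, 1] converge, with all their
   derivatives in [t] locally bounded, to the slope of [c]. *)
Lemma hadamard (d : R) (c : R -> E) : 0 < d -> smooth_on [set t | `|t| < d] c ->
  exists s : R -> E, [/\ smooth_on [set t | `|t| < d] s, s 0 = curve_derive c 0 &
    forall t, c t = c 0 + t *: s t].
Proof.
move=> d0 sc; set D := [set t | _].
have oD : open D by exact: open_ball0_real.
pose x (j i : nat) : R := i%:R * harm j.
have x0 j i : 0 <= x j i by rewrite mulr_ge0// ltW// harm_gt0.
have x1 j i : (i <= j.+1)%N -> x j i <= 1.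
  by move=> ij; rewrite /x /harm ler_pdivrMr// mul1r ler_nat.
have xD j i t r : (i <= j.+1)%N -> `|t| <= r -> `|x j i * t + 0| <= r.
  move=> ij tr; rewrite addr0 normrM ger0_norm//; apply: le_trans tr.
  by rewrite ler_piMl// x1.
have sc' := smooth_on_derive sc.
(* Beyond [j] the term is set to 0, since [dn_sum] wants all terms smooth while [x j i * t] need not
   stay in [D] for large [i]. The added 0 fits the shape of [dn_affine]. *)
pose psi j i t := if (i <= j)%N then curve_derive c (x j i * t + 0) else 0.
have spsi j i : smooth_on D (psi j i).
  rewrite /psi; case ij : (i <= j)%N; last exact: smooth_on_cst.
  apply: (smooth_on_comp hE oD _ _ sc').
    by move=> t td; apply: le_lt_trans td; apply: xD => //; exact: leqW.
  have hR := @hausdorff_real R.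
  apply: (smooth_onD hR) => //; last exact: (smooth_on_cst hR).
  by apply: (smooth_onZ hR) => //; exact: smooth_on_id.
pose q j t := harm j *: \sum_(i < j.+1) psi j i t.
pose s t := if t == 0 then curve_derive c 0 else t^-1 *: (c t - c 0).
have sq j : smooth_on D (q j).
  apply: (smooth_onZ hE _ oD) => n t Dt.
  by have [+ _] := @dn_sum _ _ hE 0 D (psi j) j.+1 t oD (spsi j) Dt; exact.
have seg t : D t -> exists2 r : R, 0 <= r & r < d /\ \forall u \near t, `|u| <= r.
  move=> td; exists ((`|t| + d) / 2); first by rewrite divr_ge0// addr_ge0// ltW.
  split; first by have := td : `|t| < d; lra.
  have e0 : 0 < (d - `|t|) / 2 by rewrite divr_gt0// subr_gt0.
  apply: filterS (near_ball_real t e0) => u ut.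
  have := ler_normD (u - t) t; rewrite subrK; lra.
have [ss _] : smooth_on D s /\ forall n t, D t -> dn n (q j) t @[j --> \oo] --> dn n s t.
  apply: (limit_smooth cE oD).
  - move=> t Dt; have [e e0 he] := ball_real_sub oD Dt.
    by exists e => //; exists 0%N => j _; apply: (smooth_on_sub _ (sq j)) => u /he.
  - move=> t Dt p sp n; have [r r0 [rd /nbhs_ballP[e /= e0 he]]] := seg t Dt.
    have [M M0 hM] := smooth_on_segment_bounded n.+1 sc
      (fun u (ur : `|u| <= r) => le_lt_trans ur rd) r0 sp.
    exists e => //; exists 0%N, M => j u _ ut.
    have ur : `|u| <= r by apply: he; rewrite /ball/= distrC.
    have Du : D u by exact: le_lt_trans rd.
    have [h1 h2] := @dn_sum _ _ hE n D (psi j) j.+1 u oD (spsi j) Du.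
    rewrite (dnZ hE n _ oD h1 Du) h2 (seminormZ sp) gtr0_norm ?harm_gt0//.
    rewrite /harm mulrC ler_pdivrMr//; apply: le_trans (seminorm_sum _ _ _ sp) _.
    have -> : M * j.+1%:R = \sum_(i < j.+1) M by rewrite sumr_const card_ord mulr_natr.
    apply: ler_sum => i _; rewrite /psi -ltnS ltn_ord.
    have xu : D (x j i * u + 0).
      by apply: le_lt_trans rd; apply: xD => //; exact: ltnW.
    rewrite (dn_affine hE n oD sc' xu) (seminormZ sp) -iterSr.
    rewrite ger0_norm ?exprn_ge0//; apply: (@le_trans _ _ (1 * M)); last by rewrite mul1r.
    apply: ler_pM; [by rewrite exprn_ge0|exact: seminorm_ge0| |].
      by rewrite exprn_ile1// x1// ltnW.
    by apply: hM; apply: xD => //; exact: ltnW.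
  - move=> t Dt; have [t0|t0] := eqVneq t 0.
      rewrite /s t0 eqxx; apply: cvg_near_cst; near=> j.
      rewrite /q (eq_bigr (fun=> curve_derive c 0)) => [|i _].
        by rewrite sumr_const card_ord -scaler_nat scalerA /harm mulVf ?scale1r// pnatr_eq0.
      by rewrite /psi -ltnS ltn_ord mulr0 addr0.
    rewrite /s (negPf t0); apply/cvg_seminorm => p sp e e0.
    have [r r0 [rd near_r]] := seg t Dt; have tr : `|t| <= r := nbhs_singleton near_r.
    have [M M0 hM] := smooth_on_segment_bounded 2 sc
      (fun u (ur : `|u| <= r) => le_lt_trans ur rd) r0 sp.
    have key j : p (c t - c 0 - t *: q j t) <= M * `|t| ^+ 2 * harm j.
      (* On each piece of the subdivision the first order expansion leaves M |harm j * t|^2, and the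
         j + 1 pieces add up to M |t|^2 harm j. *)
      have tele : c t - c 0 = \sum_(i < j.+1) (c (x j i.+1 * t) - c (x j i * t)).
        rewrite -(big_mkord xpredT (fun i => c (x j i.+1 * t) - c (x j i * t))).
        rewrite telescope_sumr// /x mul0r mul0r /harm mulfV ?mul1r// pnatr_eq0.
      rewrite tele /q scalerA scaler_sumr -sumrB.
      apply: le_trans (seminorm_sum _ _ _ sp) _.
      have -> : M * `|t| ^+ 2 * harm j = \sum_(i < j.+1) M * `|harm j * t| ^+ 2.
        rewrite sumr_const card_ord -mulr_natr normrM gtr0_norm ?harm_gt0//.
        by rewrite exprMn /harm; field; rewrite addrC natr1 pnatr_eq0.
      apply: ler_sum => i _; rewrite /psi -ltnS ltn_ord addr0.
      have xS : x j i.+1 * t = x j i * t + harm j * t.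
        by rewrite /x -natr1; ring.
      have := @taylor _ _ hE p 1 _ c (x j i * t) (harm j * t) M sp sc.
      rewrite xS big_ord_recr big_ord1 /= expr0 expr1 !divr1 scale1r opprD addrA.
      rewrite [harm j * t]mulrC; apply => u ut.
      suff h : `|x j i * t + u| <= r by split; [exact: le_lt_trans rd|exact: hM].
      apply: le_trans tr; apply: le_trans (ler_normD _ _) _.
      apply: (@le_trans _ _ (x j i * `|t| + harm j * `|t|)).
        apply: lerD; first by rewrite normrM ger0_norm.
        by apply: le_trans ut _; rewrite normrM mulrC gtr0_norm ?harm_gt0.
      rewrite -mulrDl ler_piMl//.
      have := x1 j i.+1 (ltn_ord i); rewrite /x -natr1 mulrDl mul1r; exact.
    have t1 : 0 < `|t| by rewrite normr_gt0.
    have eM : 0 < e / (M * `|t| + 1) by rewrite divr_gt0// ltr_wpDl// mulr_ge0.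
    have [N hN] := harm_lt eM; exists N => // j /= Nj.
    have := hN j Nj; rewrite ltr_pdivlMr ?ltr_wpDl// ?mulr_ge0// => hj.
    rewrite -(ltr_pM2l t1) -(seminormZ sp).
    have -> : t *: (q j t - t^-1 *: (c t - c 0)) = - (c t - c 0 - t *: q j t).
      by move: (q j t) (c t) (c 0) => Q C C0; lmod_eq R.
    rewrite (seminormN _ sp); apply: le_lt_trans (key j) _.
    have -> : M * `|t| ^+ 2 * harm j = `|t| * (harm j * (M * `|t|)) by ring.
    rewrite ltr_pM2l//; apply: le_lt_trans hj.
    by rewrite ler_wpM2l ?lerDl// ltW// harm_gt0.
exists s; split => //; first by rewrite /s eqxx.
move=> t; rewrite /s; have [->|t0] := eqVneq t 0; first by rewrite scale0r addr0.
by rewrite scalerA mulfV// scale1r subrKC.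
Unshelve. all: by end_near. Qed.

End Hadamard.

Section ChainRule.
Context {R : realType}.

Lemma tvs_deriveE {E F : tvsType R} (f : E -> F) x v :
  tvs_derive f x v = curve_derive (fun t => f (t *: v + x)) 0.
Proof.
rewrite /curve_derive /tvs_derive.
have -> : (fun h => h^-1 *: (f ((h *: (1 : R) + 0) *: v + x) - f (0 *: v + x))) =
    fun h => h^-1 *: (f (h *: v + x) - f x).
  apply/funext => h; have -> : h *: (1 : R) = h := mulr1 h.
  by rewrite addr0 scale0r add0r.
by [].
Qed.

(* With [c t = x + t s(t)], the function [F (x + t s(u))] is smooth in [(t, u)]
   and constant on [t = 0]. *)
Lemma has_cd_chain {E F : tvsType R} (N : set E) (f : E -> F) (d : R) (s : R -> E) (x : E) :
  hausdorff_space E -> complete_tvs F -> open N -> conv_smooth N f -> N x -> 0 < d ->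
  smooth_on [set t | `|t| < d] s ->
  has_cd (fun t => f (t *: s t + x)) 0 (curve_derive (fun t => f (t *: s 0 + x)) 0).
Proof.
move=> hE cF oN sf Nx d0 ss.
have oD := @open_ball0_real R d.
pose U := [set z : R * R | `|z.2| < d /\ N (z.1 *: s z.2 + x)].
have oU : open U.
  rewrite openE => -[t u] [/= ud Nu].
  have c1 : z.1 @[z --> (t, u)] --> t by exact: cvg_fst.
  have c2 : z.2 @[z --> (t, u)] --> u by exact: cvg_snd.
  have c3 : s z.2 @[z --> (t, u)] --> s u by apply: cvg_comp c2 (smooth_on_cvg ss ud).
  have c4 : z.1 *: s z.2 @[z --> (t, u)] --> t *: s u.
    apply: (@cvg_comp _ _ _ (fun z : R * R => (z.1, s z.2)) (fun y : R * E => y.1 *: y.2)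
      _ _ _ (cvg_pair c1 c3)).
    exact: (@scale_continuous R E (t, s u)).
  have c5 : (z.1 *: s z.2, x) @[z --> (t, u)] --> (t *: s u, x).
    by apply: cvg_pair => //; exact: cvg_cst.
  have c6 : z.1 *: s z.2 + x @[z --> (t, u)] --> t *: s u + x.
    apply: (@cvg_comp _ _ _ (fun z : R * R => (z.1 *: s z.2, x))
      (fun y : E * E => y.1 + y.2) _ _ _ c5).
    exact: (@add_continuous E (t *: s u, x)).
  apply: filterI; first exact: (c2 _ (open_nbhs_nbhs (conj oD ud))).
  exact: (c6 _ (open_nbhs_nbhs (conj oN Nu))).
have sphi : csmooth2 U (fun t u => f (t *: s u + x)).
  move=> D a b oD' sa sb hU.
  apply: (conv_smooth_comp hE cF.1 oD' sf); last by move=> t /hU[].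
  apply: (smooth_onD hE) => //; last exact: (smooth_on_cst hE).
  apply: (smooth_on_scale hE) => //; apply: (smooth_on_comp hE oD' _ sb ss).
  by move=> t /hU[].
have U0 : U (0, 0) by split; rewrite /= ?normr0// scale0r add0r.
have := has_cd_diag cF oU sphi U0.
have -> : curve_derive (fun u => f (0 *: s u + x)) 0 = 0.
  have -> : (fun u => f (0 *: s u + x)) = fun=> f x.
    by apply/funext => u; rewrite scale0r add0r.
  by apply: (curve_deriveE cF.1); exact: has_cd_cst.
by rewrite addr0.
Qed.

(** After translation to time 0, Hadamard's lemma writes the curve in the form [has_cd_chain]
    requires, with [s 0] its velocity. *)
Lemma has_cd_comp_conv {E F : tvsType R} (N : set E) (f : E -> F) (c : R -> E) D (t : R) :
  complete_tvs E -> complete_tvs F -> open N -> open D ->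
  conv_smooth N f -> smooth_on D c -> (forall u, D u -> N (c u)) -> D t ->
  has_cd (fun u => f (c u)) t (tvs_derive f (c t) (curve_derive c t)).
Proof.
move=> cE cF oN oD sf sc cN Dt; have hE := cE.1; have hF := cF.1.
have [d d0 hd] := ball_real_sub oD Dt.
have hR := @hausdorff_real R.
have oB := @open_ball0_real R d.
have sshift : smooth_on [set u : R | `|u| < d] (fun u => u + t).
  apply: (smooth_onD hR) => //; first exact: smooth_on_id.
  exact: (smooth_on_cst hR).
have sc' : smooth_on [set u : R | `|u| < d] (fun u => c (u + t)).
  by apply: (smooth_on_comp hE oB _ sshift sc) => u ud; apply: hd; rewrite addrK.
have [s [ss s0 cs]] := hadamard cE d0 sc'.
have := has_cd_chain hE cF oN sf (cN t Dt) d0 ss.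
rewrite -tvs_deriveE s0 -curve_derive_shift0.
have -> : (fun u => f (u *: s u + c t)) = fun u => f (c (u + t)).
  by apply/funext => u; rewrite cs add0r addrC.
move=> h p sp e e0; apply: filterS (h p sp e e0) => u.
by rewrite !add0r (addrC u t).
Qed.

End ChainRule.

(** * Chain rule for fields of symmetric bilinear maps *)

Section ChainRuleBilinear.
Context {R : realType} {E F : tvsType R} (cE : complete_tvs E) (cF : complete_tvs F).
Variables (N : set E) (G : E -> E -> E -> F).
Hypotheses (oN : open N) (sG : smooth_L2sym N G).

Let hE := cE.1.
Let hF := cF.1.

Lemma L2symC g h k : N g -> G g h k = G g k h.
Proof. by move=> /sG.1[+ _ _]; exact. Qed.

Lemma L2symDr g h k k' : N g -> G g h (k + k') = G g h k + G g h k'.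
Proof.
move=> /sG.1[_ lG _]; have := lG h 1 k k'.
by rewrite !scale1r.
Qed.

Lemma L2symZr g h a k : N g -> G g h (a *: k) = a *: G g h k.
Proof.
move=> Ng; have [_ lG _] := sG.1 g Ng; have := lG h a k 0; rewrite addr0 => ->.
have G0 : G g h 0 = 0.
  by have := lG h (-1) 0 0; rewrite scaler0 addr0 scaleN1r addNr.
by rewrite G0 addr0.
Qed.

Lemma L2symDl g h h' k : N g -> G g (h + h') k = G g h k + G g h' k.
Proof. by move=> Ng; rewrite !(L2symC _ k Ng) L2symDr. Qed.

Lemma L2symZl g a h k : N g -> G g (a *: h) k = a *: G g h k.
Proof. by move=> Ng; rewrite !(L2symC _ k Ng) L2symZr. Qed.

Lemma smooth_on_L2sym D (c a b : R -> E) : open D -> smooth_on D c -> smooth_on D a ->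
  smooth_on D b -> (forall t, D t -> N (c t)) -> smooth_on D (fun t => G (c t) (a t) (b t)).
Proof.
move=> oD sc sa sb cN.
have hEE := hausdorff_pair hE hE.
apply: (conv_smooth_comp (hausdorff_pair hEE hE) hF oD sG.2
  (smooth_on_pair hEE hE oD (smooth_on_pair hE hE oD sc sa) sb)).
by move=> t Dt; split => //; split => //=; exact: cN.
Qed.

Lemma has_cd_L2sym_affine (g h k l h' k' : E) : N g ->
  has_cd (fun t => G (t *: l + g) (t *: h' + h) (t *: k' + k)) 0
    (tvs_derive (fun g => G g h k) g l + G g h' k + G g h k').
Proof.
move=> Ng.
pose D := [set t : R | N (t *: l + g)].
have saff : smooth_on setT (fun t : R => t *: l + g).
  apply: (smooth_onD hE); [exact: openT| |by apply: (smooth_on_cst hE); exact: openT].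
  apply: (smooth_on_scale hE); [exact: openT|exact/smooth_on_id/openT|].
  by apply: (smooth_on_cst hE); exact: openT.
have oD : open D.
  rewrite openE => t Nt; exact: (smooth_on_cvg saff I (open_nbhs_nbhs (conj oN Nt))).
have D0 : D 0 by rewrite /D/= scale0r add0r.
have sg x y : smooth_on D (fun t => G (t *: l + g) x y).
  apply: smooth_on_L2sym => //; first exact: (smooth_on_sub _ saff).
    exact: (smooth_on_cst hE).
  exact: (smooth_on_cst hE).
have cdg x y := has_cd_dn hF 0 (sg x y) D0.
have cdid := @has_cd_id R 0.
pose m u := (G (u *: l + g) h' k + G (u *: l + g) h k') + u *: G (u *: l + g) h' k'.
apply: (@has_cd_near _ _ (fun u => G (u *: l + g) h k + u *: m u)).
  apply: filterS (open_nbhs_nbhs (conj oD D0)) => u Du.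
  have Nu : N (u *: l + g) := Du.
  rewrite L2symDr// !L2symDl// !L2symZr// !L2symZl// /m.
  by move: (G _ h k) (G _ h' k) (G _ h k') (G _ h' k') => x y z w; lmod_eq R.
have cdm : has_cd m 0 (_ + _ + _) :=
  has_cdD (has_cdD (cdg h' k) (cdg h k')) (has_cd_scale cdid (cdg h' k')).
have := has_cdD (cdg h k) (has_cd_scale cdid cdm).
rewrite /= -(tvs_deriveE (fun g => G g h k)) /m !scale0r !add0r !addr0 scale1r addrA.
exact.
Qed.

(** [has_cd_chain] is applied to the joint evaluation on N x E x E and the triple of Hadamard
    slopes; the affine case evaluates the result. *)
Lemma has_cd_L2sym D (c a b : R -> E) t : open D -> smooth_on D c -> smooth_on D a ->
  smooth_on D b -> (forall t, D t -> N (c t)) -> D t ->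
  has_cd (fun t => G (c t) (a t) (b t)) t
    (tvs_derive (fun g => G g (a t) (b t)) (c t) (curve_derive c t)
     + G (c t) (curve_derive a t) (b t) + G (c t) (a t) (curve_derive b t)).
Proof.
move=> oD sc sa sb cN Dt; have hR := @hausdorff_real R.
have [d d0 hd] := ball_real_sub oD Dt.
have oB := @open_ball0_real R d.
have sshift : smooth_on [set u : R | `|u| < d] (fun u => u + t).
  apply: (smooth_onD hR) => //; first exact: smooth_on_id.
  exact: (smooth_on_cst hR).
have had (x : R -> E) : smooth_on D x -> exists s : R -> E,
    [/\ smooth_on [set u | `|u| < d] s, s 0 = curve_derive x t &
      forall u, x (u + t) = u *: s u + x t].
  move=> sx.
  have sx' : smooth_on [set u : R | `|u| < d] (fun u => x (u + t)).
    by apply: (smooth_on_comp hE oB _ sshift sx) => u ud; apply: hd; rewrite addrK.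
  have [s [ss s0 xs]] := hadamard cE d0 sx'; exists s; split => //.
    by rewrite s0 -curve_derive_shift0.
  by move=> u; rewrite xs add0r addrC.
have [sgm1 [ss1 s10 c1]] := had c sc.
have [sgm2 [ss2 s20 a1]] := had a sa.
have [sgm3 [ss3 s30 b1]] := had b sb.
have hEE := hausdorff_pair hE hE.
have ss := smooth_on_pair hEE hE oB (smooth_on_pair hE hE oB ss1 ss2) ss3.
pose O := N `*` [set: E] `*` [set: E].
have oO : open O.
  rewrite openE => -[[g x] y] [/= [/= Ng _] _].
  have c2 : z.1.1 @[z --> (g, x, y)] --> g.
    apply: cvg_comp (@cvg_fst _ _ (nbhs (g, x)) (nbhs y) _) _; exact: cvg_fst.
  have h : nbhs (g, x, y) [set z : E * E * E | N z.1.1].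
    exact: (c2 _ (open_nbhs_nbhs (conj oN Ng))).
  by apply: filterS h => -[[? ?] ?] /= ?; split.
have O0 : O (c t, a t, b t) by split => //; split => //=; exact: cN.
have := has_cd_chain (hausdorff_pair hEE hE) cF oO sG.2 O0 d0 ss.
have haff := has_cd_L2sym_affine (a t) (b t) (sgm1 0) (sgm2 0) (sgm3 0) (cN t Dt).
rewrite /= (curve_deriveE hF haff).
rewrite s10 s20 s30.
have -> : (fun u : R => G (u *: sgm1 u + c t) (u *: sgm2 u + a t) (u *: sgm3 u + b t)) =
    fun u => G (c (u + t)) (a (u + t)) (b (u + t)).
  by apply/funext => u; rewrite c1 a1 b1.
move=> h p sp e e0; apply: filterS (h p sp e e0) => u.
by rewrite !add0r (addrC u t).
Qed.

End ChainRuleBilinear.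

(** * Differentiation under the integral *)

Section Integration.
Context {R : realType}.
Local Notation mu := (@lebesgue_measure R).

(** Slices in the first variable are continuous, and [lip_dn] of order 0 controls the second
    variable uniformly in the first. *)
Lemma csmooth2_continuous {E : tvsType R} (U : set (R * R)) (f : R -> R -> E) u v :
  hausdorff_space E -> open U -> csmooth2 U f -> U (u, v) ->
  f x.1 x.2 @[x --> (u, v)] --> f u v.
Proof.
move=> hE oU sf Uuv; apply/cvg_seminorm => p sp e e0.
have e2 : 0 < e / 2 by rewrite divr_gt0.
have [d d0 [C C0 hC]] := lip_dn hE oU sf 0 Uuv sp.
have C1 : 0 < C + 1 by rewrite ltr_wpDl.
have c1 : x.1 @[x --> (u, v)] --> u by exact: cvg_fst.
have c2 : x.2 @[x --> (u, v)] --> v by exact: cvg_snd.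
have nb1 : \forall x \near (u, v), `|x.1 - u| < d := c1 _ (near_ball_real u d0).
have dm : 0 < Num.min d (e / 2 / (C + 1)) by rewrite lt_min d0 divr_gt0.
have nb2 : \forall x \near (u, v), `|x.2 - v| < Num.min d (e / 2 / (C + 1)) :=
  c2 _ (near_ball_real v dm).
have sl := smooth_on_cvg (@smooth_slice1 _ _ _ _ oU sf v) Uuv.
have nb3 : \forall x \near (u, v), p (f x.1 v - f u v) < e / 2.
  have /cvg_seminorm/(_ p sp _ e2) := sl; exact: c1.
apply: filterS3 nb1 nb2 nb3 => -[x y] /= xd; rewrite lt_min => /andP[yd ye] h3.
have := hC x y v xd yd; rewrite subrr normr0 => /(_ d0) /= h4.
have h5 : C * `|y - v| < e / 2.
  apply: (@le_lt_trans _ _ ((C + 1) * `|y - v|)); first by rewrite ler_wpM2r// lerDl.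
  by rewrite mulrC -ltr_pdivlMr.
have := seminorm_dist (f x y) (f x v) (f u v) sp; lra.
Qed.

Lemma integrable_smooth (I J : set R) (g : R -> R) (a b : R) : smooth_on I g ->
  `[a, b]%classic `<=` I -> J `<=` `[a, b]%classic -> measurable J ->
  mu.-integrable J (EFin \o g).
Proof.
move=> sg abI Jab mJ.
suff : mu.-integrable `[a, b] (EFin \o g) by apply: integrableS => //; exact: measurable_itv.
apply: continuous_compact_integrable; first exact: segment_compact.
apply: continuous_in_subspaceT => t; rewrite inE => /abI It.
exact: (smooth_on_cvg sg It).
Qed.

Lemma segment_in_interval (I C : set R) : is_interval I -> open I -> compact C ->
  C !=set0 -> C `<=` I -> exists a b : R,
  [/\ a < b, `[a, b]%classic `<=` I & C `<=` `]a, b[%classic].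
Proof.
move=> iI oI cC C0 CI.
have idc : {within C, continuous (id : R -> R)} by apply: continuous_subspaceT => x; exact: cvg_id.
have [m /set_mem Cm hm] := compact_EVT_min C0 cC idc.
have [M /set_mem CM hM] := compact_EVT_max C0 cC idc.
have [d d0 hd] := ball_real_sub oI (CI _ Cm).
have [e e0 he] := ball_real_sub oI (CI _ CM).
have mM : m <= M by apply: hM; exact: mem_set.
exists (m - d / 2), (M + e / 2); split; first lra.
- move=> t /=; rewrite in_itv/= => /andP[t1 t2]; apply: (iI (m - d / 2) (M + e / 2)).
  + apply: hd; rewrite addrAC subrr add0r normrN gtr0_norm; lra.
  + apply: he; rewrite addrAC subrr add0r gtr0_norm; lra.
  + by rewrite t1.
- move=> t Ct /=; rewrite in_itv/=.
  have := hm t (mem_set Ct); have := hM t (mem_set Ct) => /= h1 h2.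
  by apply/andP; split; lra.
Qed.

(** The dominating function is constant: the maximum of the absolute value of the partial derivative
    on the compact set [-1, 1] x [a, b]. *)
Lemma has_cd_integral (f : R -> R -> R) (I J : set R) (a b : R) :
  open I -> csmooth2 (setT `*` I) f -> a <= b -> `[a, b]%classic `<=` I ->
  J `<=` `[a, b]%classic -> measurable J ->
  has_cd (fun s => \int[mu]_(t in J) f s t) 0
    (\int[mu]_(t in J) curve_derive (f ^~ t) 0).
Proof.
move=> oI sf ab abI Jab mJ; have cR := @complete_real R.
have oU := open_strip oI.
have JI : J `<=` I by move=> t /Jab /abI.
have sd1 := csmooth2_d1 cR oU sf.
have der s t : J t -> has_cd (f ^~ t) s (curve_derive (f ^~ t) s).
  move=> /JI It.
  exact: (has_cd_dn cR.1 0 (@smooth_slice1 _ _ _ _ oU sf t) (conj Logic.I It)).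
have d1E s t : J t -> (f ^~ t)^`()%classic s = curve_derive (f ^~ t) s.
  by move=> /(der s) /has_cd_derive h; rewrite derive1E; have [_ ->] := h.
have cc : compact (`[(-1 : R), 1]%classic `*` `[a, b]%classic).
  by apply: compact_setX; exact: segment_compact.
have cont : {within `[(-1 : R), 1]%classic `*` `[a, b]%classic,
    continuous (fun x : R * R => `|curve_derive (f ^~ x.2) x.1|)}.
  apply: continuous_in_subspaceT => -[s t] /set_mem[/= _ /abI It].
  apply: (@continuous_comp _ _ _ (fun x : R * R => curve_derive (f ^~ x.2) x.1) Num.norm).
    exact: (csmooth2_continuous cR.1 oU sd1).
  exact: norm_continuous.
have ne : (`[(-1 : R), 1]%classic `*` `[a, b]%classic) !=set0.
  by exists (0, a); split; rewrite /= in_itv/= ?lexx// oppr_le0 ler01.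
have [x0 _ hx0] := compact_EVT_max ne cc cont.
set M := `|_| in hx0.
have := @cvg_differentiation_under_integral R _ _ mu f J mJ 0 (-1) 1.
have I0 : `](-1 : R), 1[%classic (0 : R) by rewrite /= in_itv/= oppr_lt0 ltr01.
have intf s : `](-1 : R), 1[%classic s -> mu.-integrable J (EFin \o f s).
  move=> _; apply: (integrable_smooth _ abI) => //.
  by apply: (smooth_on_sub _ (@smooth_slice2 _ _ _ _ oU sf s)).
have derf s t : `](-1 : R), 1[%classic s -> J t -> derivable (f ^~ t) s 1.
  by move=> _ /(der s) /has_cd_derive [].
have intM : mu.-integrable J (EFin \o (fun=> M)).
  apply: (@integrable_smooth setT _ _ a b) => //.
  by apply: (smooth_on_cst cR.1); exact: openT.
have ub s t : `](-1 : R), 1[%classic s -> J t -> `|(f ^~ t)^`()%classic s| <= M.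
  move=> /= ; rewrite in_itv/= => /andP[s1 s2] Jt; rewrite d1E//.
  apply: (hx0 (s, t)); apply/mem_set; split => /=; last exact: Jab.
  by rewrite in_itv/= !ltW.
move=> /(_ I0 intf derf (fun=> M) (fun=> normr_ge0 _) intM ub) h.
apply/has_cdP; have -> : \int[mu]_(t in J) curve_derive (f ^~ t) 0 =
    \int[mu]_(y in J) (f ^~ y)^`()%classic 0.
  by apply: eq_Rintegral => t /set_mem Jt; rewrite d1E.
rewrite (_ : (fun _ => _) = fun x : R => x^-1 *:
  (\int[mu]_(t in J) f (x + 0) t - \int[mu]_(t in J) f 0 t)); first exact: h.
apply/funext => x; by have -> : x *: (1 : R) = x := mulr1 x.
Qed.

(** [J] need not be an interval, so the integral is first extended to [a, b], where the derivative
    vanishes off [J], and the fundamental theorem is used there. *)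
Lemma integral_derive_compact (I J : set R) (g : R -> R) (a b : R) : open I ->
  smooth_on I g -> a < b -> `[a, b]%classic `<=` I -> J `<=` `]a, b[%classic ->
  measurable J -> g a = 0 -> g b = 0 ->
  (forall t, I t -> ~ J t -> curve_derive g t = 0) ->
  \int[mu]_(t in J) curve_derive g t = 0.
Proof.
move=> oI sg ab abI Jab mJ ga gb g0; have hR := @hausdorff_real R.
have JE : J = `[a, b]%classic `&` J.
  apply/seteqP; split => [t Jt|t []//]; split => //.
  by apply: subset_itv_oo_cc; exact: Jab.
rewrite JE Rintegral_mkcondr.
have -> : \int[mu]_(t in `[a, b]) (curve_derive g \_ J) t =
    \int[mu]_(t in `[a, b]) curve_derive g t.
  apply: eq_Rintegral => t /set_mem tab; rewrite patchE; case: ifPn => // /negP tJ.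
  by rewrite g0 //; [exact: abI|move=> Jt; apply: tJ; exact: mem_set].
have cg t : `[a, b]%classic t -> g u @[u --> t] --> g t.
  by move=> /abI It; exact: smooth_on_cvg sg It.
have der t : `[a, b]%classic t -> is_derive t 1 g (curve_derive g t).
  by move=> /abI It; apply/has_cd_derive; exact: (has_cd_dn hR 0 sg It).
rewrite /Rintegral (@continuous_FTC2 _ _ g) //.
- by rewrite ga gb -EFinB subrr.
- apply: continuous_in_subspaceT => t /set_mem /abI It.
  exact: (smooth_on_cvg (smooth_on_derive sg) It).
- split.
  + by move=> t tab; have [] := der t (subset_itv_oo_cc tab).
  + by apply: cvg_at_right_filter; apply: cg; rewrite /= in_itv/= lexx ltW.
  + by apply: cvg_at_left_filter; apply: cg; rewrite /= in_itv/= lexx ltW.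
- move=> t tab; rewrite derive1E.
  by have [_ ->] := der t (subset_itv_oo_cc tab).
Qed.

Lemma integral_pos (I J : set R) (g : R -> R) (a b t0 : R) : smooth_on I g ->
  `[a, b]%classic `<=` I -> J `<=` `[a, b]%classic -> open J -> J t0 ->
  (forall t, J t -> 0 <= g t) -> 0 < g t0 ->
  0 < \int[mu]_(t in J) g t.
Proof.
move=> sg abI Jab oJ Jt0 g0 gt0; have mJ := measurable_realfun.open_measurable oJ.
have gc := smooth_on_cvg sg (abI _ (Jab _ Jt0)).
have e0 : 0 < g t0 / 2 by rewrite divr_gt0.
have /nbhs_ballP[e /= e_gt0 he] : nbhs t0 [set t | g t0 / 2 < g t].
  exact: (gc _ (lt_nbhsr (ltac:(lra) : g t0 / 2 < g t0))).
have [d d0 hd] := ball_real_sub oJ Jt0.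
pose r := Num.min (d / 2) (e / 2).
have r0 : 0 < r by rewrite lt_min !divr_gt0.
pose S : set R := [set` `[t0 - r, t0 + r]].
have Sr t : S t -> `|t - t0| <= r.
  by rewrite /S /= in_itv/= ler_distl.
have SJ : S `<=` J.
  move=> t /Sr tr; apply: hd; apply: le_lt_trans tr _; rewrite gt_min; apply/orP; left; lra.
have mS : measurable S by exact: measurable_itv.
have intJ := integrable_smooth sg abI Jab mJ.
have sub : \int[mu]_(t in S) g t <= \int[mu]_(t in J) g t.
  rewrite -[in leRHS](setDUK SJ) Rintegral_setU //; first last.
  - by apply/disj_setPS => t [? []].
  - by rewrite setDUK.
  - exact: measurableD.
  rewrite lerDl; apply: Rintegral_ge0 => t [Jt _]; exact: g0.
apply: lt_le_trans sub.
apply: (@lt_le_trans _ _ (\int[mu]_(t in S) (g t0 / 2))).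
  rewrite Rintegral_cst//; apply: mulr_gt0 => //.
  have := @lebesgue_measure_itv R `[t0 - r, t0 + r]; rewrite -/S /= => ->.
  rewrite lte_fin ifT; last by lra.
  by rewrite -EFinB /=; lra.
have Sab : S `<=` `[a, b]%classic by move=> t /SJ /Jab.
apply: le_Rintegral => //.
- apply: (@integrable_smooth setT _ _ a b) => //.
  by apply: (smooth_on_cst (@hausdorff_real R)); exact: openT.
- exact: (integrable_smooth sg abI).
move=> t /Sr tr; apply/ltW/he; rewrite /ball/= distrC.
apply: le_lt_trans tr _; rewrite gt_min; apply/orP; right; lra.
Qed.

End Integration.

(** * The first variation of the action *)

Section Variations.
Context {R : realType} {E : frechetType R}.
Variables (N : set E) (G : E -> E -> E -> R) (Gamma : E -> E -> E -> E).
Variables (V : E -> R) (gradV : E -> E).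
Hypotheses (oN : open N) (hG : weak_pseudo_riemannian_LC N G Gamma).
Hypotheses (hV : conv_smooth N V) (hgrad : is_G_gradient N G V gradV).
Variables (I : set R) (c : R -> E).
Hypotheses (oI : open I) (iI : is_interval I).
Hypotheses (hcN : forall t, I t -> N (c t)) (hc : conv_smooth I c).

Local Notation mu := (@lebesgue_measure R).
Local Notation L := (mechanical_lagrangian G V).

Let cE : complete_tvs E := complete_frechet E.
Let cR : complete_tvs R := complete_real.
Let hE := cE.1.
Let hR := cR.1.
Let sG : smooth_L2sym N G := metric_smooth hG.

Lemma smooth_on_curve : smooth_on I c.
Proof.
exact: (conv_smooth_comp hR hE oI hc (smooth_on_id oI)).
Qed.

Let oS := open_strip oI.
Let sc := smooth_on_curve.
Let sc' := smooth_on_derive sc.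

Definition defect (t : R) : E := covariant_derive Gamma c (curve_derive c) t + gradV (c t).

Lemma smooth_defect : smooth_on I defect.
Proof.
apply: (smooth_onD hE oI); last exact: (conv_smooth_comp hE hE oI hgrad.1 sc).
apply: (smooth_onB hE oI); first exact: smooth_on_derive.
exact: (smooth_on_L2sym cE cE (christoffel_smooth hG)).
Qed.

Section OneVariation.
Variables (cs : R -> R -> E) (K : set R).
Hypothesis var : compact_variation N I c cs K.

Let csN s t : I t -> N (cs s t).
Proof. by case: var => _ h _ _ _; exact: h. Qed.

Let cs0 t : I t -> cs 0 t = c t.
Proof. by case: var => _ _ h _ _; exact: h. Qed.

Lemma csmooth2_variation : csmooth2 ([set: R] `*` I) cs.
Proof. by case: var => h _ _ _ _; exact: (conv_smooth_csmooth2 hE h). Qed.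

Let scs := csmooth2_variation.

Lemma smooth_generator : smooth_on I (generator cs).
Proof.
have sd1 := csmooth2_d1 cE oS scs.
by apply: (smooth_on_sub _ (@smooth_slice2 _ _ _ _ oS sd1 0)) => t It.
Qed.

Lemma csmooth2_lagrangian : csmooth2 ([set: R] `*` I)
  (fun s t => L (cs s t) (curve_derive (cs s) t)).
Proof.
have sd2 := csmooth2_d2 cE oS scs.
move=> D a b oD sa sb DI.
have scs' := scs oD sa sb DI; have sd2' := sd2 _ _ _ oD sa sb DI.
have csN' t : D t -> N (cs (a t) (b t)) by move=> /DI[_ /csN]; exact.
apply: (smooth_onB hR oD).
  by apply: (smooth_onZ hR) => //; exact: (smooth_on_L2sym cE cR sG).
exact: (conv_smooth_comp hE hR oD hV scs').
Qed.

Lemma generator_outside t : I t -> ~ K t -> generator cs t = 0.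
Proof.
move=> It nK; case: var => _ _ _ _ h; apply: (curve_deriveE hE).
rewrite (_ : (fun s => _) = fun=> c t); first exact: has_cd_cst.
by apply/funext => s; exact: h.
Qed.

(* Its derivative is the boundary term of the integration by parts. *)
Definition momentum (t : R) : R := G (c t) (curve_derive c t) (generator cs t).

Lemma smooth_momentum : smooth_on I momentum.
Proof. exact: (smooth_on_L2sym cE cR sG oI sc sc' smooth_generator hcN). Qed.

Lemma first_variation_density t : I t ->
  curve_derive (fun s => L (cs s t) (curve_derive (cs s) t)) 0 =
  curve_derive momentum t - G (c t) (defect t) (generator cs t).
Proof.
move=> It; have sd2 := csmooth2_d2 cE oS scs.
have St : ([set: R] `*` I) (0, t) by [].
have oSt := @open_slice1 R _ oS t.
have s1 := @smooth_slice1 _ _ _ _ oS scs t.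
have s2 := @smooth_slice1 _ _ _ _ oS sd2 t.
set A := generator cs t; set c' := curve_derive c t.
set A' := curve_derive (generator cs) t.
have c'E : curve_derive (cs 0) t = c'.
  by apply: curve_derive_near; apply: filterS (open_nbhs_nbhs (conj oI It)) => u; exact: cs0.
have A'E : curve_derive (fun s => curve_derive (cs s) t) 0 = A'.
  exact: (d1_d2 cE oS scs St).
have hkin := has_cd_L2sym cE cR oN sG oSt s1 s2 s2 (fun s Ss => @csN s t Ss.2) St.
have hpot := has_cd_comp_conv cE cR oN oSt hV s1 (fun s Ss => @csN s t Ss.2) St.
have hL := curve_deriveE hR (has_cdB (has_cdZ 2^-1 hkin) hpot).
rewrite [LHS]hL /= {hL hkin hpot} A'E cs0// c'E -[curve_derive (cs^~ t) 0]/A.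
have hmom := has_cd_L2sym cE cR oN sG oI sc sc' smooth_generator hcN It.
rewrite [curve_derive momentum t](curve_deriveE hR hmom) -/c' -/A -/A' {hmom}.
have Nt := hcN It.
have -> := hgrad.2 _ Nt A.
(* The first instance turns half the variation of the metric into -G(Gamma(A, c'), c'). The second,
   applied to the derivative of the momentum, yields this same term and the [Gamma] term of the
   covariant derivative. *)
have lc1 := levi_civita hG Nt A c' c'; have lc2 := levi_civita hG Nt c' c' A.
rewrite /defect /covariant_derive -/c'.
set c'' := curve_derive (curve_derive c) t.
have GN x : G (c t) (- x) A = - G (c t) x A.
  by rewrite -scaleN1r (L2symZl sG _ _ _ Nt) [_ *: _]mulN1r.
rewrite !(L2symDl sG _ _ _ Nt) GN.
have Gs := @L2symC _ _ _ _ _ sG (c t).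
rewrite (Gs c' (Gamma _ _ _) Nt) in lc1.
rewrite (Gs A' c' Nt).
rewrite (L2symC (christoffel_smooth hG) c' A Nt) (Gs c' (Gamma _ _ _) Nt) in lc2.
rewrite /GRing.scale /=; lra.
Qed.

Lemma momentum_outside t : I t -> ~ K t -> momentum t = 0.
Proof.
move=> It nK; rewrite /momentum (generator_outside It nK) -(scale0r (0 : E)).
by rewrite (L2symZr sG)// ?scale0r//; exact: hcN.
Qed.

(** [K] is closed, so [momentum] vanishes on a neighbourhood of [t] and not merely at [t]. *)
Lemma derive_momentum_outside t : I t -> ~ K t -> curve_derive momentum t = 0.
Proof.
move=> It nK; case: (var) => _ _ _ [cK _] _.
have oK : open (~` K) by apply: closed_openC; apply: compact_closed cK; exact: hR.
rewrite (@curve_derive_near _ _ momentum (fun=> 0)).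
  by apply: (curve_deriveE hR); exact: has_cd_cst.
apply: filterS2 (open_nbhs_nbhs (conj oI It)) (open_nbhs_nbhs (conj oK nK)) => u.
exact: momentum_outside.
Qed.

Lemma relatively_compact_sub_segment J : relatively_compact_open I J -> J !=set0 ->
  exists a b : R, [/\ a < b, `[a, b]%classic `<=` I & J `<=` `]a, b[%classic].
Proof.
case=> _ cJ JI [t Jt].
have [||a [b [ab abI Jab]]] := segment_in_interval iI oI (C := closure J) _ _ JI.
- by rewrite -precompactE.
- by exists t; exact: subset_closure.
by exists a, b; split => // u /subset_closure /Jab.
Qed.

Lemma first_variation J : relatively_compact_open I J -> K `<=` J ->
  is_derive (0 : R) (1 : R) (fun s => action L J (cs s))
    (- \int[mu]_(t in J) G (c t) (defect t) (generator cs t)).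
Proof.
(* The segment around [J] is obtained from extremal points of its closure, so the empty set is
   treated apart. *)
move=> rJ KJ; have [J0|Jne] := pselect (J = set0).
  have -> : (fun s => action L J (cs s)) = fun=> 0.
    by apply/funext => s; rewrite /action J0 Rintegral_set0.
  by rewrite J0 Rintegral_set0 oppr0; exact: is_derive_cst.
have {}Jne : J !=set0 by apply/set0P/eqP.
have [a [b [ab abI Jab]]] := relatively_compact_sub_segment rJ Jne.
have Jab' : J `<=` `[a, b]%classic by move=> t /Jab; exact: subset_itv_oo_cc.
have [oJ _ _] := rJ; have mJ := measurable_realfun.open_measurable oJ.
have h := has_cd_integral oI csmooth2_lagrangian (ltW ab) abI Jab' mJ.
apply/has_cd_derive; move: h; congr (has_cd _ _ _).
have sdef := smooth_on_L2sym cE cR sG oI sc smooth_defect smooth_generator hcN.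
have smom := smooth_momentum.
rewrite (@eq_Rintegral _ _ _ mu _ (fun t => curve_derive momentum t -
    G (c t) (defect t) (generator cs t))); last first.
  by move=> t /set_mem /Jab' /abI It; exact: first_variation_density.
rewrite RintegralB//; last 2 first.
- exact: (integrable_smooth (smooth_on_derive smom) abI).
- exact: (integrable_smooth sdef abI).
rewrite (integral_derive_compact oI smom ab abI Jab mJ) ?sub0r//.
(* [J] lies in the open interval, so both end points are outside [K] and the boundary term
   vanishes. *)
- apply: momentum_outside => [|/KJ /Jab]; first by apply: abI; rewrite /= in_itv/= lexx ltW.
  by rewrite /= in_itv/= ltxx.
- apply: momentum_outside => [|/KJ /Jab]; first by apply: abI; rewrite /= in_itv/= lexx ltW.
  by rewrite /= in_itv/= ltxx andbF.
- by move=> t It nJ; apply: derive_momentum_outside => // /KJ.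
Qed.

End OneVariation.

(** The variation is c(t) + kap(s) b(t) k. It must stay in [N] for every real [s], so [s] enters
    through a bounded [kap]; as [kap] is the identity near 0, the generator is not affected. *)
Lemma bump_variation (t0 : R) (k : E) (U : set R) : I t0 -> open U -> U t0 ->
  exists cs K (b : R -> R), [/\ compact_variation N I c cs K,
    forall t, generator cs t = b t *: k, forall t, 0 <= b t, b t0 = 1 &
    forall t, b t != 0 -> U t].
Proof.
move=> It0 oU Ut0.
have [d1 d1_gt0 hd1] := ball_real_sub oU Ut0.
have [d2 d2_gt0 hd2] := ball_real_sub oI It0.
have cN : nbhs (t0, 0 : R) [set x : R * R | N (c x.1 + x.2 *: k)].
  have c1 : x.1 @[x --> (t0, 0 : R)] --> t0 by exact: cvg_fst.
  have c2 : x.2 @[x --> (t0, 0 : R)] --> (0 : R) by exact: cvg_snd.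
  have c3 : c x.1 @[x --> (t0, 0 : R)] --> c t0 by apply: cvg_comp c1 (smooth_on_cvg sc It0).
  have c4 : x.2 *: k @[x --> (t0, 0 : R)] --> (0 : R) *: k.
    apply: (@cvg_comp _ _ _ (fun x : R * R => (x.2, k)) (fun y : R * E => y.1 *: y.2)
      _ _ _ (cvg_pair c2 (cvg_cst k))).
    exact: (@scale_continuous R E (0, k)).
  have c5 : c x.1 + x.2 *: k @[x --> (t0, 0 : R)] --> c t0 + (0 : R) *: k.
    apply: (@cvg_comp _ _ _ (fun x : R * R => (c x.1, x.2 *: k))
      (fun y : E * E => y.1 + y.2) _ _ _ (cvg_pair c3 c4)).
    exact: (@add_continuous E (c t0, (0 : R) *: k)).
  apply: (c5 N); rewrite scale0r addr0; exact: open_nbhs_nbhs (conj oN (hcN It0)).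
have [[A B] /= [nA nB] AB] := cN.
have /nbhs_ballP[d3 /= d3_gt0 hd3] := nA.
have /nbhs_ballP[d4 /= d4_gt0 hd4] := nB.
have [b [sb b1 b0 bge0]] := @smooth_bump R.
have [M M0 hM] := dn_compact_bounded 0 sb b0.
(* With this bound on [kap] and [M] on the bump, their product stays in the ball of radius [d4]. *)
have dM : 0 < d4 / (M + 1) by rewrite divr_gt0// ltr_wpDl.
have [kap [skap kapd [r r0 kapr]]] := smooth_cutoff dM.
pose d := Num.min d1 (Num.min d2 d3).
have d_gt0 : 0 < d by rewrite !lt_min d1_gt0 d2_gt0.
(* The rescaled bump vanishes from distance 2 w on, so a third of [d] keeps the closed set [K]
   inside the open ball of radius [d]. *)
pose w := d / 3.
have w0 : 0 < w by rewrite divr_gt0.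
pose bt t := b (w^-1 * (t - t0)).
have bt0 t : d <= `|t - t0| -> bt t = 0.
  move=> td; apply: b0; rewrite normrM gtr0_norm ?invr_gt0// mulrC ler_pdivlMr//.
  rewrite /w; lra.
pose cs s t := c t + (kap s * bt t) *: k.
pose K := [set t | `|t - t0| <= 2 * w].
have Kd t : K t -> `|t - t0| < d by rewrite /K/= => h; apply: le_lt_trans h _; rewrite /w; lra.
have btK t : ~ K t -> bt t = 0.
  move=> nK; apply: b0; rewrite normrM gtr0_norm ?invr_gt0// mulrC ler_pdivlMr//.
  by rewrite leNgt; apply/negP => /ltW.
have kap0 : kap 0 = 0 by rewrite kapr ?normr0.
have btd t : bt t != 0 -> `|t - t0| < d.
  by move=> bt_t; rewrite ltNge; apply/negP => /bt0 h; rewrite h eqxx in bt_t.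
have sbt D : open D -> smooth_on D bt.
  move=> oD; apply: (smooth_on_comp hR oD (fun _ _ => Logic.I) _ sb).
  apply: (smooth_onZ hR _ oD); apply: (smooth_onB hR oD); first exact: smooth_on_id.
  exact: (smooth_on_cst hR).
exists cs, K, bt; split => //.
- split.
  + move=> gam /smooth_curveP sgam gI; apply/smooth_curveP.
    have s1 := smooth_on_fst hR hR openT sgam.
    have s2 := smooth_on_snd hR hR openT sgam.
    apply: (smooth_onD hE openT).
      by apply: (smooth_on_comp hE openT _ s2 sc) => t _; have [] := gI t.
    apply: (smooth_on_scale hE openT); last by apply: (smooth_on_cst hE); exact: openT.
    apply: smooth_onM; first exact: openT.
      exact: (smooth_on_comp hR openT (fun _ _ => Logic.I) s1 skap).
    exact: (smooth_on_comp hR openT (fun _ _ => Logic.I) s2 (sbt _ openT)).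
  + move=> s t It; rewrite /cs.
    have [->|/btd] := eqVneq (bt t) 0; first by rewrite mulr0 scale0r addr0; exact: hcN.
    rewrite !lt_min => /and3P[_ _ td]; apply: (AB (t, kap s * bt t)); split => /=.
      by apply: hd3; rewrite /ball/= distrC.
    apply: hd4; rewrite /ball/= sub0r normrN normrM.
    apply: (@le_lt_trans _ _ (`|kap s| * (M + 1))).
      by rewrite ler_wpM2l//; apply: le_trans (hM _) _; rewrite lerDl.
    by rewrite -ltr_pdivlMr ?kapd// ltr_wpDl.
  + by move=> t It; rewrite /cs kap0 mul0r scale0r addr0.
  + split; last first.
      by move=> t /Kd; rewrite !lt_min => /and3P[_ h _]; exact: hd2.
    have -> : K = `[t0 - 2 * w, t0 + 2 * w]%classic.
      by apply/seteqP; split => t; rewrite /K /= in_itv/= ler_distl.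
    exact: segment_compact.
  + by move=> s t It /btK bt_t; rewrite /cs bt_t mulr0 scale0r addr0.
- move=> t; apply: (curve_deriveE hE); rewrite /cs.
  have hk : has_cd kap 0 (1 : R).
    apply: has_cd_near (has_cd_id 0); apply: filterS (near_ball_real (0 : R) r0) => u.
    by rewrite subr0 => /kapr.
  have h := has_cd_scale hk (has_cd_cst (bt t) 0); rewrite scaler0 addr0 in h.
  have := has_cdD (has_cd_cst (c t) 0) (has_cd_scale h (has_cd_cst k 0)).
  by rewrite scaler0 addr0 add0r scale1r.
- by move=> t; exact: bge0.
- by rewrite /bt subrr mulr0 b1// normr0.
- by move=> t /btd; rewrite !lt_min => /and3P[h _ _]; exact: hd1.
Qed.

Lemma critical_defect : critical L N I c <-> forall t, I t -> defect t = 0.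
Proof.
split=> [crit t0 It0|h cs K var].
  apply: (metric_nondegenerate hG (hcN It0)) => k.
  apply: contrapT => /eqP Gk.
  have {k Gk} [k Gk] : exists k, 0 < G (c t0) (defect t0) k.
    have [Gp|Gn|G0] := ltgtP 0 (G (c t0) (defect t0) k); first by exists k.
      exists (- k); rewrite -scaleN1r (L2symZr sG _ _ _ (hcN It0)).
      by rewrite [_ *: _]mulN1r oppr_gt0.
    by rewrite -G0 eqxx in Gk.
  have scst D : open D -> smooth_on D (fun=> k) by move=> oD; exact: (smooth_on_cst hE).
  have sg := smooth_on_L2sym cE cR sG oI sc smooth_defect (scst I oI) hcN.
  (* On [U] the pairing with the constant [k] is positive, so a nonnegative bump that vanishes off
     [U] makes the integrand nonnegative. *)
  pose U := [set t | I t /\ 0 < G (c t) (defect t) k].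
  have oU : open U.
    rewrite openE => t [It gt]; apply: filterI; first exact: open_nbhs_nbhs (conj oI It).
    exact: (smooth_on_cvg sg It (lt_nbhsr gt)).
  have [cs [K [b [var gen b0 b1 bU]]]] := bump_variation k It0 oU (conj It0 Gk).
  have [J [rJ KJ dJ]] := crit cs K var.
  have dJ' := first_variation var rJ KJ.
  have int0 : \int[mu]_(t in J) G (c t) (defect t) (generator cs t) = 0.
    apply/eqP; rewrite -oppr_eq0; apply/eqP.
    by have [_ <-] := dJ'; have [_ ->] := dJ.
  have genE t : I t -> G (c t) (defect t) (generator cs t) = b t * G (c t) (defect t) k.
    by move=> It; rewrite gen (L2symZr sG _ _ _ (hcN It)).
  (* Criticality hands over a [J] known only to contain [K]; [t0] is in [K] because the generator
     there is [k], which is nonzero. *)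
  have Jt0 : J t0.
    apply: KJ; apply: contrapT => nK.
    have := generator_outside var It0 nK; rewrite gen b1 scale1r => k0.
    move: Gk; rewrite k0 -(scale0r (0 : E)) (L2symZr sG _ _ _ (hcN It0)).
    by rewrite scale0r ltxx.
  have [a' [b' [ab abI Jab]]] := relatively_compact_sub_segment rJ (ex_intro _ t0 Jt0).
  have Jab' : J `<=` `[a', b']%classic by move=> t /Jab; exact: subset_itv_oo_cc.
  have sdef := smooth_on_L2sym cE cR sG oI sc smooth_defect (smooth_generator var) hcN.
  have [oJ _ _] := rJ.
  have := integral_pos sdef abI Jab' oJ Jt0; rewrite int0 ltxx => H.
  suff : false by [].
  apply: H; last by rewrite genE// b1 mul1r.
  move=> t /Jab' /abI It; rewrite genE//.
  have [->|/bU[_ gt]] := eqVneq (b t) 0; first by rewrite mul0r.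
  by rewrite mulr_ge0// ltW.
(* An admissible [J] has to be exhibited: an open interval around [K] whose closure stays in [I], or
   the empty set if [K] is empty. *)
have [J rJ KJ] : exists2 J, relatively_compact_open I J & K `<=` J.
  case: (var) => _ _ _ [cK KI] _.
  have [K0|Kne] := pselect (K = set0).
    exists set0; last by rewrite K0.
    by split; [exact: open0|rewrite precompactE closure0; exact: compact0|rewrite closure0].
  have {}Kne : K !=set0 by apply/set0P/eqP.
  have [a [b [ab abI Kab]]] := segment_in_interval iI oI cK Kne KI.
  exists (`]a, b[%classic) => //.
  have clJ : closure (`]a, b[%classic : set R) `<=` `[a, b]%classic.
    have : closed (`[a, b]%classic : set R) by exact: interval_closed.
    by move=> /closure_id ->; apply: closure_subset; exact: subset_itv_oo_cc.
  split; [exact: interval_open| |by move=> t /clJ /abI].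
  rewrite precompactE; apply: subclosed_compact clJ; last exact: segment_compact.
  exact: closed_closure.
exists J; split => //; have := first_variation var rJ KJ; congr is_derive.
have [_ _ JI] := rJ.
rewrite (@eq_Rintegral _ _ _ mu _ (fun=> 0)); last first.
  move=> t /set_mem /subset_closure /JI It.
  by rewrite h// -(scale0r (0 : E)) (L2symZl sG _ _ _ (hcN It)) scale0r.
have [oJ _ _] := rJ.
by rewrite Rintegral_cst ?mul0r ?oppr0//; exact: measurable_realfun.open_measurable.
Qed.

End Variations.

Unset Implicit Arguments.
Set Strict Implicit.
Set Printing Implicit Defensive.

Theorem theorem3p11 (R : realType) (E : frechetType R) (N : set E)
    (hN : open N)
    (G : E -> E -> E -> R) (Gamma : E -> E -> E -> E)
    (hG : weak_pseudo_riemannian_LC N G Gamma)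
    (V : E -> R) (hV : conv_smooth N V)
    (gradV : E -> E) (hgrad : is_G_gradient N G V gradV)
    (I : set R) (hIo : open I) (hIi : is_interval I)
    (c : R -> E) (hcN : forall t, I t -> N (c t)) (hc : conv_smooth I c) :
  (forall (cs : R -> R -> E) (K J : set R),
     compact_variation N I c cs K ->
     relatively_compact_open I J -> K `<=` J ->
     is_derive (0 : R) (1 : R)
       (fun s => action (mechanical_lagrangian G V) J (cs s))
       (- (\int[lebesgue_measure]_(t in J)
             G (c t) (covariant_derive Gamma c (curve_derive c) t + gradV (c t))
               (generator cs t))))
  /\ (critical (mechanical_lagrangian G V) N I c <->
      forall t, I t ->
        covariant_derive Gamma c (curve_derive c) t = - gradV (c t))
  /\ ((forall t, I t ->
        covariant_derive Gamma c (curve_derive c) t = - gradV (c t)) <->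
      (forall t, I t ->
        curve_derive (curve_derive c) t =
          Gamma (c t) (curve_derive c t) (curve_derive c t) - gradV (c t))).
Proof.
have crit := critical_defect hN hG hV hgrad hIo hIi hcN hc.
split; [|split].
- move=> cs K J var rJ KJ; exact: (first_variation hN hG hV hgrad hIo hIi hcN hc var rJ KJ).
- split=> [/crit h t It|h].
    by apply/eqP; rewrite -addr_eq0; apply/eqP; exact: h.
  by apply/crit => t It; rewrite /defect h// addNr.
- split=> h t It; have := h t It; rewrite /covariant_derive.
    by move=> /eqP; rewrite subr_eq addrC => /eqP.
  by move=> ->; rewrite addrAC subrr sub0r.
Qed.
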